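(* Let $k,\gamma\in\mathbb{N}$, let $u^{(1)},\ldots,u^{(\gamma)}$ be orthonormal vectors in $\ell^2(\mathbb{R})$, and let $p_1,\ldots,p_\gamma\in\mathbb{R}$. Let $f\colon\mathbb{R}^k\to\mathbb{R}$ be a bounded continuous function. Then $$\lim_{n\to\infty}\int_{S_{A_n}} f\,d\bar\sigma=\int_{\mathbb{R}^k} f\,d\mu_{\bar\eta,u^{(1)},\ldots,u^{(\gamma)}}.$$
   Context: For a sequence $x=(x_1,x_2,\ldots)$ write $x_{(n)}=(x_1,\ldots,x_n)\in\mathbb{R}^n$. For $n\in\mathbb{N}$ let $A_n=\{x\in\mathbb{R}^n:\langle x,(u^{(i)})_{(n)}\rangle=p_i\text{ for all }1\le i\le\gamma\}$, let $S^{n-1}(\sqrt n)$ be the sphere of radius $\sqrt n$ centered at the origin of $\mathbb{R}^n$, and let $S_{A_n}=S^{n-1}(\sqrt n)\cap A_n$. For all sufficiently large $n$ this is a sphere (of dimension $n-\gamma-1$) in $A_n$, and $\bar\sigma$ denotes its uniform (normalized to total mass $1$) surface area measure. A function $f$ on $\mathbb{R}^k$ is regarded as a function on $\mathbb{R}^n$, $n\ge k$, by applying it to the first $k$ coordinates. For a vector $x$, $P_x$ is the orthogonal projection onto the span of $x$. Put $\bar\eta=p_1(u^{(1)})_{(k)}+\cdots+p_\gamma(u^{(\gamma)})_{(k)}$. Then $\mu_{\bar\eta,u^{(1)},\ldots,u^{(\gamma)}}$ is the (possibly degenerate) Gaussian measure on $\mathbb{R}^k$ with mean $\bar\eta$ and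 covariance $I_k-\sum_{i=1}^{\gamma}\|(u^{(i)})_{(k)}\|^2P_{(u^{(i)})_{(k)}}$. *)

(* Defs.v *)
From HB Require Import structures.
From mathcomp Require Import all_boot all_order all_algebra.
From mathcomp Require Import all_classical all_reals all_analysis.

Set Implicit Arguments.
Unset Strict Implicit.
Unset Printing Implicit Defensive.

Import Order.TTheory GRing.Theory Num.Theory.
Import numFieldNormedType.Exports.

Local Open Scope classical_set_scope.
Local Open Scope ring_scope.

Section euclidean.
Context {R : realType}.

Definition dot n (x y : 'rV[R]_n) : R := \sum_i x 0 i * y 0 i.

(* The norm carried by 'rV[R]_n in MathComp-Analysis is the sup norm, hence
   the separate Euclidean norm. *)
Definition enorm n (x : 'rV[R]_n) : R := Num.sqrt (dot x x).

Definition esphere n (r : R) : set 'rV[R]_n := [set x | enorm x = r].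

(* Orthogonal projection onto the span of x, as a matrix acting on row vectors
   (v |-> v *m proj_span x): kermx x^T is the orthogonal complement of x. *)
Definition proj_span n (x : 'rV[R]_n) : 'M[R]_n :=
  proj_mx <<x>>%MS (kermx x^T).

End euclidean.

(* A sequence (x_1, x_2, ...) is a function nat -> R, with x_(j+1) at index j. *)
Section sequences_and_truncations.
Context {R : realType}.

Definition square_summable (v : nat -> R) : Prop :=
  cvgn (series (fun j => v j ^+ 2)).

Definition l2dot (v w : nat -> R) : R := limn (series (fun j => v j * w j)).

Definition l2_orthonormal (I : finType) (u : I -> nat -> R) : Prop :=
  (forall i, square_summable (u i)) /\
  (forall i j, l2dot (u i) (u j) = (i == j)%:R).

Definition trunc n (v : nat -> R) : 'rV[R]_n := \row_(j < n) v j.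

(* The first k coordinates of x; missing coordinates are 0 if n < k. *)
Definition first_coords k n (x : 'rV[R]_n) : 'rV[R]_k :=
  \row_(j < k) (if insub (j : nat) is Some i then x 0 i else 0).

End sequences_and_truncations.

(* The d-dimensional Hausdorff measure on R^n for the Euclidean distance. It is
   the d-dimensional surface area up to a constant factor depending only on d,
   which cancels in the normalization below. *)
Section hausdorff.
Context {R : realType} {n : nat}.
Local Open Scope ereal_scope.

(* sup is taken over a set containing 0, so that the empty set has diameter 0 *)
Definition ediam (U : set 'rV[R]_n) : \bar R :=
  ereal_sup (0 |` [set (enorm (x - y))%:E | x in U & y in U]).

(* (diam U)^d, with the conventions 0^0 = 1 for nonempty U and 0 for U empty *)
Definition diam_pow (d : nat) (U : set 'rV[R]_n) : \bar R :=
  if U == set0 then 0 else ediam U ^+ d.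

Definition hausdorff_delta (d : nat) (delta : R) (A : set 'rV[R]_n) : \bar R :=
  ereal_inf [set \sum_(i <oo) diam_pow d (F i) | F in
    [set F : (set 'rV[R]_n)^nat |
      (forall i, ediam (F i) <= delta%:E) /\ A `<=` \bigcup_i F i]].

Definition hausdorff (d : nat) (A : set 'rV[R]_n) : \bar R :=
  ereal_sup [set hausdorff_delta d delta A | delta in [set e : R | (0 < e)%R]].

Lemma ediam_ge0 U : 0 <= ediam U.
Proof. by apply: ereal_sup_ubound; left. Qed.

Lemma diam_pow_ge0 d U : 0 <= diam_pow d U.
Proof. by rewrite /diam_pow; case: ifP => // _; rewrite expe_ge0// ediam_ge0. Qed.

Lemma ediam0 : ediam set0 = 0.
Proof.
rewrite /ediam (_ : [set _ | _ in _ & _ in _] = set0) ?setU0 ?ereal_sup1//.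
by apply/seteqP; split => // x [y []].
Qed.

Lemma diam_pow0 d : diam_pow d set0 = 0.
Proof. by rewrite /diam_pow eqxx. Qed.

(* hausdorff_delta as an instance of the outer measure construction of
   measure_extension, every set being declared measurable *)
Let D := g_sigma_algebraType [set: set 'rV[R]_n].

Let pen (d : nat) (delta : R) (U : set D) : \bar R :=
  if ediam U <= delta%:E then diam_pow d U else +oo.

Let pen_ge0 d delta U : 0 <= pen d delta U.
Proof. by rewrite /pen; case: ifP => // _; exact: diam_pow_ge0. Qed.

Let hausdorff_delta_mu_ext d delta : hausdorff_delta d delta = mu_ext (pen d delta).
Proof.
apply/funext => A; apply/eqP; rewrite eq_le; apply/andP; split.
- apply: le_ereal_inf_tmp => _ [F [_ AF] <-].
  have [[i ioo]|/forallNP Fle] := pselect (exists i, ~ ediam (F i) <= delta%:E).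
    rewrite (@eseries_pinfty _ _ xpredT i)// ?leey// => [j _|].
      by rewrite -ltNye (lt_le_trans _ (pen_ge0 _ _ _)).
    by rewrite /pen; case: ifPn => // /ioo.
  apply: ereal_inf_lbound; exists F.
    by split => // i; exact: contrapT (Fle i).
  by apply: eq_eseriesr => i _; rewrite /pen (contrapT (Fle i)).
- apply: le_ereal_inf_tmp => _ [F [Fle AF] <-].
  apply: ereal_inf_lbound; exists F.
    by split => // i; exact: sub_sigma_algebra.
  by apply: eq_eseriesr => i _; rewrite /pen Fle.
Qed.

Lemma hausdorff_delta_ge0 d delta A : 0 <= hausdorff_delta d delta A.
Proof. by rewrite hausdorff_delta_mu_ext; apply: mu_ext_ge0; exact: pen_ge0. Qed.

Lemma hausdorff0 d : hausdorff d set0 = 0.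
Proof.
apply/eqP; rewrite eq_le; apply/andP; split.
  apply: ge_ereal_sup => _ [e /= e0 <-].
  have pen0 : pen d e set0 = 0 by rewrite /pen ediam0 lee_fin ltW// diam_pow0.
  by rewrite hausdorff_delta_mu_ext (mu_ext0 pen0 (pen_ge0 d e)).
apply: (le_trans (hausdorff_delta_ge0 d 1 set0)).
by apply: ereal_sup_ubound; exists 1%R => //=.
Qed.

Lemma hausdorff_ge0 d A : 0 <= hausdorff d A.
Proof.
apply: (le_trans (hausdorff_delta_ge0 d 1 A)).
by apply: ereal_sup_ubound; exists 1%R => //=.
Qed.

Lemma le_hausdorff d : {homo hausdorff d : A B / A `<=` B >-> A <= B}.
Proof.
move=> A B AB; apply: ge_ereal_sup => _ [e /= e0 <-].
apply: (@le_trans _ _ (hausdorff_delta d e B)).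
  by rewrite hausdorff_delta_mu_ext; exact: le_mu_ext.
by apply: ereal_sup_ubound; exists e.
Qed.

Lemma hausdorff_sigma_subadditive d : sigma_subadditive (hausdorff d).
Proof.
move=> F; apply: ge_ereal_sup => _ [e /= e0 <-].
apply: (@le_trans _ _ (\sum_(i <oo) hausdorff_delta d e (F i))).
  rewrite hausdorff_delta_mu_ext.
  by apply: mu_ext_sigma_subadditive; exact: pen_ge0.
apply: lee_nneseries => [i _ _|i _]; first exact: hausdorff_delta_ge0.
by apply: ereal_sup_ubound; exists e.
Qed.

HB.instance Definition _ (d : nat) := isOuterMeasure.Build R 'rV[R]_n
  (hausdorff d) (hausdorff0 d) (@hausdorff_ge0 d) (@le_hausdorff d)
  (@hausdorff_sigma_subadditive d).

End hausdorff.

Section surface.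
Context {R : realType} {n : nat}.

Lemma inv_area_ge0 d (S : set 'rV[R]_n) : 0 <= (fine (hausdorff d S))^-1.
Proof. by rewrite invr_ge0 fine_ge0// hausdorff_ge0. Qed.

Definition hausdorff_outer (d : nat) : {outer_measure set 'rV[R]_n -> \bar R} :=
  @hausdorff R n d.

(* Surface area on a d-dimensional surface S, normalized to give S mass 1, as a
   measure on the sigma-algebra of Caratheodory measurable sets, which contains
   the Borel sets. It is not restricted to S and has to be integrated over S. *)
Definition unif_surface (d : nat) (S : set 'rV[R]_n) :
    {measure set (caratheodory_type (hausdorff_outer d)) -> \bar R} :=
  mscale (NngNum (inv_area_ge0 d S))
    (hausdorff_outer d : set (caratheodory_type (hausdorff_outer d)) -> \bar R).

End surface.

Section gaussian.
Context {R : realType} {k : nat}.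

Definition borel_rV := g_sigma_algebraType (@open 'rV[R]_k).

(* Univariate Gaussian law with standard deviation s; the case s = 0 is
   separated because normal_prob m 0 is the uniform law on [0, 1]. *)
Definition gauss1 (m s : R) : set R -> \bar R :=
  if s == 0 then dirac m else normal_prob m s.

Definition is_gaussian (mu : probability borel_rV R) : Prop :=
  forall a : 'rV[R]_k, exists m s : R, forall B : set R, measurable B ->
    mu [set x : 'rV[R]_k | B (dot a x)] = gauss1 m s B.

Definition has_mean (mu : probability borel_rV R) (eta : 'rV[R]_k) : Prop :=
  forall i, 'E_mu[fun x : 'rV[R]_k => x 0%R i]%E = (eta 0 i)%:E.

Definition has_covariance (mu : probability borel_rV R) (C : 'M[R]_k) : Prop :=
  forall i j, covariance mu (fun x : 'rV[R]_k => x 0 i)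
                            (fun x : 'rV[R]_k => x 0 j) = (C i j)%:E.

(* The (possibly degenerate) Gaussian measure with mean eta and covariance C; an
   unspecified probability measure if C is not a covariance matrix. *)
Definition gaussian_measure (eta : 'rV[R]_k) (C : 'M[R]_k) :
    probability borel_rV R :=
  get [set mu : pprobability borel_rV R |
    [/\ is_gaussian mu, has_mean mu eta & has_covariance mu C]].

End gaussian.

Section limit_data.
Context {R : realType} {gamma : nat}.
Variables (u : 'I_gamma -> nat -> R) (p : 'I_gamma -> R).

Definition affine_A n : set 'rV[R]_n :=
  [set x | forall i, dot x (trunc n (u i)) = p i].

Definition sphere_A n : set 'rV[R]_n :=
  esphere (Num.sqrt n%:R) `&` @affine_A n.

(* Normalized surface area on sphere_A n, a sphere of dimension n - gamma - 1
   for n large. *)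
Definition sigma_bar n := unif_surface (n - gamma - 1) (@sphere_A n).

Definition eta_bar k : 'rV[R]_k := \sum_i p i *: trunc k (u i).

Definition cov_bar k : 'M[R]_k :=
  1%:M - \sum_i enorm (trunc k (u i)) ^+ 2 *: proj_span (trunc k (u i)).

End limit_data.

Arguments affine_A {R gamma} u p n _.
Arguments sphere_A {R gamma} u p n _.

(* Main.v *)
(* On S_(A_n) a point x is c + xP, where P is the orthogonal projection onto the
   direction of A_n and |xP|^2 = n - |c|^2 is constant. Invariance of the surface
   measure under the reflections fixing A_n forces the moments of <x, y>, yP = y:
   the odd ones vanish, and E <x, y>^(2j) is |y|^(2j) times the product over i < j
   of (2i + 1)(n - |c|^2) / (n - gamma + 2i). Since the Gram matrices of the
   truncations of the u^(i) tend to the identity, these converge to the Gaussian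
   moments; hence the characteristic functions converge, and bounded continuous
   functions are approximated, locally uniformly, by trigonometric polynomials.
   That S_(A_n) has finite surface area follows by covering it with Lipschitz
   images of cubes, and that its area is positive by comparison with a product of
   one-dimensional normal laws. The limiting Gaussian measure exists by the
   Cholesky factorization of its covariance, which is positive semidefinite by
   Bessel's inequality. *)
From HB Require Import structures.
Require Import Defs.
From mathcomp Require Import all_boot all_order all_algebra.
From mathcomp Require Import all_classical all_reals all_analysis.
From mathcomp Require Import measurable_realfun.
From mathcomp Require Import ring lra zify.

Set Implicit Arguments.
Unset Strict Implicit.
Unset Printing Implicit Defensive.

Import Order.TTheory GRing.Theory Num.Theory.
Import numFieldNormedType.Exports.
Local Open Scope classical_set_scope.
Local Open Scope ring_scope.

(** * Euclidean norm *)

(** No formula for the surface measure of a sphere is computed. What is used about the Hausdorff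
    measure is that closed sets are measurable for it, that isometric involutions preserve it, and
    that [S_(A_n)] has finite positive measure, so that the normalization is meaningful. This turns
    integration over [S_(A_n)] into a positive normalized linear functional ([is_mean]) invariant
    under reflections. From then on the sphere and the Gaussian law are treated alike, through their
    values on continuous functions of polynomial growth.

    Reflections suffice because any two vectors of equal length are exchanged by one of them, so a
    moment of a linear form depends on the length of the form alone. Comparing a unit vector y with
    y + b w, for w orthogonal to y, then links one even moment to the next.

    In the final approximation no compactness of the sequence of laws is invoked: outside a large
    ball the error of the trigonometric polynomial is paid for by second moments, which stay
    bounded. *)

Section euclidean_norm.
Context {R : realType} {n : nat}.
Implicit Types x y z : 'rV[R]_n.

Lemma dotE x y : dot x y = (x *m y^T) 0 0.
Proof. by rewrite mxE; apply: eq_bigr => i _; rewrite mxE. Qed.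

Lemma dotC x y : dot x y = dot y x.
Proof. by apply: eq_bigr => i _; rewrite mulrC. Qed.

Lemma dotDl x y z : dot (x + y) z = dot x z + dot y z.
Proof. by rewrite !dotE mulmxDl mxE. Qed.

Lemma dotZl a x z : dot (a *: x) z = a * dot x z.
Proof. by rewrite !dotE -scalemxAl mxE. Qed.

Lemma dotNl x z : dot (- x) z = - dot x z.
Proof. by rewrite -scaleN1r dotZl mulN1r. Qed.

Lemma dotBl x y z : dot (x - y) z = dot x z - dot y z.
Proof. by rewrite dotDl dotNl. Qed.

Lemma dotDr x y z : dot x (y + z) = dot x y + dot x z.
Proof. by rewrite !(dotC x) dotDl. Qed.

Lemma dotZr a x z : dot x (a *: z) = a * dot x z.
Proof. by rewrite !(dotC x) dotZl. Qed.

Lemma dotNr x z : dot x (- z) = - dot x z.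
Proof. by rewrite !(dotC x) dotNl. Qed.

Lemma dotBr x y z : dot x (y - z) = dot x y - dot x z.
Proof. by rewrite dotDr dotNr. Qed.

Lemma dot0l x : dot 0 x = 0.
Proof. by rewrite -(scale0r x) dotZl mul0r. Qed.

Lemma dot0r x : dot x 0 = 0.
Proof. by rewrite dotC dot0l. Qed.

Lemma dotxx_ge0 x : 0 <= dot x x.
Proof. by apply: sumr_ge0 => i _; rewrite -expr2 sqr_ge0. Qed.

Lemma sqr_coord_le x i : x 0 i ^+ 2 <= dot x x.
Proof.
rewrite /dot (bigD1 i)//= -expr2 lerDl.
by apply: sumr_ge0 => j _; rewrite -expr2 sqr_ge0.
Qed.

Lemma dotxx_eq0 x : (dot x x == 0) = (x == 0).
Proof.
apply/eqP/eqP => [x0|->]; last exact: dot0l.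
apply/rowP => i; rewrite mxE; apply/eqP; rewrite -sqrf_eq0.
by rewrite eq_le sqr_ge0 andbT -x0 sqr_coord_le.
Qed.

Lemma dotxx_gt0 x : (0 < dot x x) = (x != 0).
Proof. by rewrite lt_neqAle dotxx_ge0 andbT eq_sym dotxx_eq0. Qed.

Lemma enorm_ge0 x : 0 <= enorm x.
Proof. exact: sqrtr_ge0. Qed.

Lemma sqr_enorm x : enorm x ^+ 2 = dot x x.
Proof. by rewrite sqr_sqrtr// dotxx_ge0. Qed.

Lemma enorm_eq0 x : (enorm x == 0) = (x == 0).
Proof. by rewrite -sqrf_eq0 sqr_enorm dotxx_eq0. Qed.

Lemma enorm_gt0 x : (0 < enorm x) = (x != 0).
Proof. by rewrite lt_neqAle enorm_ge0 andbT eq_sym enorm_eq0. Qed.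

Lemma enorm0 : enorm (0 : 'rV[R]_n) = 0.
Proof. by apply/eqP; rewrite enorm_eq0. Qed.

Lemma enormZ a x : enorm (a *: x) = `|a| * enorm x.
Proof.
by rewrite /enorm dotZl dotZr mulrA -expr2 sqrtrM ?sqr_ge0// sqrtr_sqr.
Qed.

Lemma enormN x : enorm (- x) = enorm x.
Proof. by rewrite -scaleN1r enormZ normrN1 mul1r. Qed.

Lemma enormB x y : enorm (x - y) = enorm (y - x).
Proof. by rewrite -enormN opprB. Qed.

(** The squared norm of [dot y y *: x - dot x y *: y] is [dot y y] times the defect of the
    inequality. *)
Lemma cauchy_schwarz x y : dot x y ^+ 2 <= dot x x * dot y y.
Proof.
have [->|y0] := eqVneq y 0; first by rewrite !dot0r expr0n mulr0.
have := dotxx_ge0 (dot y y *: x - dot x y *: y).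
rewrite dotBl !dotBr !dotZl !dotZr (dotC y x).
have -> : dot y y * (dot y y * dot x x) - dot y y * (dot x y * dot x y) -
  (dot x y * (dot y y * dot x y) - dot x y * (dot x y * dot y y)) =
  dot y y * (dot x x * dot y y - dot x y ^+ 2) by ring.
by rewrite pmulr_rge0 ?dotxx_gt0// subr_ge0.
Qed.

Lemma normr_dot_le x y : `|dot x y| <= enorm x * enorm y.
Proof.
rewrite -(@ler_pXn2r _ 2)// ?nnegrE ?normr_ge0 ?mulr_ge0 ?enorm_ge0//.
by rewrite real_normK ?num_real// exprMn !sqr_enorm cauchy_schwarz.
Qed.

Lemma enormD x y : enorm (x + y) <= enorm x + enorm y.
Proof.
rewrite -(@ler_pXn2r _ 2)// ?nnegrE ?addr_ge0 ?enorm_ge0//.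
rewrite sqr_enorm dotDl !dotDr (dotC y x) sqrrD !sqr_enorm.
have := le_trans (ler_norm _) (normr_dot_le x y); lra.
Qed.

Lemma enorm_triangle y x z : enorm (x - z) <= enorm (x - y) + enorm (y - z).
Proof. by apply: le_trans (enormD _ _); rewrite addrA subrK. Qed.

Lemma ler_enorm_dist x y : `|enorm x - enorm y| <= enorm (x - y).
Proof.
have h1 := enormD (x - y) y; have h2 := enormD (y - x) x.
by move: h1 h2; rewrite !subrK (enormB y) ler_norml; lra.
Qed.

Lemma normr_coord_le x i : `|x 0 i| <= `|x|.
Proof.
by rewrite [leRHS]/Num.norm/= mx_normrE (le_bigmax _ (fun ij => `|x ij.1 ij.2|) (0, i)).
Qed.

Lemma normr_rV_leP x (e : R) : 0 <= e -> (forall i, `|x 0 i| <= e) -> `|x| <= e.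
Proof.
move=> e0 xe; rewrite [leLHS]/Num.norm/= mx_normrE; apply: bigmax_le => // -[i j] _.
by rewrite ord1.
Qed.

Lemma normr_coord_enorm x i : `|x 0 i| <= enorm x.
Proof.
rewrite -(@ler_pXn2r _ 2)// ?nnegrE ?normr_ge0 ?enorm_ge0//.
by rewrite real_normK ?num_real// sqr_enorm sqr_coord_le.
Qed.

Lemma normr_le_enorm x : `|x| <= enorm x.
Proof. by apply: normr_rV_leP => [|i]; rewrite ?enorm_ge0// normr_coord_enorm. Qed.

Lemma enorm_le_normr x : enorm x <= n%:R * `|x|.
Proof.
rewrite -(@ler_pXn2r _ 2)// ?nnegrE ?enorm_ge0 ?mulr_ge0//.
have [->|n0] := eqVneq x 0; first by rewrite enorm0 expr0n/= sqr_ge0.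
have nn : (n%:R : R) <= n%:R ^+ 2 by rewrite -natrX ler_nat; nia.
rewrite sqr_enorm exprMn; apply: (@le_trans _ _ (n%:R * `|x| ^+ 2)).
  rewrite /dot mulr_natl -[X in _ *+ X]card_ord -sumr_const; apply: ler_sum => i _.
  by rewrite -expr2 -(real_normK (num_real (x 0 i))) ler_pXn2r ?nnegrE// normr_coord_le.
by rewrite ler_wpM2r ?exprn_ge0.
Qed.

End euclidean_norm.

Lemma dot_mulmx {R : realType} m n (x : 'rV[R]_m) (A : 'M[R]_(m, n)) (y : 'rV[R]_n) :
  dot (x *m A) y = dot x (y *m A^T).
Proof. by rewrite !dotE trmx_mul trmxK mulmxA. Qed.

(** The summand 1 in the constant keeps it positive for [A = 0], so that it can be inverted
    later. *)
Lemma normr_mulmx_bound {R : realType} m n (A : 'M[R]_(m, n)) :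
  exists2 C : R, 0 < C & forall x : 'rV[R]_m, `|x *m A| <= C * `|x|.
Proof.
exists (1 + \sum_i \sum_j `|A i j|) => [|x].
  by rewrite ltr_pwDl// !sumr_ge0 => // *; rewrite sumr_ge0.
apply: normr_rV_leP => [|j].
  by rewrite mulr_ge0 ?addr_ge0 ?sumr_ge0// => *; rewrite sumr_ge0.
rewrite mxE (le_trans (ler_norm_sum _ _ _))// mulrDl mul1r.
rewrite ler_wpDl// mulr_suml ler_sum// => i _.
rewrite normrM mulrC (bigD1 j)//= mulrDl ler_wpDr//.
  by rewrite mulr_ge0// sumr_ge0.
by rewrite ler_wpM2l// normr_coord_le.
Qed.

(** * Hausdorff measures *)

Section metric_outer_measure.
Context {R : realType} {n : nat}.
Implicit Types A B U X : set 'rV[R]_n.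
Local Open Scope ereal_scope.

Lemma le_ediam_dist U x y : U x -> U y -> (enorm (x - y))%:E <= ediam U.
Proof. by move=> Ux Uy; apply: ereal_sup_ubound; right; exists x => //; exists y. Qed.

Lemma ediam_le U (e : R) : (0 <= e)%R ->
  (forall x y, U x -> U y -> (enorm (x - y) <= e)%R) -> ediam U <= e%:E.
Proof.
move=> e0 Ue; apply: ge_ereal_sup => _ [->|[x Ux [y Uy <-]]]; rewrite lee_fin//.
exact: Ue.
Qed.

Lemma le_ediam A B : A `<=` B -> ediam A <= ediam B.
Proof.
move=> AB; apply: ge_ereal_sup => _ [->|[x Ax [y Ay <-]]]; first exact: ediam_ge0.
by apply: le_ediam_dist; exact: AB.
Qed.

Lemma lee_expe d (x y : \bar R) : 0 <= x -> x <= y -> x ^+ d <= y ^+ d.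
Proof.
move=> x0 xy; elim: d => [|d ih]; rewrite ?expe0// !expeS.
by rewrite lee_pmul// expe_ge0.
Qed.

Lemma le_diam_pow d A B : A `<=` B -> diam_pow d A <= diam_pow d B.
Proof.
move=> AB; rewrite /diam_pow; case: ifPn => [_|A0].
  by case: ifPn => // _; rewrite expe_ge0// ediam_ge0.
rewrite ifF; last by apply/negP => /eqP B0; move: A0 => /set0P[a /AB]; rewrite B0.
by rewrite lee_expe ?ediam_ge0 ?le_ediam.
Qed.

(** A covering set of diameter at most [delta] cannot meet both [A] and [B], so splitting a cover of
    the union into its traces on [A] and on [B] does not raise the cost. *)
Lemma hausdorff_delta_separated d (delta : R) A B :
  (forall x y, A x -> B y -> (delta < enorm (x - y))%R) ->
  hausdorff_delta d delta A + hausdorff_delta d delta B <=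
  hausdorff_delta d delta (A `|` B).
Proof.
move=> AB; apply: le_ereal_inf_tmp => _ [F [Fd ABF] <-].
apply: (@le_trans _ _ (\sum_(i <oo)
    (diam_pow d (F i `&` A) + diam_pow d (F i `&` B)))).
  rewrite nneseriesD; [|by move=> *; exact: diam_pow_ge0..].
  apply: leeD; apply: ereal_inf_lbound.
    exists (fun i => F i `&` A) => //; split=> [i|x Ax].
      by apply: le_trans (Fd i); apply: le_ediam; exact: subIsetl.
    by have [i _ Fx] := ABF x (or_introl Ax); exists i.
  exists (fun i => F i `&` B) => //; split=> [i|x Bx].
    by apply: le_trans (Fd i); apply: le_ediam; exact: subIsetl.
  by have [i _ Fx] := ABF x (or_intror Bx); exists i.
apply: lee_nneseries => [i _ _|i _].
  by rewrite adde_ge0// diam_pow_ge0.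
have [->|/set0P[a [Fa Aa]]] := eqVneq (F i `&` A) set0.
  by rewrite diam_pow0 add0e le_diam_pow//; exact: subIsetl.
have [->|/set0P[b [Fb Bb]]] := eqVneq (F i `&` B) set0.
  by rewrite diam_pow0 adde0 le_diam_pow//; exact: subIsetl.
have := le_trans (le_ediam_dist Fa Fb) (Fd i).
by rewrite lee_fin leNgt AB.
Qed.

Lemma le_hausdorff_delta d (e e' : R) A : (e <= e')%R ->
  hausdorff_delta d e' A <= hausdorff_delta d e A.
Proof.
move=> ee'; apply: le_ereal_inf_tmp => _ [F [Fd AF] <-].
apply: ereal_inf_lbound; exists F => //; split => // i.
by rewrite (le_trans (Fd i))// lee_fin.
Qed.

(** The two suprema on the left range over independent scales; the smaller of the two scales, cut
    down to at most [e / 2], serves both. The case of infinite measure is split off so that finite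
    terms can be moved across the inequality. *)
Lemma hausdorff_separated d (e : R) A B : (0 < e)%R ->
  (forall x y, A x -> B y -> (e <= enorm (x - y))%R) ->
  hausdorff d A + hausdorff d B <= hausdorff d (A `|` B).
Proof.
move=> e0 AB.
have key (d1 d2 : R) : (0 < d1)%R -> (0 < d2)%R ->
    hausdorff_delta d d1 A + hausdorff_delta d d2 B <= hausdorff d (A `|` B).
  move=> d10 d20; set m := Num.min (Num.min d1 d2) (e / 2)%R.
  have m0 : (0 < m)%R by rewrite !lt_min d10 d20 divr_gt0.
  have me : (m < e)%R by rewrite gt_min; apply/orP; right; lra.
  apply: (@le_trans _ _ (hausdorff_delta d m A + hausdorff_delta d m B)).
    by apply: leeD; apply: le_hausdorff_delta; rewrite !ge_min lexx ?orbT.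
  apply: (le_trans (hausdorff_delta_separated _ _)) => [x y Ax By|].
    exact: lt_le_trans me (AB _ _ Ax By).
  by apply: ereal_sup_ubound; exists m.
have [->|ABoo] := eqVneq (hausdorff d (A `|` B)) +oo; first by rewrite leey.
have fin C : C `<=` A `|` B -> hausdorff d C \is a fin_num.
  move=> CAB; rewrite ge0_fin_numE ?hausdorff_ge0//.
  by rewrite (le_lt_trans (le_hausdorff d CAB))// ltey.
have finA := fin A (@subsetUl _ A B); have finB := fin B (@subsetUr _ A B).
rewrite -leeBrDr//; apply: ge_ereal_sup => _ [d1 d10 <-].
have f1 : hausdorff_delta d d1 A \is a fin_num.
  rewrite ge0_fin_numE ?hausdorff_delta_ge0//.
  apply: (@le_lt_trans _ _ (hausdorff d A)); first by apply: ereal_sup_ubound; exists d1.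
  by rewrite -ge0_fin_numE ?hausdorff_ge0.
rewrite leeBrDr// addeC -leeBrDr//; apply: ge_ereal_sup => _ [d2 d20 <-].
by rewrite leeBrDr// addeC key.
Qed.

(** The gap may shrink with the index: by induction each set only has to keep its own distance from
    the earlier ones. *)
Lemma hausdorff_separated_sum d (D : (set 'rV[R]_n)^nat) (e : R^nat) :
  (forall k, (0 < e k)%R) ->
  (forall k j x y, (j < k)%N -> D j x -> D k y -> (e k <= enorm (x - y))%R) ->
  forall N, \sum_(0 <= k < N) hausdorff d (D k) <=
    hausdorff d (\bigcup_(k in `I_N) D k).
Proof.
move=> e0 De; elim=> [|N ih]; first by rewrite big_geq// hausdorff_ge0.
rewrite big_nat_recr//= IIS bigcup_setU bigcup_set1.
apply: le_trans (leeD2r _ ih) _.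
refine (@hausdorff_separated d (e N) _ (D N) (e0 N) _) => x y [j /= jN Djx] DNy.
exact: De jN Djx DNy.
Qed.

End metric_outer_measure.

(** * Open sets are Caratheodory measurable for Hausdorff measures *)

Section borel_caratheodory.
Context {R : realType} {n : nat}.
Implicit Types O X : set 'rV[R]_n.

Let a (j : nat) : R := 2 ^- j.

Let a_gt0 j : 0 < a j.
Proof. by rewrite invr_gt0 exprn_gt0. Qed.

Let aS j : a j = 2 * a j.+1.
Proof. by rewrite /a exprS invfM mulrA mulfV// mul1r. Qed.

Let a_le i j : (i <= j)%N -> a j <= a i.
Proof. by move=> ij; rewrite lef_pV2 ?posrE ?exprn_gt0// ler_weXn2l// ler1n. Qed.

Let inner O j := [set x : 'rV[R]_n | forall y, enorm (x - y) < a j -> O y].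

Let le_inner O i j : (i <= j)%N -> inner O i `<=` inner O j.
Proof. by move=> ij x xO y xy; apply: xO; exact: lt_le_trans xy (a_le ij). Qed.

Let open_inner O x : open O -> O x -> exists j, inner O j x.
Proof.
move=> oO Ox; have /nbhs_ballP[e /= e0 xeO] := open_nbhs_nbhs (conj oO Ox).
have [j ej] : exists j : nat, a j < e.
  exists (Num.bound e^-1); rewrite -[ltRHS]invrK ltf_pV2 ?posrE ?invr_gt0 ?exprn_gt0//.
  apply: (lt_trans (archi_boundP _)); first by rewrite invr_ge0 ltW.
  by rewrite -natrX ltr_nat ltn_expl.
exists j => y xy; apply: xeO; rewrite -ball_normE/=.
exact: le_lt_trans (normr_le_enorm _) (lt_trans xy ej).
Qed.

Let shell O j := inner O j.+1 `\` inner O j.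

(** The distance to the complement of [O] is at least [a i] at [x] and below [a j] at [y], and
    [a i - a j >= a j] since [a] halves at each step. Hence two shells whose indices differ by at
    least 2 are separated. *)
Let inner_shell_sep O i j x y : (i < j)%N ->
  inner O i x -> ~ inner O j y -> a j <= enorm (x - y).
Proof.
move=> ij xO /existsNP[w /not_implyP[yw wO]].
have xw : a i <= enorm (x - w) by rewrite leNgt; apply/negP => /xO.
have := enorm_triangle y x w; have := a_le ij; rewrite aS in xw *; move=> aij.
have := a_le ij; have := aS i; lra.
Qed.

Let sub_inner_shell O j : open O ->
  O `<=` inner O j `|` \bigcup_(i in [set i | (j <= i)%N]) shell O i.
Proof.
move=> oO x Ox.
have ex : exists j, `[< inner O j x >].
  by have [i xi] := open_inner oO Ox; exists i; apply/asboolP.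
case: (ex_minnP ex) => -[|i] /asboolP xi imin.
  by left; apply: le_inner xi.
have [ji|ij] := leqP j i; last by left; exact: le_inner xi.
right; exists i => //; split=> // xi'.
by have := imin _ (asboolT xi'); rewrite ltnn.
Qed.

Local Open Scope ereal_scope.

(** Caratheodory's criterion for metric outer measures: [X] inside [inner O j] is separated from [X]
    outside [O], hence additive with it, and the part of [X] between [inner O j] and [O] is covered
    by shells whose total measure tends to 0. *)
Lemma caratheodory_open d O : open O -> (@hausdorff_outer R n d).-caratheodory O.
Proof.
move=> oO; apply: le_caratheodory_measurable => X.
set mu := hausdorff_outer d.
have [->|Xoo] := eqVneq (mu X) +oo; first by rewrite leey.
pose D i := X `&` shell O i.
have le_mu A B : A `<=` B -> mu A <= mu B by exact: le_outer_measure.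
have mu_ge0 A : 0 <= mu A by exact: outer_measure_ge0.
(* Shells of the same parity are mutually separated, so their measures add up to at most [mu X];
   both parities together give a bounded series. *)
have sumD b N : \sum_(0 <= k < N) mu (D (b + k.*2)%N) <= mu X.
  apply: (le_trans (@hausdorff_separated_sum R n d (fun k => D (b + k.*2)%N)
    (fun k => a (b + k.*2)) (fun k => a_gt0 _) _ N)); last first.
    by apply: le_mu => x [k _ []].
  move=> k j x y jk [_ [xD _]] [_ [_ yD]]; apply: inner_shell_sep xD yD.
  by lia.
have partial N : \sum_(0 <= i < N) mu (D i) <= mu X + mu X.
  apply: (@le_trans _ _ (\sum_(0 <= i < N.*2) mu (D i))).
    by apply: lee_sum_nneg_natr => //; lia.
  have -> : \sum_(0 <= i < N.*2) mu (D i) =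
      \sum_(0 <= k < N) mu (D (0 + k.*2)%N) + \sum_(0 <= k < N) mu (D (1 + k.*2)%N).
    elim: N => [|N ih]; first by rewrite !big_geq// adde0.
    have E (x y u v : \bar R) : x + y + u + v = (x + u) + (y + v).
      by rewrite -addeA addeACA.
    by rewrite doubleS !big_nat_recr//= ih; exact: E.
  exact: leeD.
have fin : \sum_(0 <= i <oo) mu (D i) < +oo.
  apply: (@le_lt_trans _ _ (mu X + mu X)); last by rewrite lte_add_pinfty// ltey.
  apply: lime_le; first exact: is_cvg_nneseries.
  by near=> N; exact: partial.
have tail := nneseries_tail_cvg fin (fun k _ => mu_ge0 (D k)).
(* The inequality is proved with the tail of the series as an error term, which disappears as [j]
   grows. *)
have : mu X + \sum_(j <= i <oo) mu (D i) @[j --> \oo] --> mu X + 0.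
  by apply: cvgeD; [exact: fin_num_adde_defl|exact: cvg_cst|exact: tail].
rewrite adde0 => cv; rewrite -(cvg_lim _ cv)//.
apply: lime_ge; first by apply/cvg_ex; exists (mu X).
near=> j.
have XO : mu (X `&` O) <= mu (X `&` inner O j) + \sum_(j <= i <oo) mu (D i).
  apply: (@le_trans _ _ (mu ((X `&` inner O j) `|`
      \bigcup_i (D (i + j)%N)))).
    apply: le_mu => x [Xx /(sub_inner_shell j oO)[|[i /= ji xi]]]; first by left.
    by right; exists (i - j)%N => //; rewrite subnK.
  apply: (le_trans (outer_measureU2 _ _ _)); apply: leeD2l.
  apply: (le_trans (outer_measure_sigma_subadditive _ _)).
  by rewrite -[in leRHS](add0n j) -(@nneseries_addn _ (fun i => mu (D i)))//.
apply: (le_trans (leeD2r _ XO)).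
rewrite addeAC; apply: leeD2r.
apply: (le_trans (hausdorff_separated _ (a_gt0 j) _)) => [x y [_ xO] [_ yO]|].
  by rewrite leNgt; apply/negP => /xO.
by apply: le_mu => x [[]|[]].
Unshelve. all: by end_near. Qed.

End borel_caratheodory.

(** * Upper and lower bounds for Hausdorff measures of parametrized sets *)

Section hausdorff_bounds.
Context {R : realType} {n : nat}.
Implicit Types A U : set 'rV[R]_n.
Local Open Scope ereal_scope.

(** The images of a cover have the same diameters. For an involution [h], applying this twice gives
    equality. *)
Lemma le_hausdorff_isometry d (h : 'rV[R]_n -> 'rV[R]_n) A :
  (forall x y, enorm (h x - h y) = enorm (x - y)) ->
  hausdorff d (h @` A) <= hausdorff d A.
Proof.
move=> hh.
have hU U : ediam (h @` U) = ediam U.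
  apply/eqP; rewrite eq_le; apply/andP; split; apply: ge_ereal_sup.
    move=> _ [->|[_ [x Ux <-] [_ [y Uy <-] <-]]]; first exact: ediam_ge0.
    by rewrite hh le_ediam_dist.
  move=> _ [->|[x Ux [y Uy <-]]]; first exact: ediam_ge0.
  by rewrite -hh; apply: le_ediam_dist; [exists x|exists y].
apply: ge_ereal_sup => _ [e e0 <-].
apply: (@le_trans _ _ (hausdorff_delta d e A)); last first.
  by apply: ereal_sup_ubound; exists e.
apply: le_ereal_inf_tmp => _ [F [Fe AF] <-].
apply: (@le_trans _ _ (\sum_(i <oo) diam_pow d (h @` F i))).
  apply: ereal_inf_lbound; exists (fun i => h @` F i) => //; split=> [i|].
    by rewrite hU.
  by move=> _ [x /AF [i _ Fx] <-]; exists i => //; exists x.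
apply: lee_nneseries => [i _ _|i _]; first exact: diam_pow_ge0.
have [->|/set0P[x Fx]] := eqVneq (F i) set0; first by rewrite image_set0.
rewrite /diam_pow hU; case: ifPn => _; last by case: ifPn => // /eqP F0; rewrite F0 in Fx.
by case: ifPn => // _; rewrite expe_ge0// ediam_ge0.
Qed.

Lemma hausdorff_delta_le_sum d (e : R) (I : finType) (F : I -> set 'rV[R]_n) A :
  (0 <= e)%R -> (forall i, ediam (F i) <= e%:E) -> A `<=` \bigcup_i F i ->
  hausdorff_delta d e A <= \sum_i diam_pow d (F i).
Proof.
move=> e0 Fe AF.
(* The finite family becomes a sequence by padding with [set0], whose cost is 0 even in dimension
   0. *)
pose F' k := if insub k is Some j then F (@enum_val _ (mem I) j) else set0.
apply: (@le_trans _ _ (\sum_(k <oo) diam_pow d (F' k))).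
  apply: ereal_inf_lbound; exists F' => //; split=> [k|x /AF[i _ Fx]].
    by rewrite /F'; case: insubP => [j _ _|_]//; rewrite ediam0 lee_fin.
  exists (enum_rank i) => //; rewrite /F'; case: insubP => [j _ ji|]; last by rewrite ltn_ord.
  by rewrite (val_inj ji) enum_rankK.
rewrite (@nneseries_split _ _ 0%N #|I|) => [|k _]; last exact: diam_pow_ge0.
rewrite [X in _ + X]eseries0 => [|k /= + _]; last first.
  by rewrite add0n /F' => Ik; rewrite insubF ?diam_pow0// ltnNge Ik.
rewrite adde0 add0n big_mkord.
rewrite (big_enum_val (fun i => diam_pow d (F i))) /=.
apply: lee_sum => i _; rewrite /F'; case: insubP => [j _ ji|]; last by rewrite ltn_ord.
by rewrite (val_inj ji).
Qed.

Lemma grid_approx (N : nat) (x : R) : (0 < N)%N -> (`|x| <= 1)%R ->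
  exists k : 'I_N, (`|x - (-1 + (2 * k%:R + 1) / N%:R)| <= N%:R^-1)%R.
Proof.
move=> N0; rewrite ler_norml => /andP[x1 x2].
have NR : (0 < N%:R :> R)%R by rewrite ltr0n.
have y0 : (0 <= (x + 1) / 2 * N%:R)%R by rewrite mulr_ge0//; lra.
have /andP[k1 k2] := truncn_itv y0.
set k := Num.truncn _ in k1 k2.
move: k1 k2; move: k => k k1 k2.
have scale (j : nat) : (`|x - (-1 + (2 * j%:R + 1) / N%:R)| <= N%:R^-1 =
    (`|(x + 1) / 2 * N%:R - j%:R - 2^-1| <= 2^-1))%R.
  rewrite -(ler_pM2r (_ : 0 < N%:R / 2)%R) ?divr_gt0//.
  rewrite -[X in (_ * X <= _)%R]gtr0_norm ?divr_gt0// -normrM.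
  congr (`|_| <= _)%R; first by field; rewrite gt_eqF.
  by field; rewrite gt_eqF.
have [kN|kN] := ltnP k N.
  by exists (Ordinal kN); rewrite scale/= ler_norml; rewrite -[k.+1%:R]natr1 in k2; lra.
(* Only [x = 1] has integer part [N]; it is an endpoint of the last closed cell. *)
have N1 : (N.-1 < N)%N by rewrite prednK.
exists (Ordinal N1); rewrite scale/= -subn1 natrB// ler_norml.
have : (N%:R <= k%:R :> R)%R by rewrite ler_nat.
have : ((x + 1) / 2 * N%:R <= N%:R)%R.
  by rewrite ler_piMl//; lra.
by lra.
Qed.

(** Cutting the cube into [N ^ d] cells with images of diameter at most [2 * L / N] costs
    [(2 * L) ^+ d] in total, whatever the scale. *)
Lemma hausdorff_lipschitz_cube d (g : 'rV[R]_d -> 'rV[R]_n) (L : R) : (0 < L)%R ->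
  (forall s t, (`|s| <= 1 -> `|t| <= 1 -> enorm (g s - g t) <= L * `|s - t|)%R) ->
  hausdorff d (g @` [set t | (`|t| <= 1)%R]) < +oo.
Proof.
move=> L0 gL; apply: (@le_lt_trans _ _ ((2 * L) ^+ d)%:E); last exact: ltry.
apply: ge_ereal_sup => _ [e /= e0 <-].
set N := (Num.bound (2 * L / e)).+1.
have NR : (0 < N%:R :> R)%R by rewrite ltr0n.
have Ne : (2 * L / N%:R <= e)%R.
  rewrite ler_pdivrMr// -ler_pdivrMl// (mulrC e^-1)%R.
  have /archi_boundP/ltW/le_trans : (0 <= 2 * L / e)%R by rewrite divr_ge0 ?ltW// mulr_gt0.
  by apply; rewrite ler_nat.
pose cell (phi : {ffun 'I_d -> 'I_N}) := [set t : 'rV[R]_d | (`|t| <= 1)%R /\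
  forall i, (`|t 0 i - (-1 + (2 * (phi i)%:R + 1) / N%:R)| <= N%:R^-1)%R].
have cellP phi : ediam (g @` cell phi) <= (2 * L / N%:R)%:E.
  apply: ediam_le => [|_ _ [s [s1 sphi] <-] [t [t1 tphi] <-]].
    by rewrite divr_ge0 ?ltW// mulr_gt0.
  apply: (le_trans (gL _ _ s1 t1)); rewrite -mulrA mulrCA ler_pM2l//.
  apply: normr_rV_leP => [|i]; first by rewrite divr_ge0.
  have := sphi i; have := tphi i; rewrite !mxE.
  by set c := (-1 + _)%R; rewrite !ler_norml; lra.
apply: (le_trans (hausdorff_delta_le_sum d (ltW e0)
    (fun phi => le_trans (cellP phi) _) _)); first by rewrite lee_fin.
  move=> _ [t /= t1 <-].
  have H i : exists k : 'I_N, (`|t 0 i - (-1 + (2 * k%:R + 1) / N%:R)| <= N%:R^-1)%R.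
    by apply: grid_approx => //; exact: le_trans (normr_coord_le _ _) t1.
  exists [ffun i => sval (cid (H i))] => //; exists t => //; split=> // i.
  by rewrite ffunE; exact: (svalP (cid (H i))).
apply: (@le_trans _ _ (\sum_(phi : {ffun 'I_d -> 'I_N}) ((2 * L / N%:R) ^+ d)%:E)).
  apply: lee_sum => phi _; rewrite /diam_pow; case: ifPn => _.
    by rewrite lee_fin exprn_ge0// divr_ge0 ?ltW// mulr_gt0.
  by rewrite EFin_expe lee_expe ?ediam_ge0.
rewrite sumEFin lee_fin sumr_const card_ffun !card_ord -[X in (X <= _)%R]mulr_natr natrX -exprMn.
by rewrite divfK ?gt_eqF.
Qed.

(** The mass distribution principle. Since [g] contracts distances at most by the factor [C], a
    covering set of diameter [r] pulls back into a box of half-width [C * r], whose mass is at most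
    [(K * C * r) ^+ d]; a cover of the image therefore costs at least a fixed multiple of the mass
    of the cube. *)
Lemma hausdorff_gt0 d (disp : measure_display) (T : measurableType disp)
    (P : {measure set T -> \bar R}) (Z : T -> 'rV[R]_d) (K C : R)
    (g : 'rV[R]_d -> 'rV[R]_n) :
  (forall i, measurable_fun setT (fun w => Z w 0%R i)) ->
  (0 <= K)%R -> (0 <= C)%R ->
  (forall (a : 'rV[R]_d) (r : R), (0 <= r)%R ->
    P [set w | forall i, (`|Z w 0 i - a 0 i| <= r)%R] <= ((K * r) ^+ d)%:E) ->
  0 < P [set w | (`|Z w| <= 1)%R] ->
  (forall s t, (`|s| <= 1 -> `|t| <= 1 -> `|s - t| <= C * enorm (g s - g t))%R) ->
  0 < hausdorff d (g @` [set t | (`|t| <= 1)%R]).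
Proof.
move=> mZ K0 C0 PZ P1 gC.
have mbox (a : 'rV[R]_d) (r : R) :
    measurable [set w | forall i, (`|Z w 0 i - a 0 i| <= r)%R].
  rewrite (_ : [set w | _] = \bigcap_(i in [set: 'I_d])
      ((fun w => Z w 0%R i) @^-1` `[(a 0 i - r)%R, (a 0 i + r)%R])); last first.
    apply/seteqP; split=> w /= H i; [move=> _|]; have := H i;
      rewrite /= in_itv/= ler_norml.
      by move=> /andP[? ?]; apply/andP; split; lra.
    by move=> /(_ I)/andP[? ?]; apply/andP; split; lra.
  apply: fin_bigcap_measurable => // i _.
  by rewrite -[X in measurable X]setTI; exact: mZ.
pose M : \bar R := ((K * C) ^+ d)%:E.
have M0 : 0 <= M by rewrite lee_fin exprn_ge0// mulr_ge0.
have cover (F : (set 'rV[R]_n)^nat) : (forall i, ediam (F i) <= 1%:E) ->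
    g @` [set t | (`|t| <= 1)%R] `<=` \bigcup_i F i ->
    P [set w | (`|Z w| <= 1)%R] <= M * \sum_(i <oo) diam_pow d (F i).
  move=> F1 gF.
  (* The box is centred at some parameter [t] with [g t] in [F i]; a covering set that misses the
     image gets the empty box. *)
  pose E i := if pselect (exists t, (`|t| <= 1)%R /\ F i (g t)) is left h then
    [set w | forall j, (`|Z w 0 j - (sval (cid h)) 0 j| <= C * fine (ediam (F i)))%R]
    else set0.
  have mE i : measurable (E i) by rewrite /E; case: pselect.
  rewrite -nneseriesZl//; last by move=> i _; exact: diam_pow_ge0.
  apply: (@le_trans _ _ (\sum_(i <oo) P (E i))).
    apply: measure_sigma_subadditive => //.
      rewrite (_ : [set w | _] =
          [set w | forall i, (`|Z w 0 i - (0 : 'rV[R]_d) 0 i| <= 1)%R])//.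
      apply/seteqP; split=> w /= H => [i|].
        by rewrite mxE subr0; exact: le_trans (normr_coord_le _ _) H.
      by apply: normr_rV_leP => // i; have := H i; rewrite mxE subr0.
    move=> w /= Zw; have [i _ Fi] := gF _ (imageP g Zw).
    exists i => //; rewrite /E; case: pselect => [h|[]]; last by exists (Z w).
    case: (cid h) => t /= [t1 Ft] j.
    have := normr_coord_le (Z w - t) j; rewrite !mxE => /le_trans; apply.
    apply: (le_trans (gC _ _ Zw t1)); rewrite ler_wpM2l//.
    have fU : ediam (F i) \is a fin_num.
      by rewrite ge0_fin_numE ?ediam_ge0// (le_lt_trans (F1 i))// ltry.
    by rewrite -lee_fin fineK// le_ediam_dist.
  apply: lee_nneseries => [i _ _|i _]; first exact: measure_ge0.
  rewrite /E; case: pselect => [h|_]; last first.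
    by rewrite measure0 mule_ge0// diam_pow_ge0.
  have fU : ediam (F i) \is a fin_num.
    by rewrite ge0_fin_numE ?ediam_ge0// (le_lt_trans (F1 i))// ltry.
  apply: (le_trans (PZ _ _ _)).
    by rewrite mulr_ge0// fine_ge0// ediam_ge0.
  rewrite mulrA exprMn EFinM lee_wpmul2l// /diam_pow ifF.
    by rewrite EFin_expe fineK.
  by case: h => t [t1 Ft]; apply/negP => /eqP F0; rewrite F0 in Ft.
(* As [hausdorff] is a supremum over scales, it is enough to bound the scale 1 from below, where the
   covering sets have finite diameter. *)
apply: (@lt_le_trans _ _ (hausdorff_delta d 1 (g @` [set t | (`|t| <= 1)%R]))); last first.
  by apply: ereal_sup_ubound; exists 1%R => /=.
rewrite lt_neqAle hausdorff_delta_ge0 andbT; apply/eqP => h0.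
have fin : hausdorff_delta d 1 (g @` [set t | (`|t| <= 1)%R]) \is a fin_num by rewrite -h0.
set p := P _ in P1.
have [q q0 qP] : exists2 q : R, (0 < q)%R & q%:E <= p.
  case: (p) P1 => [q| |]//; first by rewrite lte_fin => q0; exists q.
  by move=> _; exists 1%R; rewrite ?leey.
(* The added 1 allows division by [m]; a cover of cost below [q / m] contradicts [cover]. *)
pose m : R := ((K * C) ^+ d + 1)%R.
have m0 : (0 < m)%R by rewrite ltr_wpDl// exprn_ge0// mulr_ge0.
have [_ [F [F1 gF] <-]] := lb_ereal_inf_adherent (divr_gt0 q0 m0) fin.
rewrite -[ereal_inf _]h0 add0e => Fq.
have := le_trans qP (cover F F1 gF); apply/negP; rewrite -ltNge.
apply: (@le_lt_trans _ _ (m%:E * \sum_(i <oo) diam_pow d (F i))).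
  apply: lee_wpmul2r; first by apply: nneseries_ge0 => i _ _; exact: diam_pow_ge0.
  by rewrite lee_fin lerDl.
by rewrite -lte_pdivlMl// muleC -EFinM.
Qed.

End hausdorff_bounds.

(** * Round spheres in affine subspaces, parametrized by the faces of a cube *)

Section ellipsoid.
Context {R : realType} {n d : nat}.
Variables (B : 'M[R]_(d.+1, n)) (c : 'rV[R]_n) (r : R).
Hypotheses (freeB : row_free B) (r0 : 0 < r).

(** The difference splits into a change of vector with a fixed factor and a change of factor with a
    fixed vector; each contributes at most [r / k * enorm (v - w)]. *)
Lemma radial_lipschitz (k : R) (v w : 'rV[R]_n) :
  0 < k -> k <= enorm v -> k <= enorm w ->
  enorm ((r / enorm v) *: v - (r / enorm w) *: w) <= 2 * r / k * enorm (v - w).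
Proof using r0.
move=> k0 kv kw; have v0 := lt_le_trans k0 kv; have w0 := lt_le_trans k0 kw.
have -> : (r / enorm v) *: v - (r / enorm w) *: w =
    (r / enorm v) *: (v - w) + (r / enorm v - r / enorm w) *: w.
  by rewrite scalerBr scalerBl addrA subrK.
apply: (le_trans (enormD _ _)); rewrite !enormZ.
have -> : `|r / enorm v - r / enorm w| * enorm w = r / enorm v * `|enorm w - enorm v|.
  rewrite -[X in _ * X](gtr0_norm w0) -[in RHS](gtr0_norm (divr_gt0 r0 v0)) -!normrM.
  by congr `|_|; field; rewrite !gt_eqF.
rewrite gtr0_norm ?divr_gt0// -mulrDr.
have := ler_enorm_dist w v; rewrite (enormB w) => wv.
apply: (@le_trans _ _ (r / enorm v * (2 * enorm (v - w)))).
  by rewrite ler_pM2l ?divr_gt0//; lra.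
have rvk : r / enorm v <= r / k by rewrite ler_pM2l// lef_pV2.
by have := ler_wpM2r (enorm_ge0 (v - w)) rvk; lra.
Qed.

(** For [s] equal to 1 or -1 and [t] in the cube, this parametrizes one of the faces of the cube of
    dimension [d.+1]; [h] then projects the face radially onto the sphere [S]. *)
Let insert (i : 'I_d.+1) (s : R) (t : 'rV[R]_d) : 'rV[R]_d.+1 :=
  \row_j (if unlift i j is Some k then t 0 k else s).

Let cube := [set t : 'rV[R]_d | `|t| <= 1].

Let h (y : 'rV[R]_d.+1) : 'rV[R]_n := c + (r / enorm (y *m B)) *: (y *m B).

Let S := [set x : 'rV[R]_n | exists2 y : 'rV[R]_d.+1, x = c + y *m B & enorm (y *m B) = r].

(** A row-free [B] has a right inverse, through which [y] is recovered from [y *m B] boundedly. *)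
Let le_enorm : exists2 k : R, 0 < k & forall y : 'rV[R]_d.+1, k * `|y| <= enorm (y *m B).
Proof.
have [C C0 CB] := normr_mulmx_bound (pinvmx B).
exists C^-1 => [|y]; first by rewrite invr_gt0.
rewrite mulrC ler_pdivrMr// mulrC -[in leLHS](mulmx1 y) -(mulmxVp freeB) mulmxA.
by apply: (le_trans (CB _)); rewrite ler_pM2l// normr_le_enorm.
Qed.

Let enorm_le : exists2 L : R, 0 < L & forall y : 'rV[R]_d.+1, enorm (y *m B) <= L * `|y|.
Proof.
have [C C0 CB] := normr_mulmx_bound B.
exists (n%:R * C + 1) => [|y]; first by rewrite ltr_wpDl// mulr_ge0// ltW.
apply: (le_trans (enorm_le_normr _)); rewrite mulrDl mul1r ler_wpDr// -mulrA.
by rewrite ler_wpM2l.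
Qed.

Let insertB i s t t' : `|insert i s t - insert i s t'| <= `|t - t'|.
Proof.
apply: normr_rV_leP => // j; rewrite !mxE; case: unliftP => [k _|_].
  by have := normr_coord_le (t - t') k; rewrite !mxE.
by rewrite subrr normr0.
Qed.

Let insert_ge i s t : `|s| = 1 -> 1 <= `|insert i s t|.
Proof.
by move=> s1; have := normr_coord_le (insert i s t) i; rewrite mxE unlift_none s1.
Qed.

(** On a face [|y| >= 1], so [y *m B] stays away from 0 and the radial projection is Lipschitz
    there; the images of the finitely many faces cover [S]. *)
Lemma hausdorff_ellipsoid_lty : (hausdorff d S < +oo)%E.
Proof.
have [k k0 kB] := le_enorm; have [L L0 LB] := enorm_le.
have fin (i : 'I_d.+1) (s : R) : `|s| = 1 ->
    (hausdorff d ((h \o insert i s) @` cube) < +oo)%E.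
  move=> s1; apply: (@hausdorff_lipschitz_cube _ _ _ _ (2 * r / k * L)).
    by rewrite mulr_gt0// divr_gt0// mulr_gt0.
  move=> t t' _ _ /=; rewrite /h opprD addrACA subrr add0r.
  have kI u : k <= enorm (insert i s u *m B).
    by apply: le_trans (kB _); rewrite ler_pMr// insert_ge.
  apply: (le_trans (radial_lipschitz k0 (kI _) (kI _))).
  rewrite -mulmxBl -[leRHS]mulrA ler_pM2l; last by rewrite divr_gt0// mulr_gt0.
  by apply: (le_trans (LB _)); rewrite ler_pM2l.
pose face (i : 'I_d.+1) := ((h \o insert i 1) @` cube) `|`
  ((h \o insert i (-1)) @` cube).
have finU A A' : (hausdorff d A < +oo -> hausdorff d A' < +oo ->
    @hausdorff R n d (A `|` A') < +oo)%E.
  move=> Afin A'fin; apply: le_lt_trans (outer_measureU2 (hausdorff_outer d) A A') _.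
  by apply: lte_add_pinfty; [exact: Afin|exact: A'fin].
apply: (@le_lt_trans _ _ (hausdorff d (\big[setU/set0]_i face i))); last first.
  elim/big_ind: _ => [|A A' IA IA'|i _]; first by rewrite hausdorff0.
    exact: finU IA IA'.
  by apply: finU; apply: fin; rewrite ?normrN normr1.
apply: le_hausdorff => _ [y -> yr].
have y0 : y != 0 by apply: contra_neq (lt0r_neq0 r0) => y0; rewrite -yr y0 mul0mx enorm0.
(* Dividing [y] by its largest coordinate in absolute value puts it on a face, and [h] does not see
   positive scaling. *)
have [i yi] : exists i, `|y| = `|y 0 i|.
  have : mx_norm y != 0 by rewrite (_ : mx_norm y = `|y|)// normr_eq0.
  by move=> /mx_norm_neq0[[i j] /=]; rewrite ord1; exists j.
have y0' : 0 < `|y 0 i| by rewrite -yi normr_gt0.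
pose t : 'rV[R]_d := \row_l (y 0 (lift i l) / `|y 0 i|).
have t1 : `|t| <= 1.
  apply: normr_rV_leP => // l; rewrite mxE normrM normfV normr_id ler_pdivrMr// mul1r.
  by rewrite -yi normr_coord_le.
have hy : c + y *m B = (h \o insert i (Num.sg (y 0 i))) t.
  rewrite /h /=; have -> : insert i (Num.sg (y 0 i)) t = `|y 0 i|^-1 *: y.
    apply/rowP => j; rewrite !mxE; case: unliftP => [l ->|->]; first by rewrite mxE mulrC.
    by rewrite mulrC [X in _ = X / _](numEsg (y 0 i)) mulfK// gt_eqF.
  rewrite -scalemxAl enormZ scalerA yr gtr0_norm ?invr_gt0//.
  by congr (c + _); rewrite -[LHS]scale1r; congr (_ *: _); field; rewrite !gt_eqF.
rewrite hy (bigD1 i)//=; left.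
move: (y0'); rewrite normr_gt0; case: (sgrP (y 0 i)) => // _ _; [left|right]; exact: imageP.
Qed.

(** One face is enough: on it the radial projection [g] has a Lipschitz inverse, so the mass
    distribution principle applies to its image. *)
Lemma hausdorff_ellipsoid_gt0 (disp : measure_display) (T : measurableType disp)
    (P : {measure set T -> \bar R}) (Z : T -> 'rV[R]_d) (K : R) :
  (forall i, measurable_fun setT (fun w => Z w 0 i)) -> 0 <= K ->
  (forall (a : 'rV[R]_d) (e : R), 0 <= e ->
    (P [set w | forall i, (`|Z w ord0 i - a ord0 i| <= e)%R] <= ((K * e) ^+ d)%:E)%E) ->
  (0 < P [set w | (`|Z w| <= 1)%R])%E ->
  (0 < hausdorff d S)%E.
Proof.
move=> mZ K0 PZ P1.
have [C C0 CB] := normr_mulmx_bound (pinvmx B); have [L L0 LB] := enorm_le.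
have [k k0 kB] := le_enorm.
pose g := h \o insert ord_max 1.
apply: (@lt_le_trans _ _ (hausdorff d (g @` cube))); last first.
  apply: le_hausdorff => _ [t _ <-].
  have u0 : 0 < enorm (insert ord_max 1 t *m B).
    apply: lt_le_trans (kB _); rewrite pmulr_rgt0//.
    by rewrite (lt_le_trans _ (insert_ge _ _ (normr1 _))).
  exists ((r / enorm (insert ord_max 1 t *m B)) *: insert ord_max 1 t).
    by rewrite -scalemxAl.
  by rewrite -scalemxAl enormZ gtr0_norm ?divr_gt0// divfK// gt_eqF.
apply: (@hausdorff_gt0 R n d _ T P Z K (2 * C * L / r) g) => //.
  by rewrite divr_ge0 ?ltW// !mulr_gt0.
move=> s t s1 t1.
pose a u := r / enorm (insert ord_max 1 u *m B).
have ge_a u : `|u| <= 1 -> r / L <= a u.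
  move=> u1; rewrite ler_pM2l// lef_pV2 ?posrE//; last first.
    apply: lt_le_trans (kB _); rewrite pmulr_rgt0//.
    by rewrite (lt_le_trans _ (insert_ge _ _ (normr1 _))).
  apply: (le_trans (LB _)); rewrite ler_piMr ?(ltW L0)//.
  apply: normr_rV_leP => // j; rewrite mxE; case: unlift => [l|]; rewrite ?normr1//.
  exact: le_trans (normr_coord_le _ _) u1.
have aB j : `|a s * insert ord_max 1 s 0 j - a t * insert ord_max 1 t 0 j| <=
    C * enorm (g s - g t).
  have := normr_coord_le ((g s - g t) *m pinvmx B) j.
  rewrite /g /= /h opprD addrACA subrr add0r -!/(a _) !scalemxAl -mulmxBl -mulmxA.
  rewrite mulmxVp// mulmx1 => /[!mxE] /le_trans; apply.
  rewrite -[X in `|X| <= _]mulmx1 -(mulmxVp freeB) mulmxA; apply: (le_trans (CB _)).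
  by rewrite ler_pM2l// normr_le_enorm.
have a0 u : `|u| <= 1 -> 0 < a u by move=> /ge_a; apply: lt_le_trans; rewrite divr_gt0.
apply: normr_rV_leP => [|j]; first by rewrite mulr_ge0 ?enorm_ge0// divr_ge0 ?mulr_ge0 ?ltW.
have := aB ord_max; have := aB (lift ord_max j).
rewrite !mxE liftK unlift_none !mulr1 => h1 h2.
have t1j := le_trans (normr_coord_le t j) t1.
have : a s * `|s 0 j - t 0 j| <= 2 * (C * enorm (g s - g t)).
  rewrite -(gtr0_norm (a0 _ s1)) -normrM.
  (* The inserted coordinate is 1 at both points, so that coordinate controls [a s - a t], which is
     then eliminated from the others; with [a s >= r / L] this produces the constant
     [2 * C * L / r]. *)
  have -> : a s * (s 0 j - t 0 j) = (a s * s 0 j - a t * t 0 j) - (a s - a t) * t 0 j by ring.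
  apply: (le_trans (ler_normB _ _)); rewrite mulr_natl mulr2n lerD//.
  by rewrite normrM; apply: le_trans h2; rewrite ler_piMr.
have := ler_wpM2r (normr_ge0 (s 0 j - t 0 j)) (ge_a _ s1) => h3 h4.
have := le_trans h3 h4; rewrite mulrAC ler_pdivrMr// mulrC -ler_pdivlMr// => /le_trans; apply.
by rewrite le_eqVlt; apply/orP; left; apply/eqP; field; rewrite gt_eqF.
Qed.

End ellipsoid.

(** * Univariate Gaussian laws *)

Section density.
Context d (T : measurableType d) (R : realType).
Variables (mu nu : {measure set T -> \bar R}) (p : T -> R).
Hypotheses (mp : measurable_fun setT p) (p0 : forall x, 0 <= p x).
Hypothesis nuE : forall A, measurable A -> nu A = (\int[mu]_(x in A) (p x)%:E)%E.
Local Open Scope ereal_scope.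
Import HBNNSimple.

Let integral_density_nnsfun (h : {nnsfun T >-> R}) :
  \int[nu]_x (h x)%:E = \int[mu]_x (h x * p x)%:E.
Proof.
under [LHS]eq_integral do rewrite fimfunE -fsumEFin//.
rewrite [LHS]ge0_integral_fsum//; last 2 first.
  - by move=> r; exact/measurable_EFinP/measurableT_comp.
  - by move=> n x _; rewrite EFinM nnfun_muleindic_ge0.
under [RHS]eq_integral.
  move=> x xD; rewrite EFinM fimfunE -fsumEFin// muleC ge0_mule_fsumr; last first.
    by move=> r; rewrite EFinM nnfun_muleindic_ge0.
  over.
rewrite [RHS]ge0_integral_fsum//; last 2 first.
  - move=> r; apply: emeasurable_funM; first exact/measurable_EFinP.
    exact/measurable_EFinP/measurableT_comp.
  - move=> n x _; rewrite EFinM; apply: mule_ge0; first by rewrite lee_fin.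
    exact: nnfun_muleindic_ge0.
apply: eq_fsbigr => r _.
under [RHS]eq_integral do rewrite EFinM muleCA.
have mh : measurable (h @^-1` [set r]) by exact: measurable_sfunP.
have [r0|r0] := leP 0%R r; last first.
  rewrite preimage_nnfun0// indic0.
  by under [RHS]eq_integral do rewrite mule0 mule0; rewrite integral0 integral0_eq// => x _; rewrite mulr0.
rewrite ge0_integralZl//; last 2 first.
  - by apply: emeasurable_funM; [exact/measurable_EFinP|exact/measurable_EFinP].
  - by move=> x _; rewrite mule_ge0 ?lee_fin.
under [LHS]eq_integral do rewrite EFinM.
rewrite ge0_integralZl//; last exact/measurable_EFinP.
congr (_ * _); rewrite integral_indic// setIT nuE// integral_mkcond.
apply: eq_integral => x _; rewrite patchE indicE.
by case: ifPn => xr; rewrite ?mule1 ?mule0.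
Qed.

Lemma ge0_integral_density (f : T -> \bar R) :
  measurable_fun setT f -> (forall x, 0 <= f x) ->
  \int[nu]_x f x = \int[mu]_x (f x * (p x)%:E).
Proof.
move=> mf f0; pose f_ := nnsfun_approx measurableT mf.
transitivity (limn (fun n => \int[nu]_x (f_ n x)%:E)).
  rewrite -monotone_convergence//=.
  - by apply: eq_integral => x _; apply/esym/cvg_lim => //=; exact: cvg_nnsfun_approx.
  - by move=> n; exact: measurableT_comp.
  - by move=> n x _; rewrite lee_fin.
  - by move=> x _ a b ab; rewrite lee_fin; exact/lefP/nd_nnsfun_approx.
rewrite (_ : \int[mu]_x (f x * (p x)%:E) = limn (fun n => \int[mu]_x (f_ n x * p x)%:E)).
  by congr (limn _); apply/funext => n; exact: integral_density_nnsfun.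
rewrite -monotone_convergence//=.
- apply: eq_integral => x _; apply/esym/cvg_lim => //=.
  under eq_fun do rewrite EFinM.
  by apply: cvgeZr => //; exact: cvg_nnsfun_approx.
- by move=> n; apply/measurable_EFinP; exact: measurable_funM.
- by move=> n x _; rewrite lee_fin mulr_ge0.
- by move=> x _ a b ab; rewrite lee_fin ler_wpM2r//; exact/lefP/nd_nnsfun_approx.
Qed.

(** The function is the difference of the nonnegative [f + |f|] and [|f|], both integrable against
    the density. *)
Lemma integral_density (f : T -> R) : measurable_fun setT f ->
  mu.-integrable setT (EFin \o (fun x => f x * p x)%R) ->
  nu.-integrable setT (EFin \o f) /\
  \int[nu]_x (f x)%:E = \int[mu]_x (f x * p x)%:E.
Proof.
move=> mf ifp; pose af x := `|f x|%R; pose h x := (f x + af x)%R.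
have maf : measurable_fun setT af by exact: measurableT_comp.
have mh : measurable_fun setT h by exact: measurable_funD.
have af0 x : (0 <= af x)%R by exact: normr_ge0.
have h0 x : (0 <= h x)%R by rewrite /h /af; have := ler_norm (- f x)%R; rewrite normrN; lra.
have afp x : (af x * p x = `|f x * p x|)%R by rewrite normrM (ger0_norm (p0 x)).
have iafp : mu.-integrable setT (EFin \o (fun x => af x * p x)%R).
  rewrite (_ : _ \o _ = (abse \o (EFin \o (fun x => f x * p x)%R))%E).
    exact: integrable_abse.
  by apply/funext => x /=; rewrite afp.
have ihp : mu.-integrable setT (EFin \o (fun x => h x * p x)%R).
  rewrite (_ : _ \o _ = (EFin \o (fun x => f x * p x)%R) \+ (EFin \o (fun x => af x * p x)%R)).
    exact: integrableD.
  by apply/funext => x /=; rewrite /h mulrDl EFinD.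
have dens (k : T -> R) : measurable_fun setT k -> (forall x, 0 <= k x)%R ->
    \int[nu]_x (k x)%:E = \int[mu]_x (k x * p x)%:E.
  move=> mk k0; rewrite ge0_integral_density//; last exact/measurable_EFinP.
have integrable_nu (k : T -> R) : measurable_fun setT k -> (forall x, 0 <= k x)%R ->
    mu.-integrable setT (EFin \o (fun x => k x * p x)%R) ->
    nu.-integrable setT (EFin \o k).
  move=> mk k0 /integrableP[_ ikp]; apply/integrableP; split; first exact/measurable_EFinP.
  under eq_integral do rewrite /= ger0_norm//.
  rewrite dens//; apply: le_lt_trans ikp.
  apply: ge0_le_integral => //.
  - by move=> x _; rewrite lee_fin mulr_ge0.
  - by apply/measurable_EFinP; exact: measurable_funM.
  - by apply: measurableT_comp => //; apply/measurable_EFinP; exact: measurable_funM.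
  - by move=> x _; rewrite lee_fin ler_norm.
have inaf := integrable_nu _ maf af0 iafp.
have inh := integrable_nu _ mh h0 ihp.
have hB : EFin \o f = (EFin \o h) \- (EFin \o af).
  by apply/funext => x /=; rewrite /h -EFinB addrK.
split; first by rewrite hB; exact: integrableB.
transitivity (\int[nu]_x ((EFin \o h) \- (EFin \o af)) x); first by rewrite -hB.
rewrite integralB// dens// dens//.
rewrite -integralB//; apply: eq_integral => x _.
by rewrite /= -EFinB -mulrBl /h addrK.
Qed.

End density.

(** * Affine change of variables for Lebesgue measure *)

Section lebesgue_affine.
Context {R : realType}.
Variables (a b : R).
Hypothesis a0 : a != 0.
Notation mu := (@lebesgue_measure R).
Local Open Scope ereal_scope.

Let phi (x : R) : R := (a * x + b)%R.

Lemma measurable_affine : measurable_fun setT (fun x : R => a * x + b)%R.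
Proof. by apply: measurable_funD => //; exact: measurable_funM. Qed.

Let mphi : measurable_fun setT (phi : measurableTypeR R -> measurableTypeR R).
Proof. exact: measurable_affine. Qed.

Let push : {measure set (measurableTypeR R) -> \bar R} :=
  measure_function_pushforward__canonical__measure_function_Measure mu mphi.

Let m' : {measure set (measurableTypeR R) -> \bar R} :=
  mscale (NngNum (normr_ge0 a)) push.

Let preimage_affine (x y : R) : (x <= y)%R ->
  mu (phi @^-1` `]x, y]) = (`|a^-1| * (y - x))%:E.
Proof.
move=> xy; have itvE (c e : R) (l r : bool) : (c <= e)%R ->
    mu [set` Interval (BSide l c) (BSide r e)] = (e - c)%:E.
  rewrite lebesgue_measure_itv/= lte_fin le_eqVlt => /predU1P[->|->].
    by rewrite ltxx subrr.
  by rewrite EFinB.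
have [a1|a1] : (0 < a \/ a < 0)%R by apply/orP; rewrite orbC -neq_lt.
  rewrite (_ : _ @^-1` _ = `](x - b) / a, (y - b) / a]%classic)%R.
    rewrite itvE ?ler_pM2r ?invr_gt0 ?lerB// gtr0_norm ?invr_gt0//.
    by congr EFin; ring.
  apply/seteqP; split=> z /=; rewrite /phi !in_itv/= ltr_pdivrMr// ler_pdivlMr//; lra.
rewrite (_ : _ @^-1` _ = `[(y - b) / a, (x - b) / a[%classic)%R.
  rewrite itvE ?ler_nM2r ?invr_lt0 ?lerB// ltr0_norm ?invr_lt0//.
  by congr EFin; ring.
apply/seteqP; split=> z /=; rewrite /phi !in_itv/= ltr_ndivlMr// ler_ndivrMr//; lra.
Qed.

(** The push-forward of Lebesgue measure under [phi], multiplied by [|a|], agrees with Lebesgue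
    measure on half-open intervals, hence equals it. *)
Lemma ge0_integral_lebesgue_affine (A : set R) (f : R -> \bar R) :
  measurable A -> measurable_fun setT f -> (forall x, 0 <= f x) ->
  \int[mu]_(y in A) f y = `|a|%:E * \int[mu]_(x in phi @^-1` A) f (a * x + b)%R.
Proof.
move=> mA mf f0.
rewrite (eq_measure_integral m') => [|B mB _]; last first.
  apply: lebesgue_measure_unique => //= _ [[x y] /= xy <-].
  rewrite /m' /mscale/= /pushforward.
  have [xy'|yx] := leP x y.
    rewrite preimage_affine// lebesgue_measure_itv/= lte_fin -EFinM mulrA -normrM.
    rewrite divff// normr1 mul1r; move: xy'; rewrite le_eqVlt => /predU1P[->|->].
      by rewrite ltxx subrr.
    by rewrite EFinB.
  rewrite lebesgue_measure_itv/= lte_fin ltNge (ltW yx)/= (_ : _ @^-1` _ = set0).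
    by rewrite measure0 mule0.
  by rewrite -subset0 => z /=; rewrite in_itv/= => /andP[? ?]; lra.
rewrite /m' ge0_integral_mscale//=; last exact: measurable_funTS.
by rewrite ge0_integral_pushforward//; exact: measurable_funTS.
Qed.

End lebesgue_affine.

(** * Affine images and convolutions of normal laws *)

Section normal_affine.
Context {R : realType}.
Notation mu := (@lebesgue_measure R).
Local Open Scope ereal_scope.

Lemma normal_prob_affine (m s a b : R) (B : set R) : a != 0%R -> s != 0%R ->
  measurable B ->
  normal_prob m s [set x | B (a * x + b)%R] = normal_prob (a * m + b) (a * s) B.
Proof.
move=> a0 s0 mB; have as0 : (a * s != 0)%R by rewrite mulf_neq0.
rewrite /normal_prob (ge0_integral_lebesgue_affine b a0 mB); last first.
- by move=> x; rewrite lee_fin normal_pdf_ge0.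
- by apply/measurable_EFinP; exact: measurable_normal_pdf.
have mpre : measurable [set x | B (a * x + b)%R].
  by rewrite -[X in measurable X]setTI; apply: measurable_affine.
rewrite -ge0_integralZl//; last 2 first.
- apply/measurable_funTS/measurable_EFinP; apply: measurableT_comp.
    exact: measurable_normal_pdf.
  exact: measurable_affine.
- by move=> x _; rewrite lee_fin normal_pdf_ge0.
apply: eq_integral => x _; rewrite -EFinM; congr EFin.
rewrite !normal_pdfE// /normal_peak /normal_fun mulrA; congr (_ * expR _)%R; last first.
  by field; rewrite s0.
have -> : ((a * s) ^+ 2 * pi *+ 2 = a ^+ 2 * (s ^+ 2 * pi *+ 2))%R by ring.
by rewrite (sqrtrM _ (sqr_ge0 a)) sqrtr_sqr invfM mulrA divff ?mul1r// normr_eq0.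
Qed.

(** Both degenerate cases yield a Dirac law: [s = 0] moves the atom, and [a = 0] collapses
    everything to [b]. *)
Lemma gauss1_affine (m s a b : R) (B : set R) : measurable B ->
  gauss1 m s [set x | B (a * x + b)%R] = gauss1 (a * m + b) (a * s) B.
Proof.
move=> mB; rewrite /gauss1 mulf_eq0.
have [->/=|s0] := eqVneq s 0%R.
  by rewrite orbT !diracE.
have [->/=|a0] := eqVneq a 0%R; last exact: normal_prob_affine.
rewrite mul0r add0r diracE; have [/set_mem Bb|/negP Bb] := boolP (b \in B).
  rewrite (_ : [set x | _] = setT) ?probability_setT//.
  by apply/seteqP; split=> // x _ /=; rewrite mul0r add0r.
rewrite (_ : [set x | _] = set0) ?measure0//.
by apply/seteqP; split=> // x /=; rewrite mul0r add0r => /mem_set.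
Qed.

Lemma ge0_integral_normal_prob (m s : R) (f : R -> \bar R) :
  measurable_fun setT f -> (forall x, 0 <= f x) ->
  \int[normal_prob m s]_x f x = \int[mu]_x (f x * (normal_pdf m s x)%:E).
Proof.
move=> mf f0; apply: (@ge0_integral_density _ _ _ mu (normal_prob m s)) => //.
  exact: measurable_normal_pdf.
by move=> x; exact: normal_pdf_ge0.
Qed.

Let measurable_normal_pdf2 (t : R) : t != 0%R ->
  measurable_fun setT (fun xz : R * R => normal_pdf xz.1 t xz.2).
Proof.
move=> t0; rewrite (_ : (fun _ => _) = (fun y => normal_pdf 0 t y) \o (fun xz => xz.2 - xz.1)%R).
  by apply: measurableT_comp; [exact: measurable_normal_pdf|exact: measurable_funB].
by apply/funext => -[x z] /=; rewrite !normal_pdfE// /normal_fun subr0.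
Qed.

Let G (t : R) (B : set R) (xz : R * R) := (normal_pdf xz.1 t xz.2 * \1_B xz.2)%:E.

Let mG t B : t != 0%R -> measurable B -> measurable_fun setT (G t B).
Proof.
move=> t0 mB; apply/measurable_EFinP; apply: measurable_funM.
  exact: measurable_normal_pdf2.
by apply: measurableT_comp => //; exact: measurable_indic.
Qed.

Let G0 t B xz : 0 <= G t B xz.
Proof. by rewrite lee_fin mulr_ge0// normal_pdf_ge0. Qed.

Let normal_probE t B x : normal_prob x t B = \int[mu]_z G t B (x, z).
Proof.
rewrite /normal_prob integral_mkcond; apply: eq_integral => z _.
by rewrite patchE /G/= indicE; case: ifPn => _; rewrite ?mulr1 ?mulr0.
Qed.

(** Tonelli's theorem for the density, which is jointly measurable in the mean and the variable. *)
Lemma measurable_normal_prob (t : R) (B : set R) : t != 0%R -> measurable B ->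
  measurable_fun setT (fun x => normal_prob x t B).
Proof.
move=> t0 mB; have mGtB := mG t0 mB; have G0tB := G0 t B.
under eq_fun do rewrite normal_probE.
exact: measurable_fun_fubini_tonelli_F.
Qed.

(* Completing the square in the product of the two densities. *)
Lemma normal_prob_convolution (m s t : R) (B : set R) : s != 0%R -> t != 0%R ->
  measurable B ->
  \int[normal_prob m s]_x normal_prob x t B =
  normal_prob m (Num.sqrt (s ^+ 2 + t ^+ 2)) B.
Proof.
move=> s0 t0 mB; set c := Num.sqrt _.
have s2 : (0 < s ^+ 2)%R by rewrite lt_neqAle sqr_ge0 eq_sym sqrf_eq0 s0.
have t2 : (0 < t ^+ 2)%R by rewrite lt_neqAle sqr_ge0 eq_sym sqrf_eq0 t0.
have c2 : (c ^+ 2 = s ^+ 2 + t ^+ 2)%R by rewrite sqr_sqrtr// ltW// addr_gt0.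
have c0 : c != 0%R by rewrite -sqrf_eq0 c2 gt_eqF// addr_gt0.
(* Density of the sum [z] times the conditional density of [x] given [z]; the conditional mean is
   the average of [m] and [z] with weights [t ^+ 2] and [s ^+ 2]. *)
have pdfE x z : (normal_pdf x t z * normal_pdf m s x =
    normal_pdf m c z * normal_pdf ((t ^+ 2 * m + s ^+ 2 * z) / c ^+ 2) (s * t / c) x)%R.
  rewrite !normal_pdfE ?mulf_neq0 ?invr_eq0// /normal_peak /normal_fun.
  rewrite mulrACA [RHS]mulrACA -!expRD -!invfM; congr (_^-1 * expR _)%R.
    rewrite -!sqrtrM; [|by rewrite mulrn_wge0// mulr_ge0 ?sqr_ge0 ?pi_ge0..].
    congr Num.sqrt; field.
    by rewrite c0.
  have cc : (s ^+ 2 + t ^+ 2 != 0)%R by rewrite -c2 sqrf_eq0.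
  rewrite !exprMn !exprVn c2; field.
  by rewrite s0 t0 cc.
rewrite ge0_integral_normal_prob//; last exact: measurable_normal_prob.
pose F (xz : R * R) := G t B xz * (normal_pdf m s xz.1)%:E.
have mF : measurable_fun setT F.
  apply: emeasurable_funM; [exact: mG|apply/measurable_EFinP].
  by apply: measurableT_comp => //; exact: measurable_normal_pdf.
have F0 xz : 0 <= F xz by rewrite mule_ge0 ?G0// lee_fin normal_pdf_ge0.
transitivity (\int[mu]_x \int[mu]_z F (x, z)).
  apply: eq_integral => x _; rewrite normal_probE /F /= ge0_integralZr//.
  - by apply: measurableT_comp; [exact: mG|exact: measurable_pair1].
  - by rewrite lee_fin normal_pdf_ge0.
rewrite [LHS](@fubini_tonelli _ _ _ _ _ mu mu F mF F0) /normal_prob [RHS]integral_mkcond.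
apply: eq_integral => z _.
under eq_integral => x _ do rewrite /F /G /= -EFinM mulrAC pdfE mulrAC EFinM.
rewrite ge0_integralZl//; last 3 first.
- by apply/measurable_EFinP; exact: measurable_normal_pdf.
- by move=> x _; rewrite lee_fin normal_pdf_ge0.
- by rewrite lee_fin mulr_ge0// normal_pdf_ge0.
rewrite integral_normal_pdf mule1 patchE indicE.
by case: ifPn => _; rewrite ?mulr1 ?mulr0.
Qed.

Lemma gauss1_normr (m s : R) : gauss1 m `|s|%R = gauss1 m s.
Proof.
have [->|s0] := eqVneq s 0%R; first by rewrite normr0.
rewrite /gauss1 normr_eq0 (negbTE s0).
have ns0 : `|s|%R != 0%R by rewrite normr_eq0.
rewrite /normal_prob; apply/funext => B; apply: eq_integral => x _; congr EFin.
by rewrite !normal_pdfE// /normal_peak /normal_fun real_normK// num_real.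
Qed.

(** The law of [a * X + s * Y] for independent standard normal [X] and [Y], obtained by conditioning
    on [X]. For [s = 0] the mixture of Dirac laws is just the law of [a * X]. *)
Lemma gauss1_convolution (a s : R) (B : set R) : measurable B ->
  \int[normal_prob 0 1]_x gauss1 (a * x)%R s B =
  gauss1 0 (Num.sqrt (a ^+ 2 + s ^+ 2)) B.
Proof.
move=> mB; have [->|s0] := eqVneq s 0%R.
  rewrite expr0n/= addr0 sqrtr_sqr gauss1_normr.
  transitivity (\int[normal_prob 0 1]_(x in [set x | B (a * x + 0)%R]) (cst 1) x).
    rewrite [RHS]integral_mkcond; apply: eq_integral => x _.
    rewrite /gauss1 eqxx diracE patchE; case: ifPn => [/set_mem|/negP] /= H.
      by rewrite addr0 in H; rewrite mem_set.
    by rewrite memNset// => H'; apply: H; apply: mem_set => /=; rewrite addr0.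
  rewrite integral_cst//; last first.
    by rewrite -[X in measurable X]setTI; exact: measurable_affine.
  rewrite mul1e; have := gauss1_affine 0 1 a 0 mB.
  by rewrite mulr0 addr0 mulr1 /gauss1 oner_eq0.
have [->|a0] := eqVneq a 0%R.
  rewrite expr0n/= add0r sqrtr_sqr gauss1_normr.
  under eq_integral do rewrite mul0r.
  by rewrite integral_cst// [X in _ * X](@probability_setT _ _ _ (normal_prob 0 1)) mule1.
rewrite /gauss1 (negbTE s0) ifF; last first.
  by apply/negbTE; rewrite gt_eqF// sqrtr_gt0 ltr_pwDl ?sqr_ge0// lt_neqAle sqr_ge0 eq_sym sqrf_eq0 a0.
transitivity (\int[normal_prob 0 a]_x normal_prob x s B); last exact: normal_prob_convolution.
have mphi : measurable_fun setT (( *%R a) : measurableTypeR R -> measurableTypeR R).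
  exact: measurable_funM.
transitivity (\int[pushforward (normal_prob 0 1)
   (( *%R a) : measurableTypeR R -> measurableTypeR R)]_y normal_prob y s B).
  rewrite ge0_integral_pushforward//; first exact: measurable_normal_prob.
apply: eq_measure_integral => A mA _.
have := @normal_prob_affine 0 1 a 0 A a0 (oner_neq0 _) mA.
rewrite mulr0 addr0 mulr1 => E; apply: etrans E; rewrite /pushforward.
congr (normal_prob 0 1 _); by apply/seteqP; split=> x /=; rewrite addr0.
Qed.

End normal_affine.

(** * Independent standard normal variables *)

Section iid_normal.
Context {R : realType}.
Local Open Scope ereal_scope.

(** The product space is built one factor at a time. The box formula serves the lower bound on
    Hausdorff measure; the law of linear forms serves the existence of Gaussian measures. *)
Lemma exists_iid_normal d : exists (disp : measure_display)
    (T : measurableType disp) (P : probability T R) (Z : T -> 'rV[R]_d),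
  [/\ forall i, measurable_fun setT (fun w => Z w 0%R i),
    forall B : 'I_d -> set R, (forall i, measurable (B i)) ->
      P [set w | forall i, B i (Z w 0%R i)] = \prod_i normal_prob 0 1 (B i) &
    forall (a : 'rV[R]_d) (B : set R), measurable B ->
      P [set w | B (dot a (Z w))] = gauss1 0 (enorm a) B].
Proof.
elim: d => [|d [disp [T [P [Z [mZ boxZ dotZ]]]]]].
  exists _, unit, \d_tt, (fun=> 0%R); split=> [[]//|B mB|a B mB].
    rewrite big_ord0 (_ : [set w | _] = setT) ?probability_setT//.
    by apply/seteqP; split=> // w _ [].
  rewrite (thinmx0 a) /gauss1 enorm0 eqxx !diracE.
  by rewrite dot0l; congr (_%:R%:E); congr nat_of_bool; apply/idP/idP => /set_mem H; apply/mem_set.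
pose Z' (xw : measurableTypeR R * T) : 'rV[R]_d.+1 :=
  (\row_i (if unlift ord0 i is Some j then Z xw.2 0 j else xw.1))%R.
exists _, (measurableTypeR R * T)%type, (normal_prob 0 1 \x P), Z'.
have mZ' i : measurable_fun setT (fun w => Z' w 0%R i).
  rewrite (_ : (fun w => _) = (fun w : measurableTypeR R * T =>
      if unlift ord0 i is Some j then Z w.2 0%R j else w.1)); last first.
    by apply/funext => w; rewrite mxE.
  case: unliftP => [j _|_]; last exact: measurable_fst.
  by apply: measurableT_comp (mZ j) _.
split=> // [B mB|a B mB].
  rewrite (_ : [set w | _] = B ord0 `*` [set w | forall i, B (lift ord0 i) (Z w 0%R i)]).
    set W := [set w | forall i, _]; have mW : measurable W.
    rewrite /W (_ : [set w | _] = \bigcap_(i in [set: 'I_d])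
      ((fun w => Z w 0%R i) @^-1` (B (lift ord0 i)))); last first.
      by apply/seteqP; split=> w H i; [move=> _|]; apply: H.
      apply: fin_bigcap_measurable => // i _.
      by rewrite -[X in measurable X]setTI; exact: mZ.
    have := @product_measure1E _ _ _ _ _ (normal_prob 0 1) P _ _ (mB ord0) mW.
    by move=> /= ->; rewrite /W (boxZ (fun i => B (lift ord0 i)))// big_ord_recl.
  apply/seteqP; split=> -[x w] /=.
    move=> H; split=> [|i]; first by have := H ord0; rewrite mxE unlift_none.
    by have := H (lift ord0 i); rewrite mxE liftK.
  by move=> [H0 H] i; rewrite mxE; case: unliftP => [j ->|->].
pose a' : 'rV[R]_d := (\row_i a 0 (lift ord0 i))%R.
have dotE xw : dot a (Z' xw) = (a 0 ord0 * xw.1 + dot a' (Z xw.2))%R.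
  rewrite /dot big_ord_recl !mxE unlift_none; congr (_ + _)%R.
  by apply: eq_bigr => i _; rewrite !mxE liftK.
transitivity ((normal_prob 0 1 \x P) [set w | B (dot a (Z' w))]); first by [].
rewrite /product_measure1.
(* With the first coordinate frozen at [x], the linear form is the form [a'] in the others, shifted
   by [a 0 ord0 * x]. *)
transitivity (\int[normal_prob 0 1]_x gauss1 (a 0 ord0 * x)%R (enorm a') B).
  apply: eq_integral => x _ /=.
  have := gauss1_affine 0 (enorm a') 1 (a 0%R ord0 * x) mB.
  rewrite mulr0 add0r mul1r => <-; rewrite -dotZ; last first.
    by rewrite -[X in measurable X]setTI; exact: measurable_affine.
  congr (P _); apply/seteqP; split=> w /=.
    by move=> /xsectionP /=; rewrite dotE/= mul1r addrC.
  by move=> H; apply/xsectionP => /=; rewrite dotE/=; rewrite mul1r addrC in H.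
have -> : enorm a = Num.sqrt (a 0 ord0 ^+ 2 + enorm a' ^+ 2)%R.
  rewrite sqr_enorm /enorm /dot big_ord_recl; congr (Num.sqrt (_ + _)%R).
  by apply: eq_bigr => i _; rewrite !mxE.
exact: gauss1_convolution.
Qed.

End iid_normal.

(** * Masses of boxes, and the area of spheres in affine subspaces *)

Section normal_box.
Context {R : realType}.
Local Open Scope ereal_scope.
Notation mu := (@lebesgue_measure R).

Lemma normal_prob_itv_le (a r : R) : (0 <= r)%R ->
  normal_prob 0 1 `[(a - r)%R, (a + r)%R] <= (2 * normal_peak 1 * r)%:E.
Proof.
move=> r0; apply: (@le_trans _ _
    (\int[mu]_(x in `[(a - r)%R, (a + r)%R]) (normal_peak 1)%:E)).
  apply: ge0_le_integral => //=.
  - by move=> x _; rewrite lee_fin normal_pdf_ge0.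
  - by apply/measurable_EFinP/measurable_funTS; exact: measurable_normal_pdf.
  - by move=> x _; rewrite lee_fin normal_pdf_ub// oner_neq0.
rewrite integral_cst//= lebesgue_measure_itv/= lte_fin.
case: ifPn => _; last by rewrite mule0 lee_fin !mulr_ge0// normal_peak_ge0.
by rewrite -EFinB -EFinM lee_fin le_eqVlt; apply/orP; left; apply/eqP; ring.
Qed.

Lemma normal_prob_itv_gt0 : 0 < normal_prob 0 1 `[(-1)%R : R, 1%R].
Proof.
(* On [[-1, 1]] the exponent is at least -1/2, so [expR (- 1)] is a crude lower bound. *)
have p0 : (0 < @normal_peak R 1 * expR (- 1))%R.
  by rewrite mulr_gt0 ?expR_gt0// normal_peak_gt0// oner_neq0.
apply: (@lt_le_trans _ _ (\int[mu]_(x in `[(-1)%R : R, 1%R]) (normal_peak 1 * expR (- 1))%:E)).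
  rewrite integral_cst//= lebesgue_measure_itv/= lte_fin ifT; last by lra.
  by rewrite -EFinB -EFinM lte_fin mulr_gt0//; lra.
apply: ge0_le_integral => //=.
- by move=> x _; rewrite lee_fin ltW.
- by apply/measurable_EFinP/measurable_funTS; exact: measurable_normal_pdf.
- move=> x; rewrite in_itv/= => x1; rewrite lee_fin normal_pdfE ?oner_neq0//.
  rewrite ler_wpM2l ?normal_peak_ge0// ler_expR subr0 expr1n.
  case/andP: x1 => x1 x2; have x21 : (x ^+ 2 <= 1)%R by rewrite expr2; nra.
  rewrite mulNr lerN2 ler_pdivrMr ?mul1r; last by rewrite mulr2n; lra.
  by rewrite mulr2n; lra.
Qed.

Lemma exists_box_measure d : exists (disp : measure_display)
    (T : measurableType disp) (P : {measure set T -> \bar R}) (Z : T -> 'rV[R]_d) (K : R),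
  [/\ forall i, measurable_fun setT (fun w => Z w 0%R i), (0 <= K)%R,
    forall (a : 'rV[R]_d) (e : R), (0 <= e)%R ->
      P [set w | forall i, (`|Z w ord0 i - a ord0 i| <= e)%R] <= ((K * e) ^+ d)%:E &
    0 < P [set w | (`|Z w| <= 1)%R]].
Proof.
have [disp [T [P [Z [mZ boxZ _]]]]] := @exists_iid_normal R d.
exists disp, T, P, Z, (2 * normal_peak 1)%R; split=> //.
- by rewrite mulr_ge0// normal_peak_ge0.
- move=> a e e0.
  pose B i : set R := `[(a 0 i - e)%R, (a 0 i + e)%R]%classic.
  rewrite (_ : [set w | _] = [set w | forall i, B i (Z w 0%R i)]); last first.
    apply/seteqP; split=> w /= H i; have := H i; rewrite /B/= in_itv/= ler_norml;
    by move=> /andP[h1 h2]; apply/andP; split; lra.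
  refine (eq_ind_r (fun z => z <= _) _ (boxZ B (fun i => measurable_itv _))).
  have le1 i : normal_prob 0 1 (B i) <= (2 * normal_peak 1 * e)%:E.
    exact: normal_prob_itv_le.
  have ge0 i : 0 <= normal_prob 0 1 (B i) by exact: measure_ge0.
  move: (B) le1 ge0 => {a boxZ mZ Z T P disp} {}B le1 ge0.
  elim: d B le1 ge0 => [|d ih] B le1 ge0; first by rewrite big_ord0 expr0.
  rewrite big_ord_recl exprS EFinM; apply: lee_pmul; [exact: ge0| |exact: le1|].
    by apply: prode_ge0 => i _; exact: ge0.
  by apply: ih => i; [exact: le1|exact: ge0].
- pose B (i : 'I_d) : set R := `[(-1)%R, 1%R]%classic.
  rewrite (_ : [set w | _] = [set w | forall i, B i (Z w 0%R i)]); last first.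
    apply/seteqP; split=> w /= H; last first.
      by apply: normr_rV_leP => // i; have := H i; rewrite /B/= in_itv/= ler_norml.
    by move=> i; rewrite /B/= in_itv/= -ler_norml; exact: le_trans (normr_coord_le _ _) H.
  refine (eq_ind_r (fun z => 0 < z) _ (boxZ B (fun i => measurable_itv _))).
  elim/big_ind: _ => [|x y x0 y0|i _]; first by rewrite lte01.
    exact: mule_gt0.
  exact: normal_prob_itv_gt0.
Qed.

Lemma hausdorff_ellipsoid n d (B : 'M[R]_(d.+1, n)) (c : 'rV[R]_n) (r : R) :
  row_free B -> (0 < r)%R ->
  0 < hausdorff d [set x : 'rV[R]_n |
    exists2 y : 'rV[R]_d.+1, x = (c + y *m B)%R & enorm (y *m B) = r] < +oo.
Proof.
move=> freeB r0; rewrite hausdorff_ellipsoid_lty// andbT.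
have [disp [T [P [Z [K [mZ K0 PZ P1]]]]]] := exists_box_measure d.
exact: hausdorff_ellipsoid_gt0 mZ K0 PZ P1.
Qed.

End normal_box.

(** * Means of polynomially growing functions *)

Section poly_growth.
Context {R : realType} {n : nat}.
Implicit Types f g : 'rV[R]_n -> R.

(** An algebra of test functions containing both the polynomials and the bounded continuous
    functions, and integrable for the surface measures as well as for Gaussian measures. *)
Definition poly_growth f :=
  continuous f /\ exists K N, forall x, `|f x| <= K * (1 + `|x|) ^+ N.

Lemma poly_growth_ge0 f : poly_growth f ->
  exists (K : R) (N : nat), 0 <= K /\ forall x, `|f x| <= K * (1 + `|x|) ^+ N.
Proof.
move=> [_ [K [N fK]]]; exists K, N; split => //.
have := le_trans (normr_ge0 _) (fK 0).
by rewrite normr0 addr0 expr1n mulr1.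
Qed.

Lemma poly_growth_bounded f (M : R) : continuous f -> (forall x, `|f x| <= M) ->
  poly_growth f.
Proof.
by move=> cf fM; split=> //; exists M, 0%N => x; rewrite expr0 mulr1.
Qed.

Lemma poly_growth_cst (c : R) : poly_growth (fun=> c).
Proof. by apply: (@poly_growth_bounded _ `|c|); first exact: cst_continuous. Qed.

Lemma poly_growthD f g : poly_growth f -> poly_growth g ->
  poly_growth (fun x => f x + g x).
Proof.
move=> pf pg; have [K [N [K0 fK]]] := poly_growth_ge0 pf.
have [L [M [L0 gL]]] := poly_growth_ge0 pg.
split; first by move=> x; apply: continuousD; [apply: pf.1|apply: pg.1].
exists (K + L), (N + M)%N => x; apply: (le_trans (ler_normD _ _)).
have x1 : 1 <= 1 + `|x| by rewrite lerDl.
rewrite mulrDl lerD//.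
  by apply: (le_trans (fK x)); rewrite ler_wpM2l ?ler_weXn2l ?leq_addr.
by apply: (le_trans (gL x)); rewrite ler_wpM2l ?ler_weXn2l ?leq_addl.
Qed.

Lemma poly_growthM f g : poly_growth f -> poly_growth g ->
  poly_growth (fun x => f x * g x).
Proof.
move=> pf pg; have [K [N [K0 fK]]] := poly_growth_ge0 pf.
have [L [M [L0 gL]]] := poly_growth_ge0 pg.
split; first by move=> x; apply: continuousM; [apply: pf.1|apply: pg.1].
exists (K * L), (N + M)%N => x; rewrite normrM exprD mulrACA.
by rewrite ler_pM.
Qed.

Lemma poly_growthZ (a : R) f : poly_growth f -> poly_growth (fun x => a * f x).
Proof. by move=> pf; apply: poly_growthM => //; exact: poly_growth_cst. Qed.

Lemma poly_growthB f g : poly_growth f -> poly_growth g ->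
  poly_growth (fun x => f x - g x).
Proof.
move=> pf pg; rewrite (_ : (fun x => _) = (fun x => f x + -1 * g x)).
  by apply: poly_growthD => //; exact: poly_growthZ.
by apply/funext => x; rewrite mulN1r.
Qed.

Lemma poly_growthX f m : poly_growth f -> poly_growth (fun x => f x ^+ m).
Proof.
move=> pf; elim: m => [|m ih]; first exact: poly_growth_cst.
rewrite (_ : (fun x => _) = (fun x => f x * f x ^+ m)); first exact: poly_growthM.
by apply/funext => x; rewrite exprS.
Qed.

Lemma poly_growth_sum (I : Type) (r : seq I) (F : I -> 'rV[R]_n -> R) :
  (forall i, poly_growth (F i)) -> poly_growth (fun x => \sum_(i <- r) F i x).
Proof.
move=> pF; elim: r => [|i r ih].
  rewrite (_ : (fun x => _) = (fun=> 0)); first exact: poly_growth_cst.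
  by apply/funext => x; rewrite big_nil.
rewrite (_ : (fun x => _) = (fun x => F i x + \sum_(j <- r) F j x)).
  exact: poly_growthD.
by apply/funext => x; rewrite big_cons.
Qed.

Lemma poly_growth_coord i : poly_growth (fun x : 'rV[R]_n => x 0 i).
Proof.
split; first exact: coord_continuous.
exists 1, 1%N => x; rewrite mul1r expr1 (le_trans (normr_coord_le x i))//.
by rewrite lerDr.
Qed.

Lemma poly_growth_dot (a : 'rV[R]_n) : poly_growth (dot a).
Proof. by apply: poly_growth_sum => i; apply: poly_growthZ; exact: poly_growth_coord. Qed.

Lemma poly_growth_dotl (a : 'rV[R]_n) : poly_growth (fun x => dot x a).
Proof.
rewrite (_ : (fun x => _) = dot a); first exact: poly_growth_dot.
by apply/funext => x; exact: dotC.
Qed.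

Lemma dot_continuous (a : 'rV[R]_n) : continuous (dot a).
Proof. exact: (poly_growth_dot a).1. Qed.

Lemma poly_growth_cos_dot t : poly_growth (fun x => cos (dot t x)).
Proof.
apply: (@poly_growth_bounded _ 1) => x; last exact: cos_max.
by apply: continuous_comp; [exact: dot_continuous|exact: continuous_cos].
Qed.

Lemma poly_growth_sin_dot t : poly_growth (fun x => sin (dot t x)).
Proof.
apply: (@poly_growth_bounded _ 1) => x; last exact: sin_max.
by apply: continuous_comp; [exact: dot_continuous|exact: continuous_sin].
Qed.

End poly_growth.

Section mean.
Context {R : realType} {n : nat}.
Implicit Types (f g : 'rV[R]_n -> R) (E : ('rV[R]_n -> R) -> R).

(* The properties of f |-> \int f dmu, mu a probability measure with finite
   moments, that the proof relies on. *)
Definition is_mean E :=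
  [/\ E (fun=> 1) = 1,
      forall f g, poly_growth f -> poly_growth g ->
        E (fun x => f x + g x) = E f + E g,
      forall (a : R) f, poly_growth f -> E (fun x => a * f x) = a * E f &
      forall f, poly_growth f -> (forall x, 0 <= f x) -> 0 <= E f].

Variable E : ('rV[R]_n -> R) -> R.
Hypothesis mE : is_mean E.

Lemma meanD f g : poly_growth f -> poly_growth g ->
  E (fun x => f x + g x) = E f + E g.
Proof using mE. by case: mE => _ + _ _; exact. Qed.

Lemma meanZ a f : poly_growth f -> E (fun x => a * f x) = a * E f.
Proof using mE. by case: mE => _ _ + _; exact. Qed.

Lemma mean_ge0 f : poly_growth f -> (forall x, 0 <= f x) -> 0 <= E f.
Proof using mE. by case: mE => _ _ _; exact. Qed.

Lemma mean_cst (c : R) : E (fun=> c) = c.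
Proof using mE.
rewrite -[in LHS](mulr1 c) (meanZ c (poly_growth_cst 1)); case: mE => -> _ _ _.
by rewrite mulr1.
Qed.

Lemma meanB f g : poly_growth f -> poly_growth g ->
  E (fun x => f x - g x) = E f - E g.
Proof using mE.
move=> pf pg; rewrite (_ : (fun x => _) = (fun x => f x + -1 * g x)).
  by rewrite meanD ?meanZ ?mulN1r//; exact: poly_growthZ.
by apply/funext => x; rewrite mulN1r.
Qed.

Lemma mean_le f g : poly_growth f -> poly_growth g -> (forall x, f x <= g x) ->
  E f <= E g.
Proof using mE.
move=> pf pg fg; rewrite -subr_ge0 -meanB//; apply: mean_ge0; first exact: poly_growthB.
by move=> x; rewrite subr_ge0.
Qed.

Lemma mean_norm_le f g : poly_growth f -> poly_growth g ->
  (forall x, `|f x| <= g x) -> `|E f| <= E g.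
Proof using mE.
move=> pf pg fg; rewrite ler_norml -mulN1r -meanZ//; apply/andP; split; apply: mean_le => //.
- exact: poly_growthZ.
- by move=> x; have := fg x; rewrite ler_norml; lra.
- by move=> x; have := fg x; rewrite ler_norml; lra.
Qed.

Lemma mean_sum (I : Type) (r : seq I) (F : I -> 'rV[R]_n -> R) :
  (forall i, poly_growth (F i)) ->
  E (fun x => \sum_(i <- r) F i x) = \sum_(i <- r) E (F i).
Proof using mE.
move=> pF; elim: r => [|i r ih].
  rewrite big_nil -[RHS](mean_cst 0); congr E.
  by apply/funext => x; rewrite big_nil.
rewrite big_cons -ih -meanD//; last exact: poly_growth_sum.
by congr E; apply/funext => x; rewrite big_cons.
Qed.

End mean.

(** * The algebra of trigonometric polynomials *)

Section trig.
Context {R : realType} {n : nat}.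

Inductive trig_poly : ('rV[R]_n -> R) -> Prop :=
| trig_cos t : trig_poly (fun x => cos (dot t x))
| trig_sin t : trig_poly (fun x => sin (dot t x))
| trigD f g : trig_poly f -> trig_poly g -> trig_poly (fun x => f x + g x)
| trigZ (a : R) f : trig_poly f -> trig_poly (fun x => a * f x).

Lemma trig_ext f g : f =1 g -> trig_poly f -> trig_poly g.
Proof. by move=> /funext ->. Qed.

Lemma trig_poly_growth f : trig_poly f -> poly_growth f.
Proof.
elim=> [t|t|{}f g _ pf _ pg|a {}f _ pf].
- exact: poly_growth_cos_dot.
- exact: poly_growth_sin_dot.
- exact: poly_growthD.
- exact: poly_growthZ.
Qed.

Lemma trig_cst c : trig_poly (fun=> c).
Proof.
apply: trig_ext (trigZ c (trig_cos 0)) => x.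
by rewrite dot0l cos0 mulr1.
Qed.

(** The product-to-sum formulas settle the generators; linearity in each factor does the rest. *)
Lemma trigM f g : trig_poly f -> trig_poly g -> trig_poly (fun x => f x * g x).
Proof.
have key h h' t : trig_poly (fun x => h (dot t x)) -> (h = cos \/ h = sin) ->
    (h' = cos \/ h' = sin) -> forall s, trig_poly (fun x => h (dot t x) * h' (dot s x)).
  move=> _ [->|->] [->|->] s.
  - apply: trig_ext (trigZ 2^-1 (trigD (trig_cos (t - s)) (trig_cos (t + s)))) => x.
    by rewrite dotBl dotDl cosB cosD; field.
  - apply: trig_ext (trigZ 2^-1 (trigD (trig_sin (t + s)) (trigZ (-1) (trig_sin (t - s))))) => x.
    by rewrite dotBl dotDl sinB sinD; field.
  - apply: trig_ext (trigZ 2^-1 (trigD (trig_sin (t - s)) (trig_sin (t + s)))) => x.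
    by rewrite dotBl dotDl sinB sinD; field.
  - apply: trig_ext (trigZ 2^-1 (trigD (trig_cos (t - s)) (trigZ (-1) (trig_cos (t + s))))) => x.
    by rewrite dotBl dotDl cosB cosD; field.
have left h t : (h = cos \/ h = sin) -> forall g, trig_poly g ->
    trig_poly (fun x => h (dot t x) * g x).
  move=> hcs {}g; elim=> [s|s|g1 g2 _ t1 _ t2|a g1 _ t1].
  - by apply: key => //; [case: hcs => ->; constructor|left].
  - by apply: key => //; [case: hcs => ->; constructor|right].
  - by apply: trig_ext (trigD t1 t2) => x; rewrite mulrDr.
  - by apply: trig_ext (trigZ a t1) => x; rewrite mulrCA.
move=> tf tg; elim: tf => [t|t|f1 f2 _ t1 _ t2|a f1 _ t1].
- by apply: left => //; left.
- by apply: left => //; right.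
- by apply: trig_ext (trigD t1 t2) => x; rewrite mulrDl.
- by apply: trig_ext (trigZ a t1) => x; rewrite mulrA.
Qed.

Lemma trigX f m : trig_poly f -> trig_poly (fun x => f x ^+ m).
Proof.
move=> tf; elim: m => [|m ih]; first exact: trig_cst.
by apply: trig_ext (trigM tf ih) => x; rewrite exprS.
Qed.

Lemma trig_sum (I : Type) (r : seq I) (F : I -> 'rV[R]_n -> R) :
  (forall i, trig_poly (F i)) -> trig_poly (fun x => \sum_(i <- r) F i x).
Proof.
move=> tF; elim: r => [|i r ih].
  by apply: trig_ext (trig_cst 0) => x; rewrite big_nil.
by apply: trig_ext (trigD (tF i) ih) => x; rewrite big_cons.
Qed.

Lemma trig_prod (I : Type) (r : seq I) (F : I -> 'rV[R]_n -> R) :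
  (forall i, trig_poly (F i)) -> trig_poly (fun x => \prod_(i <- r) F i x).
Proof.
move=> tF; elim: r => [|i r ih].
  by apply: trig_ext (trig_cst 1) => x; rewrite big_nil.
by apply: trig_ext (trigM (tF i) ih) => x; rewrite big_cons.
Qed.

End trig.

(** * Bernstein weights *)

Section bernstein.
Context {R : realType}.
Implicit Types (s : R) (g : nat -> R).

Definition bernstein N s j : R := 'C(N, j)%:R * s ^+ j * (1 - s) ^+ (N - j).

Lemma bernstein_ge0 N s j : 0 <= s <= 1 -> 0 <= bernstein N s j.
Proof.
by move=> /andP[s0 s1]; rewrite !mulr_ge0// ?exprn_ge0// subr_ge0.
Qed.

(** Conditioning a binomial variable on its last trial, by Pascal's rule. *)
Lemma sum_bernsteinS N s g :
  \sum_(j < N.+2) bernstein N.+1 s j * g j =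
  s * (\sum_(j < N.+1) bernstein N s j * g j.+1) +
  (1 - s) * (\sum_(j < N.+1) bernstein N s j * g j).
Proof.
have -> : (1 - s) * (\sum_(j < N.+1) bernstein N s j * g j) =
    \sum_(j < N.+2) 'C(N, j)%:R * s ^+ j * (1 - s) ^+ (N.+1 - j) * g j.
  rewrite [RHS]big_ord_recr/= bin_small// !mul0r addr0 mulr_sumr.
  apply: eq_bigr => j _; have jN : (j <= N)%N by rewrite -ltnS.
  rewrite /bernstein subSn// exprS.
  by move: ('C(N, j)%:R * s ^+ j) (_ ^+ (N - j)) (g j) => A B C; ring.
rewrite big_ord_recl [X in _ = _ + X]big_ord_recl mulr_sumr addrCA /bernstein !bin0.
congr (_ + _); rewrite -big_split/=; apply: eq_bigr => j _.
rewrite /bump/= add1n binS natrD exprS subSS.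
by move: ('C(N, _)%:R) ('C(N, _)%:R) (s ^+ j) (_ ^+ (N - j)) (g _) => A B C D E; ring.
Qed.

Lemma sum_bernstein1 N s : \sum_(j < N.+1) bernstein N s j = 1.
Proof.
suff : \sum_(j < N.+1) bernstein N s j * 1 = 1.
  by under eq_bigr do rewrite mulr1.
elim: N => [|N ih]; first by rewrite big_ord1 /bernstein bin0 !mulr1.
by rewrite (sum_bernsteinS _ _ (fun=> 1)) ih !mulr1 addrC subrK.
Qed.

(** Variance plus squared bias. The centre [c] is arbitrary because the induction moves it by 1. *)
Lemma sum_bernstein_sqr N s c :
  \sum_(j < N.+1) bernstein N s j * (j%:R - c) ^+ 2 =
  N%:R * s * (1 - s) + (N%:R * s - c) ^+ 2.
Proof.
elim: N c => [|N ih] c.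
  by rewrite big_ord1 /bernstein/= bin0 subnn !expr0; ring.
rewrite (sum_bernsteinS _ _ (fun j => (j%:R - c) ^+ 2)).
have -> : \sum_(j < N.+1) bernstein N s j * (j.+1%:R - c) ^+ 2 =
    \sum_(j < N.+1) bernstein N s j * (j%:R - (c - 1)) ^+ 2.
  by apply: eq_bigr => j _; rewrite -natr1; congr (_ * _ ^+ 2); ring.
by rewrite !ih -natr1; ring.
Qed.

End bernstein.

(** * Approximation of bounded continuous functions by trigonometric polynomials *)

Section trig_approximation.
Context {R : realType} {k : nat}.

(** By monotonicity of the sine it is enough to move by [h = min d (1/2)]. Then [sin (u + h) - sin u
    = 2 * cos (u + h / 2) * sin (h / 2)], and [|u + h / 2| <= 3 / 4] keeps the cosine at least
    [cos (3 / 4)]. *)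
Lemma sin_gap (d : R) : 0 < d -> exists2 e : R, 0 < e &
  forall u v : R, `|u| <= 2^-1 -> `|v| <= pi / 2 -> d <= `|u - v| ->
    e <= `|sin u - sin v|.
Proof.
move=> d0; have p1 := @pihalf_ge1 R.
pose h : R := Num.min d 2^-1.
have h0 : 0 < h by rewrite lt_min d0 invr_gt0 ltr0n.
have h1 : h <= 2^-1 by rewrite ge_min lexx orbT.
have hd : h <= d by rewrite ge_min lexx.
exists (2 * cos (3 / 4) * sin (h / 2)).
  rewrite !mulr_gt0//; first by rewrite cos_gt0_pihalf//; lra.
  by rewrite sin_gt0_pihalf//; lra.
have lesin : {in `[- (pi / 2), pi / 2] &, {mono (@sin R) : x y / x <= y}}.
  by apply: le_mono_in => x y xI yI; rewrite ltr_sin.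
have lecos : {in `[0, pi] &, {mono (@cos R) : x y /~ x <= y}}.
  by apply: le_nmono_in => x y xI yI; rewrite ltr_cos.
have key u v : `|u| <= 2^-1 -> `|v| <= pi / 2 -> d <= v - u ->
    2 * cos (3 / 4) * sin (h / 2) <= sin v - sin u.
  rewrite !ler_norml => /andP[u1 u2] /andP[v1 v2] duv.
  have : sin (u + h) <= sin v by rewrite lesin ?in_itv/=; lra.
  suff : 2 * cos (3 / 4) * sin (h / 2) <= sin (u + h) - sin u by lra.
  have -> : sin (u + h) - sin u = 2 * cos (u + h / 2) * sin (h / 2).
    have -> : sin (u + h) = sin ((u + h / 2) + h / 2) by congr sin; field.
    have -> : sin u = sin ((u + h / 2) - h / 2) by congr sin; ring.
    by rewrite sinD sinB; ring.
  rewrite ler_wpM2r//; first by rewrite ltW// sin_gt0_pihalf//; lra.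
  have n1 : `|u + h / 2| <= 3 / 4 by rewrite ler_norml; lra.
  have n0 := normr_ge0 (u + h / 2).
  by rewrite ler_wpM2l// -(cos_norm (u + _)) lecos ?in_itv/=; lra.
move=> u v u1 v1; rewrite ler_normr; move=> /orP[|]; rewrite ?opprB => duv.
  have := key (- u) (- v); rewrite !normrN !sinN => /(_ u1 v1) H.
  by apply: le_trans (ler_norm _); apply: le_trans (H _) _; lra.
by rewrite distrC; apply: le_trans (ler_norm _); exact: key.
Qed.

(** Only [x] is confined to the ball: the interpolation nodes that play the part of [y] may lie
    outside it. *)
Lemma uniform_continuity_ball (f : 'rV[R]_k -> R) (L e : R) : continuous f -> 0 < e ->
  exists2 d : R, 0 < d &
    forall x y, `|x| <= L -> `|x - y| <= d -> `|f x - f y| <= e.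
Proof.
move=> cf e0.
have cK : compact [set x : 'rV[R]_k | `|x| <= L].
  apply: bounded_closed_compact.
    exists L; split; first exact: num_real.
    by move=> M LM x /= xL; exact: le_trans xL (ltW LM).
  apply: (@closed_comp _ _ _ [set r : R | r <= L]); last exact: closed_le.
  by move=> x _; exact: norm_continuous.
have /compact_near_coveringP/(_ _ (0^'+) (fun d x => forall y, `|x - y| <= d -> `|f x - f y| <= e)) := cK.
move=> /(_ _)[].
  move=> x _.
  have /cvgrPdist_lt/(_ (e / 2)) := cf x; rewrite divr_gt0// => /(_ isT) /nbhs_ballP[r /= r0 xr].
  have r2 : 0 < r / 2 by rewrite divr_gt0.
  exists (ball x (r / 2), [set d | 0 < d < r / 2]).
    split; first exact: nbhsx_ballx.
    near=> d => /=; apply/andP; split => //.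
  move=> [z d] /= [xz /andP[d0 dr]] y zy.
  have fz : `|f x - f z| < e / 2.
    by apply: xr; apply: le_ball xz; lra.
  have fy : `|f x - f y| < e / 2.
    apply: xr; rewrite -ball_normE/= in xz *.
    have := ler_normD (x - z) (z - y); rewrite addrA subrK; lra.
  have := ler_normB (f x - f y) (f x - f z).
  by rewrite opprB addrC addrA subrK; lra.
move=> d /= d0 H; exists (d / 2); first by rewrite divr_gt0.
move=> x y xL; apply: H => //=.
  by rewrite sub0r normrN gtr0_norm ?divr_gt0//; lra.
by rewrite divr_gt0.
Unshelve. all: by end_near. Qed.

Lemma dot_delta (i : 'I_k) (x : 'rV[R]_k) : dot (delta_mx 0 i) x = x 0 i.
Proof.
rewrite /dot (bigD1 i)//= mxE !eqxx mul1r big1 ?addr0// => j ji.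
by rewrite mxE eqxx (negbTE ji) mul0r.
Qed.

Lemma sum_ffun_prod (N : nat) (b : 'I_k -> 'I_N.+1 -> R) :
  (forall i, \sum_j b i j = 1) -> \sum_(v : {ffun 'I_k -> 'I_N.+1}) \prod_i b i (v i) = 1.
Proof. by move=> b1; rewrite -bigA_distr_bigA/= big1. Qed.

(** Under product weights, the mean of a function of one coordinate is taken with the weights of
    that coordinate. *)
Lemma sum_ffun_prodM (N : nat) (b : 'I_k -> 'I_N.+1 -> R) (l : 'I_k) (g : 'I_N.+1 -> R) :
  (forall i, \sum_j b i j = 1) ->
  \sum_(v : {ffun 'I_k -> 'I_N.+1}) (\prod_i b i (v i)) * g (v l) = \sum_j b l j * g j.
Proof.
move=> b1; transitivity (\sum_(v : {ffun 'I_k -> 'I_N.+1})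
    \prod_i (b i (v i) * (if i == l then g (v i) else 1))).
  apply: eq_bigr => v _; rewrite big_split/=; congr (_ * _).
  by rewrite (bigD1 l)//= eqxx big1 ?mulr1// => i /negbTE ->.
rewrite -(bigA_distr_bigA (fun i j => b i j * (if i == l then g j else 1)))/=.
rewrite (bigD1 l)//= eqxx [X in _ * X]big1 ?mulr1// => i /negbTE ->.
by under eq_bigr do rewrite mulr1.
Qed.

(* Multivariate Bernstein approximation in the variables (1 + sin (x_i / 2L)) / 2;
   these range inside [0, 1] for all x, which bounds the approximant globally. *)
Lemma trig_approx (f : 'rV[R]_k -> R) (M L e : R) : continuous f ->
  (forall x, `|f x| <= M) -> 0 < L -> 0 < e ->
  exists T : 'rV[R]_k -> R, [/\ trig_poly T, forall x, `|T x| <= M &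
    forall x, `|x| <= L -> `|T x - f x| <= e].
Proof.
move=> cf fM L0 e0.
have M0 : 0 <= M by exact: le_trans (normr_ge0 _) (fM 0).
have [d d0 fd] := uniform_continuity_ball L cf (divr_gt0 e0 (ltr0n R 2)).
have [h h0 hgap] := sin_gap (divr_gt0 d0 (mulr_gt0 (ltr0n R 2) L0)).
(* Chosen so that [2 * M <= c * z ^+ 2] whenever [h ^+ 2 <= 4 * z ^+ 2]; the factor 4 arises because
   the sine is [2 * s - 1]. *)
pose c : R := 8 * M / h ^+ 2.
have c0 : 0 <= c by rewrite divr_ge0 ?sqr_ge0// mulr_ge0.
pose N := (Num.bound (2 * (c * k%:R) / e)).+1.
have N0 : 0 < N%:R :> R by rewrite ltr0n.
have Nce : c * k%:R / N%:R <= e / 2.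
  have : 2 * (c * k%:R) / e <= N%:R.
    have /archi_boundP/ltW/le_trans : 0 <= 2 * (c * k%:R) / e.
      by rewrite divr_ge0 ?(ltW e0)// mulr_ge0// mulr_ge0.
    by apply; rewrite ler_nat.
  by rewrite !ler_pdivrMr//; lra.
pose s (x : 'rV[R]_k) (i : 'I_k) : R := (1 + sin (dot ((2 * L)^-1 *: delta_mx 0 i) x)) / 2.
have s01 x i : 0 <= s x i <= 1.
  by have := sin_max (dot ((2 * L)^-1 *: delta_mx 0 i) x); rewrite /s ler_norml; lra.
(* The node [y v] is the point at which each variable [s] takes the value [v i / N]. *)
pose y (v : {ffun 'I_k -> 'I_N.+1}) : 'rV[R]_k :=
  \row_i (2 * L * asin (2 * ((v i)%:R / N%:R) - 1)).
pose w (v : {ffun 'I_k -> 'I_N.+1}) x := \prod_i bernstein N (s x i) (v i).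
have w0 v x : 0 <= w v x by apply: prodr_ge0 => i _; exact: bernstein_ge0.
have w1 x : \sum_v w v x = 1.
  exact: (@sum_ffun_prod N (fun i j => bernstein N (s x i) j)
    (fun i => sum_bernstein1 N (s x i))).
exists (fun x => \sum_v f (y v) * w v x); split.
- apply: trig_sum => v; apply: trigZ; apply: trig_prod => i.
  have ts : trig_poly (s^~ i).
    apply: trig_ext (trigZ 2^-1 (trigD (trig_cst 1)
      (trig_sin ((2 * L)^-1 *: delta_mx 0 i)))) => x.
    by rewrite /s mulrC.
  rewrite /bernstein; apply: trigM.
    by apply: trigZ; exact: trigX.
  apply: trigX; apply: trig_ext (trigD (trig_cst 1) (trigZ (-1) ts)) => x.
  by rewrite mulN1r.
- move=> x; apply: (le_trans (ler_norm_sum _ _ _)).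
  apply: (@le_trans _ _ (\sum_v M * w v x)).
    by apply: ler_sum => v _; rewrite normrM (ger0_norm (w0 _ _)) ler_wpM2r.
  by rewrite -mulr_sumr w1 mulr1.
move=> x xL.
(* Nodes within [d] of [x] are handled by uniform continuity. At any other node some coordinate is
   more than [d] away, so by [sin_gap] the quadratic term exceeds the trivial bound [2 * M]. *)
have fy v : `|f (y v) - f x| <= e / 2 + \sum_l c * ((v l)%:R / N%:R - s x l) ^+ 2.
  have S0 : 0 <= \sum_l c * ((v l)%:R / N%:R - s x l) ^+ 2.
    by apply: sumr_ge0 => l _; rewrite mulr_ge0// sqr_ge0.
  have [yd|] := pselect (forall l, `|(x - y v) 0 l| <= d).
    have : `|f x - f (y v)| <= e / 2.
      by apply: fd => //; apply: normr_rV_leP => //; exact: ltW.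
    by rewrite distrC; lra.
  move=> /existsNP[l /negP]; rewrite -ltNge => dl.
  have vN : 0 <= ((v l)%:R / N%:R : R) <= 1.
    by rewrite divr_ge0//= ler_pdivrMr// mul1r ler_nat -ltnS ltn_ord.
  have vI : (2 * ((v l)%:R / N%:R) - 1 : R) \in `[-1, 1] by rewrite in_itv/=; lra.
  have := hgap (x 0 l / (2 * L)) (asin (2 * ((v l)%:R / N%:R) - 1)).
  rewrite asinK//.
  have -> : sin (x 0 l / (2 * L)) = 2 * s x l - 1.
    by rewrite /s dotZl dot_delta mulrC; field.
  have L2 : 0 < 2 * L by rewrite mulr_gt0.
  have x2 : `|x 0 l / (2 * L)| <= 2^-1.
    rewrite normrM normfV (gtr0_norm L2) ler_pdivrMr//.
    by have := le_trans (normr_coord_le x l) xL; lra.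
  have a2 : `|asin (2 * ((v l)%:R / N%:R) - 1)| <= pi / 2 :> R.
    by rewrite in_itv/= in vI; rewrite ler_norml; have [] := asin_def vI.
  have xy : d / (2 * L) <= `|x 0 l / (2 * L) - asin (2 * ((v l)%:R / N%:R) - 1)|.
    rewrite ler_pdivrMr// -[X in _ * X](gtr0_norm L2) -normrM mulrBl divfK ?gt_eqF//.
    by move: dl; rewrite !mxE mulrC => /ltW; rewrite [X in _ - X]mulrC.
  move=> /(_ x2 a2 xy) hs.
  have hs2 : h ^+ 2 <= 4 * ((v l)%:R / N%:R - s x l) ^+ 2.
    apply: (@le_trans _ _ (`|2 * s x l - 1 - (2 * ((v l)%:R / N%:R) - 1)| ^+ 2)).
      by rewrite ler_pXn2r ?nnegrE ?normr_ge0// ltW.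
    by rewrite real_normK ?num_real// le_eqVlt; apply/orP; left; apply/eqP; ring.
  have f2M : `|f (y v) - f x| <= 2 * M.
    by apply: (le_trans (ler_normB _ _)); have := fM x; have := fM (y v); lra.
  apply: (le_trans f2M).
  have : 2 * M <= c * ((v l)%:R / N%:R - s x l) ^+ 2.
    rewrite /c mulrAC ler_pdivlMr ?exprn_gt0//.
    by have := ler_wpM2l M0 hs2; lra.
  have : c * ((v l)%:R / N%:R - s x l) ^+ 2 <= \sum_l c * ((v l)%:R / N%:R - s x l) ^+ 2.
    by rewrite (bigD1 l)//= lerDl sumr_ge0// => j _; rewrite mulr_ge0// sqr_ge0.
  lra.
have -> : \sum_v f (y v) * w v x - f x = \sum_v (f (y v) - f x) * w v x.
  by under [RHS]eq_bigr do rewrite mulrBl; rewrite sumrB -mulr_sumr w1 mulr1.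
apply: (le_trans (ler_norm_sum _ _ _)).
have step v : `|(f (y v) - f x) * w v x| <=
    (e / 2 + \sum_l c * ((v l)%:R / N%:R - s x l) ^+ 2) * w v x.
  by rewrite normrM (ger0_norm (w0 _ _)) ler_wpM2r.
apply: (le_trans (ler_sum _ (fun v _ => step v))).
under eq_bigr do rewrite mulrDl.
rewrite big_split/= -mulr_sumr w1 mulr1.
(* Averaged over the nodes, each quadratic term becomes [c] times the binomial variance divided by
   [N ^+ 2]. *)
have -> : \sum_(v : {ffun 'I_k -> 'I_N.+1})
    (\sum_l c * ((v l)%:R / N%:R - s x l) ^+ 2) * w v x =
    \sum_l c * (s x l * (1 - s x l) / N%:R).
  under eq_bigr do rewrite mulr_suml.
  rewrite exchange_big/=; apply: eq_bigr => l _.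
  under eq_bigr do rewrite -mulrA [X in c * X]mulrC.
  rewrite -mulr_sumr; congr (c * _).
  rewrite (@sum_ffun_prodM N (fun i j => bernstein N (s x i) j) l
    (fun j => (j%:R / N%:R - s x l) ^+ 2) (fun i => sum_bernstein1 N (s x i))).
  have -> : s x l * (1 - s x l) / N%:R =
      (N%:R * s x l * (1 - s x l) + (N%:R * s x l - N%:R * s x l) ^+ 2) / N%:R ^+ 2.
    by field; rewrite gt_eqF.
  rewrite -sum_bernstein_sqr mulr_suml; apply: eq_bigr => j _.
  by rewrite -mulrA; congr (_ * _); field; rewrite gt_eqF.
have : \sum_l c * (s x l * (1 - s x l) / N%:R) <= c * k%:R / N%:R; last lra.
apply: (@le_trans _ _ (\sum_(l < k) c / N%:R)).
  apply: ler_sum => l _; rewrite ler_wpM2l// ler_pdivrMr// mulVf ?gt_eqF//.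
  by have /andP[] := s01 x l; nra.
by rewrite sumr_const card_ord -[leLHS]mulr_natr mulrAC.
Qed.

End trig_approximation.

(** * From characteristic functions to bounded continuous functions *)

Section mean_convergence.
Context {R : realType} {k : nat}.
Variables (E_ : nat -> ('rV[R]_k -> R) -> R) (E : ('rV[R]_k -> R) -> R) (C : R).
Hypotheses (mE_ : \forall n \near \oo, is_mean (E_ n)) (mE : is_mean E).
Hypothesis cvg_cosE : forall t,
  E_ n (fun x => cos (dot t x)) @[n --> \oo] --> E (fun x => cos (dot t x)).
Hypothesis cvg_sinE : forall t,
  E_ n (fun x => sin (dot t x)) @[n --> \oo] --> E (fun x => sin (dot t x)).
Hypothesis E_sqr : forall i, \forall n \near \oo, E_ n (fun x => x 0 i ^+ 2) <= C.
Hypothesis E0_sqr : forall i, E (fun x => x 0 i ^+ 2) <= C.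

Let cvg_trigE T : trig_poly T -> E_ n T @[n --> \oo] --> E T.
Proof.
elim=> [t|t|f g tf cf tg cg|a f tf cf].
- exact: cvg_cosE.
- exact: cvg_sinE.
- have pf := trig_poly_growth tf; have pg := trig_poly_growth tg.
  rewrite (meanD mE pf pg).
  apply: (@cvg_trans _ ((E_ n f + E_ n g) @[n --> \oo])); last exact: cvgD.
  by apply: near_eq_cvg; near=> n; rewrite meanD//; near: n.
- have pf := trig_poly_growth tf; rewrite (meanZ mE a pf).
  apply: (@cvg_trans _ ((a * E_ n f) @[n --> \oo])); last by apply: cvgM => //; exact: cvg_cst.
  by apply: near_eq_cvg; near=> n; rewrite meanZ//; near: n.
Unshelve. all: by end_near. Qed.

(** Levy's continuity theorem, with the uniform bound [C] on second moments in the place of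
    tightness. *)
Lemma mean_cvg (f : 'rV[R]_k -> R) (M : R) : continuous f -> (forall x, `|f x| <= M) ->
  E_ n f @[n --> \oo] --> E f.
Proof.
move=> cf fM; have pf := poly_growth_bounded cf fM.
have M0 : 0 <= M by exact: le_trans (normr_ge0 _) (fM 0).
apply/cvgrPdist_le => e e0.
pose D := 2 * M * (k%:R * `|C|).
have D0 : 0 <= D by rewrite !mulr_ge0.
(* Then [e / 8 * L = e / 8 + D], and [1 <= L] gives [D / L ^+ 2 <= e / 8]. *)
pose L := 1 + 8 * D / e.
have L1 : 1 <= L by rewrite lerDl divr_ge0 ?mulr_ge0// ltW.
have L0 : 0 < L by exact: lt_le_trans ltr01 L1.
have e8 : 0 < e / 8 by rewrite divr_gt0.
have [T [tT TM Tf]] := trig_approx cf fM L0 e8.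
have pT := trig_poly_growth tT.
(* A majorant of [|T - f|] everywhere: the constant covers the ball of radius [L], the quadratic
   part exceeds [2 * M] outside it. *)
pose q (x : 'rV[R]_k) := e / 8 + 2 * M / L ^+ 2 * \sum_i x 0 i ^+ 2.
have psq i : poly_growth (fun x : 'rV[R]_k => x 0 i ^+ 2).
  by apply: poly_growthX; exact: poly_growth_coord.
have pq : poly_growth q.
  apply: poly_growthD; first exact: poly_growth_cst.
  by apply: poly_growthZ; exact: poly_growth_sum.
have L20 : 0 < L ^+ 2 by rewrite exprn_gt0.
have ML : 0 <= 2 * M / L ^+ 2 by apply: divr_ge0; [rewrite mulr_ge0|exact: ltW].
have Tfq x : `|T x - f x| <= q x.
  have S0 : 0 <= \sum_i x 0 i ^+ 2 by apply: sumr_ge0 => i _; exact: sqr_ge0.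
  have [xL|xL] := leP `|x| L.
    by apply: (le_trans (Tf x xL)); rewrite lerDl; exact: mulr_ge0.
  have [i Li] : exists i, L < `|x 0 i|.
    apply: contrapT => /forallNP H.
    suff : `|x| <= L by move=> /(lt_le_trans xL); rewrite ltxx.
    by apply: normr_rV_leP => [|i]; [exact: ltW|rewrite leNgt; apply/negP/H].
  have L2 : L ^+ 2 <= \sum_i x 0 i ^+ 2.
    rewrite (bigD1 i)//=; apply: (@le_trans _ _ (x 0 i ^+ 2)).
      by rewrite -(real_normK (num_real (x 0 i))) ler_pXn2r ?nnegrE// ltW.
    by rewrite lerDl sumr_ge0// => j _; exact: sqr_ge0.
  apply: (@le_trans _ _ (2 * M)).
    by apply: (le_trans (ler_normB _ _)); have := fM x; have := TM x; lra.
  apply: (@le_trans _ _ (2 * M / L ^+ 2 * L ^+ 2)); first by rewrite divfK// gt_eqF.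
  rewrite /q; apply: ler_wpDl; first exact: ltW.
  by rewrite ler_wpM2l.
have qbound F : is_mean F -> (forall i, F (fun x => x 0 i ^+ 2) <= C) -> F q <= e / 4.
  move=> mF FC.
  rewrite (meanD mF (poly_growth_cst _)); last by apply: poly_growthZ; exact: poly_growth_sum.
  rewrite (mean_cst mF) (meanZ mF); last exact: poly_growth_sum.
  rewrite (mean_sum mF)//.
  have : \sum_i F (fun x => x 0 i ^+ 2) <= k%:R * `|C|.
    rewrite mulr_natl -[X in _ *+ X]card_ord -sumr_const ler_sum// => i _.
    by apply: (le_trans (FC i)); exact: ler_norm.
  move=> sC; suff : 2 * M / L ^+ 2 * \sum_i F (fun x => x 0 i ^+ 2) <= e / 8 by lra.
  apply: (@le_trans _ _ (2 * M / L ^+ 2 * (k%:R * `|C|))).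
    by rewrite ler_wpM2l.
  rewrite mulrAC -/D ler_pdivrMr//.
  have LL : L <= L ^+ 2 by rewrite expr2 ler_peMl// ltW.
  have : e / 8 * L <= e / 8 * L ^+ 2 by rewrite ler_pM2l.
  have -> : e / 8 * L = e / 8 + D by rewrite /L; field; rewrite gt_eqF.
  lra.
have ET : `|E T - E f| <= e / 4.
  rewrite -meanB//; apply: (@le_trans _ _ (E q)); last exact: qbound.
  by apply: mean_norm_le => //; exact: poly_growthB.
have /cvgrPdist_le/(_ (e / 4)) := cvg_trigE tT.
rewrite divr_gt0// => /(_ isT) cT.
near=> n.
have mn : is_mean (E_ n) by near: n.
have EnT : `|E_ n T - E_ n f| <= e / 4.
  rewrite -(meanB mn)//; apply: (@le_trans _ _ (E_ n q)).
    by apply: (mean_norm_le mn) => //; exact: poly_growthB.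
  apply: qbound => // i; move: i; near: n.
  exact: filter_forall.
have : `|E T - E_ n T| <= e / 4 by near: n.
by move: ET EnT; rewrite !ler_norml; lra.
Unshelve. all: by end_near. Qed.

End mean_convergence.

(** * Moments of a reflection-invariant mean on a sphere *)

Section taylor_trig.
Context {R : realType}.

Lemma poly_primitive (q : {poly R}) (a : R) : exists p : {poly R}, p^`() = q /\ p.[0] = a.
Proof.
exists (a%:P + \sum_(i < size q) (q`_i / i.+1%:R) *: 'X^(i.+1)); split; last first.
  rewrite hornerD hornerC horner_sum big1 ?addr0// => i _.
  by rewrite hornerZ hornerXn exprS mul0r mulr0.
rewrite derivD derivC add0r raddf_sum/= -[RHS]coefK poly_def.
apply: eq_bigr => i _; rewrite derivZ derivXn/=.
by rewrite -['X^i *+ i.+1]scaler_nat scalerA divfK// pnatr_eq0.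
Qed.

(** The functions [y ^+ n.+1 / n.+1!] plus or minus [h y - p.[y]] vanish at 0 and have nonnegative
    derivative. *)
Let taylor_step_ge0 (h h' : R -> R) (p : {poly R}) (n : nat) (y : R) :
  (forall x : R, is_derive x (1 : R) h (h' x)) -> h 0 = p.[0] ->
  (forall x, 0 <= x -> `|h' x - p^`().[x]| <= x ^+ n / n`!%:R) ->
  0 <= y -> `|h y - p.[y]| <= y ^+ n.+1 / n.+1`!%:R.
Proof.
move=> dh h0 hp y0.
have fact0 m : (m`!%:R : R) != 0 by rewrite pnatr_eq0 -lt0n fact_gt0.
suff key (s : R) : s = 1 \/ s = -1 -> 0 <= y ^+ n.+1 / n.+1`!%:R + s * (h y - p.[y]).
  have := key 1 (or_introl erefl); have := key (-1) (or_intror erefl).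
  by rewrite ler_norml; lra.
move=> s1; pose q : {poly R} := (n.+1`!%:R)^-1 *: 'X^(n.+1) - s *: p.
pose F := (fun x => s * h x) \+ horner q.
have FE x : F x = x ^+ n.+1 / n.+1`!%:R + s * (h x - p.[x]).
  by rewrite /F /= /q hornerD hornerN !hornerZ hornerXn; ring.
have dF (x : R) : is_derive x (1 : R) F (s * h' x + (q^`()).[x]).
  by apply: is_deriveD; apply: is_deriveZ.
rewrite -FE; have -> : 0 = F 0 by rewrite FE h0 subrr mulr0 addr0 exprS mul0r mul0r.
apply: (@ger0_derive1_ndecr _ F 0 y) => // [x|].
- rewrite in_itv/= => /andP[x0 _]; rewrite derive1E; have [_ ->] := dF x.
  have := hp x (ltW x0); rewrite /q derivB !derivZ derivXn/= hornerD hornerN !hornerZ.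
  rewrite hornerMn hornerXn.
  have -> : (n.+1`!%:R)^-1 * (x ^+ n *+ n.+1) = x ^+ n / n`!%:R.
    have n1 : (n.+1%:R : R) != 0 by rewrite pnatr_eq0.
    rewrite factS natrM -[x ^+ n *+ n.+1]mulr_natr.
    by move: (n.+1%:R : R) n1 (n`!%:R : R) (fact0 n) => a a0 b b0; field; rewrite a0 b0.
  by rewrite ler_norml; case: s1 => ->; lra.
- apply: continuous_subspaceT => x; apply: differentiable_continuous.
  by apply/derivable1_diffP; have [] := dF x.
Qed.

Lemma taylor_step (h h' : R -> R) (p : {poly R}) (n : nat) :
  (forall x : R, is_derive x (1 : R) h (h' x)) -> h 0 = p.[0] ->
  (forall x, `|h' x - p^`().[x]| <= `|x| ^+ n / n`!%:R) ->
  forall y, `|h y - p.[y]| <= `|y| ^+ n.+1 / n.+1`!%:R.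
Proof.
move=> dh h0 hp y; have [y0|y0] := leP 0 y.
  rewrite (ger0_norm y0); apply: (taylor_step_ge0 dh h0) => // x x0.
  by have := hp x; rewrite (ger0_norm x0).
(* Negative arguments reduce to positive ones by reflecting both the function and the polynomial. *)
pose g x := h (- x); pose q := p \Po (- 'X).
have qE x : q.[x] = p.[- x] by rewrite horner_comp hornerN hornerX.
have -> : h y - p.[y] = g (- y) - q.[- y] by rewrite /g qE !opprK.
rewrite (ltr0_norm y0); apply: (@taylor_step_ge0 g (fun x => - h' (- x))).
- move=> x; rewrite -mulN1r.
  have dN : is_derive x (1 : R) (fun t : R => - t) (- 1).
    by apply: is_deriveN; exact: is_derive_id.
  have := @is_derive1_comp R h (fun t : R => - t) x _ _ (dh (- x)) dN.
  by rewrite mulrC.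
- by rewrite /g qE oppr0.
- move=> x x0; rewrite deriv_comp derivN derivX hornerM hornerN hornerC horner_comp.
  rewrite hornerN hornerX mulrN1 -opprD normrN.
  by have := hp (- x); rewrite normrN (ger0_norm x0).
- by rewrite oppr_ge0 ltW.
Qed.

(** Cosine and sine are integrated into each other, so both bounds advance together; the polynomials
    are successive primitives, starting from 0. *)
Lemma taylor_cos_sin (n : nat) :
  (exists p : {poly R}, forall y, `|cos y - p.[y]| <= `|y| ^+ n / n`!%:R) /\
  (exists p : {poly R}, forall y, `|sin y - p.[y]| <= `|y| ^+ n / n`!%:R).
Proof.
elim: n => [|n [[p pc] [q qs]]].
  by split; exists 0 => y; rewrite horner0 subr0 expr0 fact0 divr1; [exact: cos_max|exact: sin_max].
split.
  have [P [dP P0]] := poly_primitive (- q) 1.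
  exists P; apply: (@taylor_step _ (fun x => - sin x)); first by rewrite cos0 P0.
  by move=> x; rewrite dP hornerN -opprD normrN.
have [P [dP P0]] := poly_primitive p 0.
by exists P; apply: (@taylor_step _ (@cos R)); rewrite ?sin0 ?P0 ?dP.
Qed.

End taylor_trig.

(** * Moments of linear forms on a sphere *)

Section sphere_moments.
Context {R : realType} {n : nat}.
Variables (E : ('rV[R]_n -> R) -> R) (P : 'M[R]_n) (S : set 'rV[R]_n) (R2 m : R).

Definition reflection (w x : 'rV[R]_n) : 'rV[R]_n :=
  x - (2 * dot x w / dot w w) *: w.

Hypotheses (mE : is_mean E) (symP : P^T = P) (idemP : P *m P = P) (trP : \tr P = m).
Hypothesis E_supp : forall f g, poly_growth f -> poly_growth g ->
  (forall x, S x -> f x = g x) -> E f = E g.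
Hypothesis S_norm : forall x, S x -> dot (x *m P) (x *m P) = R2.
Hypothesis E_reflection : forall w, w *m P = w -> forall f, poly_growth f ->
  E (fun x => f (reflection w x)) = E f.

Let pgX (y : 'rV[R]_n) j : poly_growth (fun x => dot x y ^+ j).
Proof. by apply: poly_growthX; exact: poly_growth_dotl. Qed.

Lemma dot_reflection (w x y : 'rV[R]_n) : dot (reflection w x) y = dot x (reflection w y).
Proof. by rewrite /reflection dotBl dotBr dotZl dotZr (dotC w y); ring. Qed.

(** The reflection along [y] itself sends [y] to [- y]. *)
Lemma sphere_moment_odd (y : 'rV[R]_n) j : y *m P = y -> odd j ->
  E (fun x => dot x y ^+ j) = 0.
Proof.
move=> yP oj; have [->|y0] := eqVneq y 0.
  rewrite -[RHS](mean_cst mE 0); congr E; apply/funext => x.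
  by rewrite dot0r expr0n; case: j oj.
have := E_reflection yP (pgX y j).
rewrite (_ : (fun x => _) = (fun x => -1 * dot x y ^+ j)).
  by rewrite (meanZ mE)//; lra.
apply/funext => x; rewrite dot_reflection /reflection -mulrA divff ?dotxx_eq0// mulr1.
have -> : y - 2 *: y = - y by rewrite scaler_nat mulr2n opprD addrA subrr add0r.
by rewrite dotNr exprNn -signr_odd oj expr1.
Qed.

(** Vectors [y] and [z] of equal length are exchanged by the reflection along [y - z]. *)
Let moment_eq_norm (y z : 'rV[R]_n) j : y *m P = y -> z *m P = z ->
  dot y y = dot z z -> E (fun x => dot x y ^+ j) = E (fun x => dot x z ^+ j).
Proof.
move=> yP zP yz; have [->//|yz0] := eqVneq y z.
have wP : (y - z) *m P = y - z by rewrite mulmxBl yP zP.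
rewrite -(E_reflection wP (pgX y j)); congr E; apply/funext => x.
rewrite dot_reflection; congr (dot x _ ^+ j); rewrite /reflection.
have w0 : dot (y - z) (y - z) != 0 by rewrite dotxx_eq0 subr_eq0.
have -> : 2 * dot y (y - z) = dot (y - z) (y - z).
  by rewrite dotBl !dotBr -yz (dotC z y); ring.
by rewrite divff// scale1r opprB addrC subrK.
Qed.

Let moment_scale (y z : 'rV[R]_n) j : y *m P = y -> z *m P = z -> dot y y = 1 ->
  E (fun x => dot x z ^+ j.*2) = dot z z ^+ j * E (fun x => dot x y ^+ j.*2).
Proof.
move=> yP zP y1; rewrite (@moment_eq_norm z (enorm z *: y)) ?scalemxAl -?scalemxAl ?yP//.
  rewrite -(meanZ mE)//; congr E; apply/funext => x.
  by rewrite dotZr exprMn -muln2 mulnC exprM sqr_enorm.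
by rewrite dotZl dotZr y1 mulr1 -expr2 sqr_enorm.
Qed.

Lemma poly_ext_horner (p q : {poly R}) : (forall b, p.[b] = q.[b]) -> p = q.
Proof.
move=> pq; apply/eqP; rewrite -subr_eq0; apply/negPn/negP => r0.
have := @max_poly_roots _ (p - q) [seq i%:R | i <- iota 0 (size (p - q))] r0.
rewrite size_map size_iota ltnn => H; suff : false by []; apply: H.
  by apply/allP => _ /mapP[i _ ->]; rewrite /root hornerD hornerN pq subrr.
by rewrite map_inj_uniq ?iota_uniq// => i j /eqP; rewrite eqr_nat => /eqP.
Qed.

Lemma coef2_exp_1DaX2 (a : R) j : ((1 + a *: 'X^2) ^+ j : {poly R})`_2 = j%:R * a.
Proof.
have c0 i : ((1 + a *: 'X^2) ^+ i : {poly R})`_0 = 1.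
  by rewrite -horner_coef0 horner_exp hornerD hornerC hornerZ hornerXn expr0n mulr0 addr0 expr1n.
elim: j => [|j ih]; first by rewrite expr0 coef1 mul0r.
rewrite exprS mulrDl mul1r coefD ih -scalerAl coefZ coefXnM/= c0 -natr1; ring.
Qed.

(* The coefficient of b^2 in E <x, y + b w>^(2j+2) = |y + b w|^(2j+2) E <x, y>^(2j+2). *)
Let mixed_moment (y w : 'rV[R]_n) j : y *m P = y -> w *m P = w -> dot y y = 1 ->
  dot y w = 0 ->
  'C(j.*2.+2, 2)%:R * E (fun x => dot x y ^+ j.*2 * dot x w ^+ 2) =
  j.+1%:R * dot w w * E (fun x => dot x y ^+ j.*2.+2).
Proof.
move=> yP wP y1 yw.
pose p : {poly R} := \poly_(i < j.*2.+3)
  ('C(j.*2.+2, i)%:R * E (fun x => dot x y ^+ (j.*2.+2 - i) * dot x w ^+ i)).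
pose q : {poly R} := E (fun x => dot x y ^+ j.*2.+2) *: (1 + dot w w *: 'X^2) ^+ j.+1.
have pg i : poly_growth (fun x => dot x y ^+ (j.*2.+2 - i) * dot x w ^+ i).
  exact: poly_growthM.
suff pq : p = q.
  have := congr1 (fun r : {poly R} => r`_2) pq.
  rewrite coef_poly /= !subSS subn0 => ->.
  by rewrite /q coefZ coef2_exp_1DaX2 mulrC.
apply: poly_ext_horner => b.
have bP : (y + b *: w) *m P = y + b *: w by rewrite mulmxDl yP -scalemxAl wP.
have := @moment_scale y (y + b *: w) j.+1 yP bP y1.
have -> : dot (y + b *: w) (y + b *: w) = 1 + dot w w * b ^+ 2.
  by rewrite dotDl !dotDr !dotZl !dotZr y1 yw (dotC w y) yw; ring.
rewrite /q hornerZ horner_exp hornerD hornerC hornerZ hornerXn mulrC => <-.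
rewrite horner_poly.
have -> : (fun x => dot x (y + b *: w) ^+ j.+1.*2) =
    (fun x => \sum_(i < j.*2.+3) ('C(j.*2.+2, i)%:R * b ^+ i) *
      (dot x y ^+ (j.*2.+2 - i) * dot x w ^+ i)).
  apply/funext => x; rewrite dotDr dotZr doubleS exprDn; apply: eq_bigr => i _.
  by rewrite exprMn -mulr_natl; ring.
rewrite (mean_sum mE) => [|i]; last exact: poly_growthZ.
by apply: eq_bigr => i _; rewrite (meanZ mE)// mulrAC.
Qed.

(** The vectors [w i] are the standard basis projected onto the part of the range of [P] orthogonal
    to [y]: their squared pairings with [x] add up to [R2 - dot x y ^+ 2] on [S], their squared
    lengths to [m - 1]. Summing [mixed_moment] over them and cancelling [j.+1] from the binomial
    coefficient [j.+1 * j.*2.+1] gives the recursion. *)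
Let moment_rec (y : 'rV[R]_n) j : y *m P = y -> dot y y = 1 ->
  (m + j.*2%:R) * E (fun x => dot x y ^+ j.*2.+2) =
  (j.*2.+1)%:R * R2 * E (fun x => dot x y ^+ j.*2).
Proof.
move=> yP y1; pose Q := P - y^T *m y.
have symQ : Q^T = Q by rewrite /Q linearB/= symP trmx_mul trmxK.
have yyt : y *m y^T = 1%:M.
  by apply/matrixP => i k; rewrite !ord1 -dotE y1 mxE.
have yQ : y *m Q = 0 by rewrite /Q mulmxBr yP mulmxA yyt mul1mx subrr.
have QP : Q *m P = Q by rewrite /Q mulmxBl idemP -mulmxA yP.
have PyT : P *m y^T = y^T by rewrite -[in LHS]symP -trmx_mul yP.
have QQ : Q *m Q = Q by rewrite {1}/Q mulmxBl -mulmxA yQ mulmx0 subr0 /Q mulmxBr idemP mulmxA PyT.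
have trQ : \tr Q = m - 1.
  by rewrite /Q raddfB/= trP mxtrace_mulC yyt mxtrace1.
pose w (i : 'I_n) : 'rV[R]_n := delta_mx 0 i *m Q.
have wP i : w i *m P = w i by rewrite /w -mulmxA QP.
have yw i : dot y (w i) = 0 by rewrite dotC /w dot_mulmx symQ yQ dot0r.
have dotw x i : dot x (w i) = (x *m Q) 0 i.
  by rewrite dotC /w dot_mulmx symQ dot_delta.
have sum_dotw x : S x -> \sum_i dot x (w i) ^+ 2 = R2 - dot x y ^+ 2.
  move=> Sx; have -> : \sum_i dot x (w i) ^+ 2 = dot (x *m Q) (x *m Q).
    by apply: eq_bigr => i _; rewrite dotw expr2.
  have -> : x *m Q = x *m P - dot x y *: y.
    by rewrite /Q mulmxBr mulmxA [x *m y^T]mx11_scalar -dotE mul_scalar_mx.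
  rewrite dotBl !dotBr !dotZl !dotZr S_norm// y1 (dotC y) dot_mulmx symP yP; ring.
have sum_w : \sum_i dot (w i) (w i) = m - 1.
  rewrite -trQ; apply: eq_bigr => i _.
  by rewrite {1}/w dot_mulmx symQ /w -mulmxA QQ dot_delta -rowE mxE.
have pgw i : poly_growth (fun x => dot x y ^+ j.*2 * dot x (w i) ^+ 2).
  exact: poly_growthM.
have sumE : \sum_i E (fun x => dot x y ^+ j.*2 * dot x (w i) ^+ 2) =
    R2 * E (fun x => dot x y ^+ j.*2) - E (fun x => dot x y ^+ j.*2.+2).
  rewrite -(mean_sum mE)// -(meanZ mE)// -(meanB mE)//; last exact: poly_growthZ.
  apply: E_supp => [||x Sx].
  - exact: poly_growth_sum.
  - by apply: poly_growthB => //; exact: poly_growthZ.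
  - by rewrite -mulr_sumr sum_dotw// mulrBr -exprD addn2 mulrC.
have : 'C(j.*2.+2, 2)%:R * \sum_i E (fun x => dot x y ^+ j.*2 * dot x (w i) ^+ 2) =
    j.+1%:R * (m - 1) * E (fun x => dot x y ^+ j.*2.+2).
  rewrite -sum_w mulr_sumr mulr_sumr mulr_suml; apply: eq_bigr => i _.
  exact: mixed_moment.
have -> : 'C(j.*2.+2, 2)%:R = j.+1%:R * (j.*2.+1)%:R :> R.
  by rewrite bin2 /= -natrM; congr (_%:R); nia.
rewrite sumE -!mulrA => /(mulfI _) H.
have {}H := H _; rewrite pnatr_eq0 in H; have {}H := H isT.
have -> : m + j.*2%:R = (m - 1) + (j.*2.+1)%:R by rewrite -natr1; ring.
by rewrite mulrDl -H; ring.
Qed.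

Lemma sphere_moment_even (y : 'rV[R]_n) j : 0 < m -> y *m P = y ->
  E (fun x => dot x y ^+ j.*2) =
  dot y y ^+ j * \prod_(i < j) ((i.*2.+1)%:R * (R2 / (m + i.*2%:R))).
Proof.
move=> m0 yP; have [->|y0] := eqVneq y 0.
  case: j => [|j].
    by rewrite !expr0 big_ord0 mulr1; exact: (mean_cst mE).
  rewrite dot0l expr0n/= mul0r -[RHS](mean_cst mE 0); congr E; apply/funext => x.
  by rewrite dot0r expr0n.
have ny0 : 0 < enorm y by rewrite enorm_gt0.
pose z := (enorm y)^-1 *: y.
have zP : z *m P = z by rewrite /z -scalemxAl yP.
have z1 : dot z z = 1.
  by rewrite /z dotZl dotZr -sqr_enorm; field; rewrite gt_eqF.
rewrite (moment_scale j zP yP z1); congr (_ * _).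
elim: j => [|j ih]; first by rewrite big_ord0; exact: (mean_cst mE).
rewrite big_ord_recr/= -ih; have := moment_rec j zP z1.
have mj : m + j.*2%:R != 0 by rewrite gt_eqF// ltr_wpDr.
by rewrite doubleS => H; apply: (mulfI mj); rewrite H; field.
Qed.

End sphere_moments.

Lemma cvg_sum_seq {R : realType} (I : Type) (r : seq I) (F_ : I -> nat -> R) (F : I -> R) :
  (forall i, F_ i n @[n --> \oo] --> F i) ->
  \sum_(i <- r) F_ i n @[n --> \oo] --> \sum_(i <- r) F i.
Proof.
move=> cF; elim: r => [|i r ih].
  rewrite big_nil; under eq_fun do rewrite big_nil.
  exact: cvg_cst.
rewrite big_cons; under eq_fun do rewrite big_cons.
exact: cvgD.
Qed.

Lemma cvg_prod_seq {R : realType} (I : Type) (r : seq I) (F_ : I -> nat -> R) (F : I -> R) :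
  (forall i, F_ i n @[n --> \oo] --> F i) ->
  \prod_(i <- r) F_ i n @[n --> \oo] --> \prod_(i <- r) F i.
Proof.
move=> cF; elim: r => [|i r ih].
  rewrite big_nil; under eq_fun do rewrite big_nil.
  exact: cvg_cst.
rewrite big_cons; under eq_fun do rewrite big_cons.
exact: cvgM.
Qed.

(** * Convergence of moments implies convergence of characteristic functions *)

Section moments_to_characteristic_function.
Context {R : realType} {k : nat}.
Variables (E_ : nat -> ('rV[R]_k -> R) -> R) (E : ('rV[R]_k -> R) -> R).
Variables (t : 'rV[R]_k) (a_ : nat -> R) (a : R).
Hypotheses (mE_ : \forall n \near \oo, is_mean (E_ n)) (mE : is_mean E).
Hypothesis a_a : a_ n @[n --> \oo] --> a.
Hypothesis cvg_moment : forall j,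
  E_ n (fun x => (dot t x - a_ n) ^+ j) @[n --> \oo] --> E (fun x => (dot t x - a) ^+ j).
Hypothesis moment_small :
  E (fun x => (dot t x - a) ^+ j.*2) / j.*2`!%:R @[j --> \oo] --> 0.

Let pg c : poly_growth (fun x => dot t x - c).
Proof.
by apply: poly_growthB; [exact: poly_growth_dot|exact: poly_growth_cst].
Qed.

Let pgX c j : poly_growth (fun x => (dot t x - c) ^+ j).
Proof. exact: poly_growthX. Qed.

Let pg_horner c (p : {poly R}) : poly_growth (fun x => p.[dot t x - c]).
Proof.
under eq_fun do rewrite horner_coef.
by apply: poly_growth_sum => i; exact: poly_growthZ.
Qed.

Let cvg_horner (p : {poly R}) :
  E_ n (fun x => p.[dot t x - a_ n]) @[n --> \oo] --> E (fun x => p.[dot t x - a]).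
Proof.
have hE F c : is_mean F -> F (fun x => p.[dot t x - c]) =
    \sum_(i < size p) p`_i * F (fun x => (dot t x - c) ^+ i).
  move=> mF; under eq_fun do rewrite horner_coef.
  rewrite (mean_sum mF) => [|i]; last exact: poly_growthZ.
  by apply: eq_bigr => i _; rewrite (meanZ mF).
rewrite hE//; apply: (@cvg_trans _
  ((\sum_(i < size p) p`_i * E_ n (fun x => (dot t x - a_ n) ^+ i)) @[n --> \oo])).
  by apply: near_eq_cvg; near=> n; rewrite hE//; near: n.
by apply: cvg_sum_seq => i; apply: cvgM; [exact: cvg_cst|exact: cvg_moment].
Unshelve. all: by end_near. Qed.

(** The Taylor polynomial is fixed by the limit alone. Its degree is governed by an even power, so
    the remainder is again a moment, and stays small along [E_ n] because that moment converges. *)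
Let cvg_bounded (h : R -> R) : continuous h -> (forall y, `|h y| <= 1) ->
  (forall n, exists p : {poly R}, forall y, `|h y - p.[y]| <= `|y| ^+ n / n`!%:R) ->
  E_ n (fun x => h (dot t x - a_ n)) @[n --> \oo] --> E (fun x => h (dot t x - a)).
Proof.
move=> ch h1 hp; apply/cvgrPdist_le => e e0.
have pgh c : poly_growth (fun x => h (dot t x - c)).
  apply: (@poly_growth_bounded _ _ _ 1) => x //.
  by apply: continuous_comp; [exact: (pg c).1|exact: ch].
have e8 : 0 < e / 8 by rewrite divr_gt0.
have [J EJ] : exists J, E (fun x => (dot t x - a) ^+ J.*2) / J.*2`!%:R <= e / 8.
  have /cvgrPdist_le/(_ _ e8)[N _ HN] := moment_small.
  by exists N; have := HN N (leqnn N); rewrite /= sub0r normrN; apply: le_trans (ler_norm _).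
have [p pJ] := hp J.*2.
have bound F c : is_mean F -> `|F (fun x => h (dot t x - c)) - F (fun x => p.[dot t x - c])| <=
    F (fun x => (dot t x - c) ^+ J.*2) / J.*2`!%:R.
  move=> mF; rewrite -(meanB mF)// mulrC -(meanZ mF)//; apply: (mean_norm_le mF).
  - exact: poly_growthB.
  - exact: poly_growthZ.
  move=> x; apply: (le_trans (pJ _)); rewrite mulrC ler_wpM2l ?invr_ge0//.
  by rewrite -normrX ger0_norm// -muln2 exprM sqr_ge0.
have /cvgrPdist_le/(_ _ e8) cp := @cvg_horner p.
have cJ : E_ n (fun x => (dot t x - a_ n) ^+ J.*2) / J.*2`!%:R @[n --> \oo] -->
    E (fun x => (dot t x - a) ^+ J.*2) / J.*2`!%:R.
  by apply: cvgM; [exact: cvg_moment|exact: cvg_cst].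
have /cvgrPdist_le/(_ _ e8) cJ8 := cJ.
near=> n.
have mn : is_mean (E_ n) by near: n.
have b1 := bound E a mE; have b2 := bound (E_ n) (a_ n) mn.
have b3 : `|E (fun x => p.[dot t x - a]) - E_ n (fun x => p.[dot t x - a_ n])| <= e / 8.
  by near: n.
have b4 : `|E (fun x => (dot t x - a) ^+ J.*2) / J.*2`!%:R -
   E_ n (fun x => (dot t x - a_ n) ^+ J.*2) / J.*2`!%:R| <= e / 8 by near: n.
by move: b1 b2 b3 b4; rewrite !ler_norml; lra.
Unshelve. all: by end_near. Qed.

Let cvg_cosB : E_ n (fun x => cos (dot t x - a_ n)) @[n --> \oo] -->
  E (fun x => cos (dot t x - a)).
Proof.
apply: cvg_bounded; [exact: continuous_cos|exact: cos_max|].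
by move=> n; have [] := @taylor_cos_sin R n.
Qed.

Let cvg_sinB : E_ n (fun x => sin (dot t x - a_ n)) @[n --> \oo] -->
  E (fun x => sin (dot t x - a)).
Proof.
apply: cvg_bounded; [exact: continuous_sin|exact: sin_max|].
by move=> n; have [] := @taylor_cos_sin R n.
Qed.

Let pg_cos c : poly_growth (fun x => cos (dot t x - c)).
Proof.
apply: (@poly_growth_bounded _ _ _ 1) => x; last exact: cos_max.
by apply: continuous_comp; [exact: (pg c).1|exact: continuous_cos].
Qed.

Let pg_sin c : poly_growth (fun x => sin (dot t x - c)).
Proof.
apply: (@poly_growth_bounded _ _ _ 1) => x; last exact: sin_max.
by apply: continuous_comp; [exact: (pg c).1|exact: continuous_sin].
Qed.

(** The moments are taken about the moving centre [a_ n]; the addition formulas detach it. *)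
Let cos_split F c : is_mean F -> F (fun x => cos (dot t x)) =
  cos c * F (fun x => cos (dot t x - c)) - sin c * F (fun x => sin (dot t x - c)).
Proof.
move=> mF; rewrite -!(meanZ mF)// -(meanB mF); [|exact: poly_growthZ..].
by congr F; apply/funext => x; rewrite -cosD addrC subrK.
Qed.

Let sin_split F c : is_mean F -> F (fun x => sin (dot t x)) =
  sin c * F (fun x => cos (dot t x - c)) + cos c * F (fun x => sin (dot t x - c)).
Proof.
move=> mF; rewrite -!(meanZ mF)// -(meanD mF); [|exact: poly_growthZ..].
by congr F; apply/funext => x; rewrite -sinD addrC subrK.
Qed.

Let cvg_cosa : cos (a_ n) @[n --> \oo] --> cos a.
Proof. by apply: cvg_comp a_a _; exact: continuous_cos. Qed.

Let cvg_sina : sin (a_ n) @[n --> \oo] --> sin a.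
Proof. by apply: cvg_comp a_a _; exact: continuous_sin. Qed.

Lemma cvg_cos_of_moments :
  E_ n (fun x => cos (dot t x)) @[n --> \oo] --> E (fun x => cos (dot t x)).
Proof.
rewrite (cos_split a mE).
apply: (@cvg_trans _ ((cos (a_ n) * E_ n (fun x => cos (dot t x - a_ n)) -
  sin (a_ n) * E_ n (fun x => sin (dot t x - a_ n))) @[n --> \oo])).
  by apply: near_eq_cvg; near=> n; rewrite [RHS](cos_split (a_ n))//; near: n.
by apply: cvgB; apply: cvgM.
Unshelve. all: by end_near. Qed.

Lemma cvg_sin_of_moments :
  E_ n (fun x => sin (dot t x)) @[n --> \oo] --> E (fun x => sin (dot t x)).
Proof.
rewrite (sin_split a mE).
apply: (@cvg_trans _ ((sin (a_ n) * E_ n (fun x => cos (dot t x - a_ n)) +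
  cos (a_ n) * E_ n (fun x => sin (dot t x - a_ n))) @[n --> \oo])).
  by apply: near_eq_cvg; near=> n; rewrite [RHS](sin_split (a_ n))//; near: n.
by apply: cvgD; apply: cvgM.
Unshelve. all: by end_near. Qed.

End moments_to_characteristic_function.

(** * Growth of Gaussian moments *)

Section gaussian_moment_size.
Context {R : realType}.

Lemma double_fact_prod j : (j.*2`! = 2 ^ j * j`! * \prod_(i < j) i.*2.+1)%N.
Proof.
elim: j => [|j ih]; first by rewrite big_ord0.
rewrite big_ord_recr/= doubleS !factS ih expnS.
have -> : j.*2.+2 = (2 * j.+1)%N by lia.
by move: (\prod_(i < j) _)%N (j.*2.+1) (2 ^ j)%N (j`!) (j.+1) => p d a b c; ring.
Qed.

(** Since the odd factors divide [j.*2!] with quotient [2 ^ j * j!], this is the general term of the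
    exponential series at [v / 2]. *)
Lemma gaussian_moment_small (v : R) :
  v ^+ j * (\prod_(i < j) (i.*2.+1)%:R) / j.*2`!%:R @[j --> \oo] --> 0.
Proof.
have -> : (fun j => v ^+ j * (\prod_(i < j) (i.*2.+1)%:R) / j.*2`!%:R) =
    exp_coeff (v / 2).
  apply/funext => j; rewrite /exp_coeff/= double_fact_prod !natrM natrX natr_prod.
  have p0 : \prod_(i < j) (i.*2.+1)%:R != 0 :> R.
    by apply/prodf_neq0 => i _; rewrite pnatr_eq0.
  have f0 : (j`!%:R : R) != 0 by rewrite pnatr_eq0 -lt0n fact_gt0.
  have e0 : (2 ^+ j : R) != 0 by rewrite expf_neq0.
  rewrite expr_div_n; move: p0 f0 e0.
  move: (\prod_(i < j) _) (j`!%:R) (2 ^+ j) (v ^+ j) => p f e w p0 f0 e0.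
  by field; rewrite p0 f0 e0.
exact: cvg_exp_coeff.
Qed.

End gaussian_moment_size.

(** * Normalized surface measure *)

Section surface_mean.
Context {R : realType} {n : nat}.
Variables (d : nat) (S : set 'rV[R]_n) (B : R).
Hypotheses (closedS : closed S) (SB : forall x, S x -> `|x| <= B).
Hypotheses (S0 : (0 < hausdorff d S)%E) (Sfin : (hausdorff d S < +oo)%E).

Let T := caratheodory_type (@hausdorff_outer R n d).
Let mu := @unif_surface R n d S.

Let measurable_closed (A : set T) : closed (A : set 'rV[R]_n) -> measurable A.
Proof.
move=> cA; rewrite -[A]setCK; apply: measurableC.
by apply: caratheodory_open; exact: closed_openC.
Qed.

Let measurable_cont (f : T -> R) : continuous (f : 'rV[R]_n -> R) -> measurable_fun setT f.
Proof.
move=> /continuousP cf; apply: (measurability _ (RGenOpens.measurableE R)).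
move=> _ [_ [a [b ->] <-]]; rewrite setTI; apply: caratheodory_open.
exact/cf/interval_open.
Qed.

Let mS : measurable (S : set T).
Proof. exact: measurable_closed. Qed.

Let muE (A : set T) : (mu A = ((fine (hausdorff d S))^-1)%:E * hausdorff d A)%E.
Proof. by []. Qed.

Let muS : (mu S = 1)%E.
Proof.
have fS : hausdorff d S \is a fin_num by rewrite ge0_fin_numE// hausdorff_ge0.
rewrite muE -[X in (_ * X)%E](fineK fS) -EFinM mulVf//.
by rewrite gt_eqF// fine_gt0// S0.
Qed.

Let integrable_bounded (f : T -> R) (K : R) : measurable_fun setT f ->
  (forall x, S x -> `|f x| <= K) -> mu.-integrable S (EFin \o f).
Proof.
move=> mf fK; apply: measurable_bounded_integrable => //.
- by apply: (@le_lt_trans _ _ 1%E); [rewrite -muS|exact: ltry].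
- exact: measurable_funTS.
exists K; split; first exact: num_real.
by move=> M KM x /= Sx; apply: le_trans (ltW KM); exact: fK.
Qed.

Let pg_bound f : poly_growth f -> exists K : R, forall x, S x -> `|f x| <= K.
Proof.
move=> pf; have [K [N [K0 fK]]] := poly_growth_ge0 pf.
exists (K * (1 + B) ^+ N) => x Sx; apply: (le_trans (fK x)).
have B0 : 0 <= B by exact: le_trans (normr_ge0 _) (SB Sx).
by rewrite ler_wpM2l// lerXn2r ?nnegrE ?addr_ge0// lerD2l SB.
Qed.

Let integrable_pg (f : T -> R) : poly_growth (f : 'rV[R]_n -> R) ->
  mu.-integrable S (EFin \o f).
Proof.
move=> pf; have [K fK] := pg_bound pf; apply: integrable_bounded fK.
by apply: measurable_cont; exact: pf.1.
Qed.

Definition surface_mean (f : 'rV[R]_n -> R) : R := \int[mu]_(x in S) (f x).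

Lemma is_mean_surface_mean : is_mean surface_mean.
Proof.
split=> [|f g pf pg|a f pf|f pf f0]; rewrite /surface_mean.
- by rewrite Rintegral_cst//; rewrite [X in fine X]muS mulr1.
- by rewrite RintegralD//; exact: integrable_pg.
- by rewrite RintegralZl//; exact: integrable_pg.
- exact: Rintegral_ge0.
Qed.

Lemma surface_mean_supp f g : (forall x, S x -> f x = g x) ->
  surface_mean f = surface_mean g.
Proof. by move=> fg; apply: eq_Rintegral => x; rewrite inE => /fg. Qed.

Lemma EFin_surface_mean f : poly_growth f ->
  (\int[unif_surface d S]_(x in S) (f x)%:E)%E = (surface_mean f)%:E.
Proof.
move=> pf; rewrite /surface_mean /Rintegral fineK//.
exact: integrable_fin_num (integrable_pg pf).
Qed.

Section isometric_involution.
Variable h : 'rV[R]_n -> 'rV[R]_n.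
Hypotheses (hh : forall x, h (h x) = x) (ch : continuous h).
Hypothesis h_iso : forall x y, enorm (h x - h y) = enorm (x - y).
Hypothesis hS : forall x, S x -> S (h x).

Let preimage_h A : h @^-1` A = h @` A.
Proof.
apply/seteqP; split=> x /=; first by move=> Ahx; exists (h x).
by move=> [y Ay <-]; rewrite hh.
Qed.

Let hausdorff_h A : hausdorff d (h @` A) = hausdorff d A.
Proof.
apply/eqP; rewrite eq_le le_hausdorff_isometry//=.
have -> : hausdorff d A = hausdorff d (h @` (h @` A)).
  congr hausdorff; apply/seteqP; split=> x.
    by move=> Ax; exists (h x) => //; exists x.
  by move=> [_ [y Ay <-] <-]; rewrite hh.
exact: le_hausdorff_isometry.
Qed.

(** The Caratheodory condition for [A], tested on the image of [X], transports back through [h],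
    which preserves the outer measure of every set. *)
Let measurable_h : measurable_fun setT (h : T -> T).
Proof.
move=> _ A mA; rewrite setTI.
change ((@hausdorff_outer R n d).-caratheodory (h @^-1` A)) => X.
have := mA (h @` X); rewrite /= !hausdorff_h => ->.
congr (_ + _)%E; rewrite -[RHS]hausdorff_h; congr hausdorff; apply/seteqP.
- split=> x /=; first by move=> [[y Xy <-] Ay]; exists y => //; split=> //=; rewrite ?hh.
  by move=> [y [Xy Ay] <-]; split=> //; exists y.
- split=> x /=; first by move=> [[y Xy <-] Ay]; exists y => //; split=> //=; rewrite ?hh.
  by move=> [y [Xy Ay] <-]; split=> //; exists y.
Qed.

Lemma surface_mean_isometry f : poly_growth f ->
  surface_mean (fun x => f (h x)) = surface_mean f.
Proof.
move=> pf; rewrite /surface_mean /Rintegral; congr fine.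
have hpS : h @^-1` S = S.
  by apply/seteqP; split=> x /=; [move=> /hS; rewrite hh|exact: hS].
have mh : forall A : set T, measurable A -> mu (h @^-1` A) = mu A.
  by move=> A mA; rewrite !muE preimage_h hausdorff_h.
transitivity (\int[pushforward mu (h : T -> T)]_(x in (S : set T)) (f x)%:E)%E; last first.
  by apply: eq_measure_integral => A mA _; exact: mh.
rewrite (@integral_pushforward _ _ T T R (h : T -> T) measurable_h mu (S : set T)
  (EFin \o (f : T -> R))).
- by rewrite hpS.
- by apply/measurable_EFinP; apply: measurable_cont; exact: pf.1.
- rewrite hpS; have [K fK] := pg_bound pf.
  apply: (@integrable_bounded (fun x : T => f (h x)) K) => [|x Sx]; last exact/fK/hS.
  apply: measurableT_comp measurable_h; apply: measurable_cont; exact: pf.1.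
- exact: mS.
Qed.

End isometric_involution.
End surface_mean.

(** * Gaussian measures *)

Section standard_normal_moments.
Context {R : realType}.
Notation mu := (@lebesgue_measure R).
Notation phi := (@normal_pdf R 0 1).

Let phiE x : phi x = normal_peak 1 * expR (- x ^+ 2 / 2).
Proof. by rewrite normal_pdfE ?oner_neq0// /normal_fun subr0 expr1n. Qed.

Let pow_le_expR (x : R) j : 0 <= x -> x ^+ j <= j`!%:R * expR x.
Proof.
move=> x0; have f0 : 0 < j`!%:R :> R by rewrite ltr0n fact_gt0.
case: j f0 => [|j] f0; first by rewrite expr0 fact0 mul1r -expR0 ler_expR.
rewrite mulrC -ler_pdivrMr//; apply: le_trans (expR_ge1Dxn j x0).
by rewrite lerDr.
Qed.

(** Since [|x| ^+ j <= j! * (expR x + expR (- x))] and multiplying by [expR x] or [expR (- x)]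
    merely shifts the Gaussian density and adds the factor [expR (1/2)], two shifted densities
    dominate. *)
Let tail j : exists2 C : R, 0 <= C & forall x,
  `|x| ^+ j * phi x <= C * (normal_pdf 1 1 x + normal_pdf (-1) 1 x).
Proof.
exists (j`!%:R * expR 2^-1) => [|x]; first by rewrite mulr_ge0// expR_ge0.
have pk0 : 0 <= @normal_peak R 1 by exact: normal_peak_ge0.
have shift (a : R) : a ^+ 2 = 1 -> expR (a * x) * phi x = expR 2^-1 * normal_pdf a 1 x.
  move=> a1; rewrite phiE normal_pdfE ?oner_neq0// /normal_fun mulrCA [RHS]mulrCA.
  by rewrite -!expRD; congr (_ * expR _); rewrite sqrrB a1 expr1n -[1 *+ 2]/(2 : R); field.
have phi0 : 0 <= phi x by exact: normal_pdf_ge0.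
rewrite -mulrA mulrDr -!shift ?expr1n ?sqrrN ?expr1n// mul1r mulN1r -mulrDl mulrA.
rewrite ler_wpM2r//; apply: (le_trans (pow_le_expR j (normr_ge0 x))).
rewrite ler_wpM2l//; have := expR_ge0 x; have := expR_ge0 (- x).
by case: (ger0P x) => _; lra.
Qed.

Lemma integrable_pow_normal_pdf j :
  mu.-integrable setT (EFin \o (fun x => x ^+ j * phi x)).
Proof.
have [C C0 tC] := tail j.
apply: (@le_integrable _ _ _ mu setT _ _
    (EFin \o (fun x => C * (normal_pdf 1 1 x + normal_pdf (-1) 1 x)))) => //.
- apply/measurable_EFinP; apply: measurable_funM; first exact: measurable_funX.
  exact: measurable_normal_pdf.
- move=> x _ /=; rewrite lee_fin normrM normrX (ger0_norm (normal_pdf_ge0 _ _ _)).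
  by apply: (le_trans (tC x)); exact: ler_norm.
rewrite (_ : _ \o _ = fun x => (C%:E * ((normal_pdf 1 1 x)%:E + (normal_pdf (-1) 1 x)%:E))%E)//.
apply: integrableZl => //; apply: integrableD => //; exact: integrable_normal_pdf.
Qed.

Let bounded j : exists C : R, forall x, `|x| ^+ j * phi x <= C.
Proof.
have [C C0 tC] := tail j; exists (C * (normal_peak 1 + normal_peak 1)) => x.
by apply: (le_trans (tC x)); rewrite ler_wpM2l// lerD// normal_pdf_ub// oner_neq0.
Qed.

(** [g j] is the derivative of [G j]; the integral of this derivative over the line is the Stein
    identity for powers. *)
Let G j (x : R) := x ^+ j.+1 * phi x.
Let g j (x : R) := j.+1%:R * (x ^+ j * phi x) - x ^+ j.+2 * phi x.

Let is_derive_pow j (x : R) :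
  is_derive x (1 : R) (fun y : R => y ^+ j.+1) (j.+1%:R * x ^+ j).
Proof.
rewrite (_ : (fun y : R => y ^+ j.+1) = (id : R -> R) ^+ j.+1); last first.
  by apply/funext => y; rewrite exprfctE.
by have := @is_deriveX R R id j.+1 x 1 1 (is_derive_id x 1); rewrite /GRing.scale/= mulr1.
Qed.

Let is_derive_phi (x : R) : is_derive x (1 : R) phi (- x * phi x).
Proof.
have -> : phi = (fun y => normal_peak 1 * expR (- y ^+ 2 / 2)) by apply/funext; exact: phiE.
have h1 : is_derive x (1 : R) (fun y : R => - y ^+ 2 / 2) (- x).
  have hX : is_derive x (1 : R) (fun y : R => y ^+ 2) (2 * x).
    exact: (is_derive_pow 1 x).
  have -> : (fun y : R => - y ^+ 2 / 2) = (fun y => (- 2^-1) *: (y ^+ 2)).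
    by apply/funext => y; rewrite /GRing.scale/=; ring.
  have -> : - x = (- 2^-1) *: (2 * x) by rewrite /GRing.scale/=; field.
  exact: is_deriveZ.
have h2 := @is_derive1_comp R expR (fun y : R => - y ^+ 2 / 2) x _ _ (is_derive_expR _) h1.
have -> : - x * (normal_peak 1 * expR (- x ^+ 2 / 2)) =
  normal_peak 1 *: (expR (- x ^+ 2 / 2) * - x) by rewrite /GRing.scale/=; ring.
exact: is_deriveZ.
Qed.

Let is_derive_G j (x : R) : is_derive x (1 : R) (G j) (g j x).
Proof.
have hX := is_derive_pow j x.
have -> : g j x = x ^+ j.+1 *: (- x * phi x) + phi x *: (j.+1%:R * x ^+ j).
  by rewrite /g /GRing.scale/= !exprS; ring.
exact: is_deriveM.
Qed.

Let continuous_pow_phi j : continuous (fun x : R => x ^+ j * phi x).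
Proof.
move=> x; apply: cvgM; first exact: exprn_continuous.
by apply: continuous_normal_pdf; exact: oner_neq0.
Qed.

Let continuous_g j : continuous (g j).
Proof.
move=> x; apply: cvgB; last exact: continuous_pow_phi.
by apply: cvgM; [exact: cvg_cst|exact: continuous_pow_phi].
Qed.

Let integrable_g j : mu.-integrable setT (EFin \o g j).
Proof.
rewrite (_ : _ \o _ = fun x => ((j.+1%:R)%:E * (x ^+ j * phi x)%:E - (x ^+ j.+2 * phi x)%:E)%E)//.
apply: integrableB => //; last exact: integrable_pow_normal_pdf.
by apply: integrableZl => //; exact: integrable_pow_normal_pdf.
Qed.

Let I (N : nat) : set R := `[(- N.+1%:R : R), N.+1%:R]%classic.

Let integral_g_itv j (N : nat) :
  (\int[mu]_(x in I N) (g j x)%:E =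
    (G j N.+1%:R - G j (- N.+1%:R))%:E)%E.
Proof.
rewrite (@continuous_FTC2 _ (g j) (G j)).
- by rewrite EFinB.
- by rewrite gtrN ?ltr0n.
- by apply: continuous_subspaceT; exact: continuous_g.
- have cG : continuous (G j) by exact: continuous_pow_phi.
  split; first by move=> x _; have [] := is_derive_G j x.
    by apply: cvg_at_right_filter; exact: cG.
  by apply: cvg_at_left_filter; exact: cG.
- by move=> x _; rewrite derive1E; have [_ ->] := is_derive_G j x.
Qed.

(** Bounding one more power of [x] against the density makes the boundary terms at most
    [C / N.+1]. *)
Let cvg_G j : (G j N.+1%:R - G j (- N.+1%:R))%:E @[N --> \oo] --> (0 : \bar R).
Proof.
have [C bC] := bounded j.+2.
have C0 : 0 <= C.
  by apply: le_trans (bC 0); rewrite mulr_ge0// ?exprn_ge0// normal_pdf_ge0.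
apply: cvg_EFin; first by apply: nearW.
apply/cvgrPdist_le => e e0.
near=> N.
have N0 : 0 < N.+1%:R :> R by rewrite ltr0n.
have GN (x : R) : `|x| = N.+1%:R -> `|G j x| <= C / N.+1%:R.
  move=> xN; rewrite ler_pdivlMr// -xN /G normrM normrX mulrAC -exprSr.
  by rewrite (ger0_norm (normal_pdf_ge0 _ _ _)); exact: bC.
rewrite /= sub0r normrN; apply: (le_trans (ler_normB _ _)).
apply: (@le_trans _ _ (C / N.+1%:R + C / N.+1%:R)).
  by apply: lerD; apply: GN; rewrite ?normrN ger0_norm// ltW.
have : 2 * C / e <= N%:R by near: N; exact: nbhs_infty_ger.
rewrite -mulrDl ler_pdivrMr// => H; rewrite ler_pdivrMr//.
by rewrite -natr1; nra.
Unshelve. all: by end_near. Qed.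

(** The fundamental theorem of calculus on growing intervals, with [|g j|] itself as the dominating
    function. *)
Lemma integral_stein j :
  (\int[mu]_x (j.+1%:R * (x ^+ j * phi x) - x ^+ j.+2 * phi x)%:E = 0)%E.
Proof.
pose f_ N : R -> \bar R := (EFin \o g j) \_ (I N).
have mI N : measurable (I N) by exact: measurable_itv.
have [mg _] : measurable_fun setT (EFin \o g j) /\ True.
  by split=> //; have /integrableP[] := integrable_g j.
have f_g x : f_ ^~ x @ \oo --> (EFin \o g j) x.
  apply: cvg_near_cst; near=> N; rewrite /f_ patchE mem_set//= /I/= in_itv/= -ler_norml.
  have : `|x| <= N%:R by near: N; exact: nbhs_infty_ger.
  by rewrite -natr1; lra.
have mf_ N : measurable_fun setT (f_ N).
  by apply/(measurable_restrictT _ (mI N)); exact: measurable_funTS.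
have f_le : {ae mu, forall x N, setT x -> (`|f_ N x| <= (abse \o (EFin \o g j)) x)%E}.
  apply: aeW => x N _; rewrite /f_ patchE; case: ifPn => _ //=.
  by rewrite normr0 lee_fin normr_ge0.
have f_cvg : {ae mu, forall x, setT x -> f_ ^~ x @ \oo --> (EFin \o g j) x}.
  by apply: aeW => x _; exact: f_g.
have [_ _] := @dominated_convergence _ _ R mu setT measurableT f_ (EFin \o g j) _
  mf_ mg f_cvg (integrable_abse (integrable_g j)) f_le.
move=> cv; apply/esym; apply: cvg_unique (cvg_G j) _ => //.
apply: cvg_trans cv; apply: near_eq_cvg; near=> N.
by apply: etrans (integral_g_itv j N); rewrite [RHS]integral_mkcond.
Unshelve. all: by end_near. Qed.

End standard_normal_moments.

(** * Reduction of Gaussian expectations to the standard normal law *)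

Section gauss_law.
Context {R : realType}.
Notation N01 := (normal_prob (0 : R) 1).

Let affm (m s : R) : measurableTypeR R -> measurableTypeR R := fun y => s * y + m.

Let measurable_affm m s : measurable_fun setT (affm m s).
Proof. exact: measurable_affine. Qed.

Let gauss1_aff (m s : R) (B : set R) : measurable B ->
  N01 (affm m s @^-1` B) = gauss1 m s B.
Proof.
move=> mB; have := gauss1_affine 0 1 s m mB.
by rewrite mulr0 add0r mulr1 /gauss1 oner_eq0.
Qed.

Context d (T : measurableType d) (P : {measure set T -> \bar R}) (Y : T -> R).
Variables (m s : R).
Hypothesis mY : measurable_fun setT Y.
Hypothesis lawY : forall B : set R, measurable B -> P (Y @^-1` B) = gauss1 m s B.

(** For every [s], including 0, [gauss1 m s] is the law of [s * y + m] under the standard normal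
    law, so the degenerate case needs no separate treatment. *)
Lemma integral_gauss_law (h : R -> R) : measurable_fun setT h ->
  N01.-integrable setT (EFin \o (fun y => h (s * y + m))) ->
  P.-integrable setT (EFin \o (fun w => h (Y w))) /\
  \int[P]_w h (Y w) = \int[N01]_y h (s * y + m).
Proof.
move=> mh ih.
pose Y' : T -> measurableTypeR R := Y.
have mY' : measurable_fun setT Y' by exact: mY.
have lawE A : measurable A -> A `<=` setT -> pushforward P Y' A = pushforward N01 (affm m s) A.
  by move=> mA _; rewrite /pushforward gauss1_aff// -lawY.
have mhE : measurable_fun setT (EFin \o h) by exact/measurable_EFinP.
have iY : P.-integrable setT (EFin \o (fun w => h (Y w))).
  apply/integrableP; split.
    by apply/measurable_EFinP; exact: measurableT_comp mY.
  have mah : measurable_fun setT (abse \o (EFin \o h)) by exact: measurableT_comp.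
  have ah0 : {in setT, forall y, (0 <= (abse \o (EFin \o h)) y)%E}.
    by move=> y _; exact: abse_ge0.
  have e1 := ge0_integral_pushforward mY' P measurableT mah ah0.
  have e2 := ge0_integral_pushforward (measurable_affm m s) N01 measurableT mah ah0.
  have [_ fin] := integrableP _ _ _ ih.
  apply: le_lt_trans fin; rewrite le_eqVlt; apply/orP; left; apply/eqP.
  apply: (etrans (esym e1)); apply: etrans e2.
  exact: (eq_measure_integral _ lawE).
split=> //; rewrite /Rintegral; congr fine.
apply: (etrans (esym (integral_pushforward mY' mhE iY measurableT))).
apply: etrans (integral_pushforward (measurable_affm m s) mhE ih measurableT).
exact: (eq_measure_integral _ lawE).
Qed.

End gauss_law.

Section standard_moments.
Context {R : realType}.
Notation N01 := (normal_prob (0 : R) 1).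

Let std_pow j : N01.-integrable setT (EFin \o (fun x : R => x ^+ j)) /\
  (\int[N01]_x (x ^+ j)%:E = \int[lebesgue_measure]_x (x ^+ j * normal_pdf 0 1 x)%:E)%E.
Proof.
apply: (@integral_density _ _ R lebesgue_measure N01 (normal_pdf 0 1)
  (measurable_normal_pdf 0 1) (fun x => normal_pdf_ge0 0 1 x) (fun A _ => erefl)
  (fun x => x ^+ j) _ (integrable_pow_normal_pdf j)).
exact: measurable_funX.
Qed.

Lemma integrable_std_pow j : N01.-integrable setT (EFin \o (fun x : R => x ^+ j)).
Proof. by have [] := std_pow j. Qed.

Definition std_moment j : R := \int[N01]_x (x ^+ j).

Lemma std_momentE j :
  (std_moment j)%:E = (\int[lebesgue_measure]_x (x ^+ j * normal_pdf 0 1 x)%:E)%E.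
Proof.
have [i e] := std_pow j.
by rewrite -e /std_moment /Rintegral fineK//; exact: integrable_fin_num i.
Qed.

Lemma std_moment0 : std_moment 0 = 1.
Proof.
rewrite /std_moment /Rintegral; under eq_integral do rewrite expr0.
have := integral_cst N01 (@measurableT _ _) (1%E : \bar R) => /(congr1 fine).
rewrite mul1e => ->; exact: (congr1 fine (@probability_setT _ _ _ N01)).
Qed.

Lemma std_momentSS j : std_moment j.+2 = j.+1%:R * std_moment j.
Proof.
apply: EFin_inj; rewrite EFinM !std_momentE.
have i0 := @integrable_pow_normal_pdf R j; have i2 := @integrable_pow_normal_pdf R j.+2.
have := @integral_stein R j.
under eq_integral do rewrite EFinB EFinM.
rewrite integralB//=; last by have := integrableZl measurableT j.+1%:R i0.
rewrite integralZl// => /eqP; rewrite sube_eq ?add0e; first by move/eqP.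
  rewrite fin_numM//; exact: (integrable_fin_num _ i0).
by rewrite fin_num_adde_defl//; exact: (integrable_fin_num _ i2).
Qed.

(** The recursion goes in steps of two and leaves this value open; it vanishes by the symmetry
    [x |-> - x]. *)
Lemma std_moment1 : std_moment 1 = 0.
Proof.
have law (B : set R) : measurable B -> N01 ((fun x : R => - x) @^-1` B) = gauss1 0 1 B.
  move=> mB; have := gauss1_affine 0 1 (-1) 0 mB.
  rewrite mulr0 addr0 mulr1 -[in RHS]gauss1_normr normrN1 => <-.
  rewrite /gauss1 oner_eq0; congr (normal_prob _ _ _).
  by apply/seteqP; split=> x /=; rewrite mulN1r addr0.
have e : (fun y : R => 1 * y + 0) = (fun y => y ^+ 1).
  by apply/funext => y; rewrite mul1r addr0 expr1.
have mN : measurable_fun setT (fun x : R => - x) by exact: measurableT_comp.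
have mI : measurable_fun setT (fun x : R => x) by exact: measurable_id.
have [] := @integral_gauss_law R _ (measurableTypeR R) N01 (fun x : R => - x) 0 1 mN law _ mI; first by rewrite e; exact: integrable_std_pow.
move=> _; rewrite e -/(std_moment 1) => N.
have {N} : - std_moment 1 = std_moment 1.
  rewrite -[RHS]N /std_moment -mulN1r -RintegralZl//; last exact: integrable_std_pow.
  by apply: eq_Rintegral => x _; rewrite mulN1r expr1.
by move=> /eqP; rewrite eq_sym -addr_eq0 -mulr2n mulrn_eq0/= => /eqP.
Qed.

Lemma std_moment_odd j : odd j -> std_moment j = 0.
Proof.
elim/ltn_ind: j => -[|[|j]] ih //= oj; first exact: std_moment1.
by rewrite std_momentSS ih ?mulr0//; move: oj; rewrite negbK.
Qed.

Lemma std_moment_even j : std_moment j.*2 = \prod_(i < j) (i.*2.+1)%:R.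
Proof.
elim: j => [|j ih]; first by rewrite big_ord0 std_moment0.
by rewrite doubleS std_momentSS ih big_ord_recr/= mulrC.
Qed.

End standard_moments.

Section borel_rV_measurability.
Context {R : realType} {k : nat}.

Lemma measurable_borel_continuous (f : @borel_rV R k -> R) :
  continuous (f : 'rV[R]_k -> R) -> measurable_fun setT f.
Proof.
move=> /continuousP cf; apply: (measurability _ (RGenOpens.measurableE R)).
move=> _ [_ [a [b ->] <-]]; rewrite setTI; apply: sub_sigma_algebra.
exact/cf/interval_open.
Qed.

End borel_rV_measurability.

(** * Moments of Gaussian measures on row vectors *)

Section gaussian_mean.
Context {R : realType} {k : nat}.
Variable mu : probability (@borel_rV R k) R.

Definition prob_mean (f : 'rV[R]_k -> R) : R := \int[mu]_x (f x).

Hypothesis gmu : is_gaussian mu.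

Let pow_affine (s m : R) j : (fun y : R => (s * y + m) ^+ j) =
  (fun y => \sum_(i < j.+1) ((s * y) ^+ (j - i) * m ^+ i) *+ 'C(j, i)).
Proof. by apply/funext => y; rewrite exprDn. Qed.

Let integrable_std_affine (s m : R) j :
  (normal_prob (0 : R) 1).-integrable setT (EFin \o (fun y => (s * y + m) ^+ j)).
Proof.
rewrite pow_affine.
have -> : EFin \o (fun y : R => \sum_(i < j.+1) ((s * y) ^+ (j - i) * m ^+ i) *+ 'C(j, i))
    = (fun y => (\sum_(i < j.+1) ((s ^+ (j - i) * m ^+ i) *+ 'C(j, i))%:E *
        ((y ^+ (j - i)))%:E)%E).
  apply/funext => y /=; rewrite -sumEFin; apply: eq_bigr => i _.
  by rewrite -EFinM exprMn mulrnAl; congr (_ *+ _)%:E; ring.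
apply: integrable_sum => // i _.
by apply: integrableZl => //; exact: integrable_std_pow.
Qed.

Lemma integrable_gaussian_pow a j :
  mu.-integrable setT (EFin \o (fun x : 'rV[R]_k => dot a x ^+ j)).
Proof using gmu.
have [m [s law]] := gmu a.
have ma : measurable_fun setT (fun x : @borel_rV R k => dot a x).
  by apply: measurable_borel_continuous; exact: dot_continuous.
have mh : measurable_fun setT (fun y : R => y ^+ j) by exact: measurable_funX.
by have [] := @integral_gauss_law R _ (@borel_rV R k) mu _ m s ma law _ mh
  (integrable_std_affine s m j).
Qed.

Lemma integrable_gaussian f : poly_growth f -> mu.-integrable setT (EFin \o f).
Proof using gmu.
move=> pf; have [K [N [K0 fK]]] := poly_growth_ge0 pf.
(* An even exponent makes all powers nonnegative, so the largest coordinate is dominated by the sum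
   over coordinates. *)
pose M := N.*2.
pose g (x : 'rV[R]_k) := K * 2 ^+ M * (1 + \sum_i dot (delta_mx 0 i) x ^+ M).
have M0 (y : R) : 0 <= y ^+ M by rewrite /M -muln2 exprM -real_normK ?num_real// exprn_ge0 ?sqr_ge0.
have gE : EFin \o g = (fun x => (K * 2 ^+ M)%:E *
    (1 + \sum_i (dot (delta_mx 0 i) x ^+ M)%:E))%E.
  by apply/funext => x; rewrite /g/= sumEFin -EFinD -EFinM.
have ig : mu.-integrable setT (EFin \o g).
  rewrite gE; apply: integrableZl => //; apply: integrableD => //.
    have := finite_measure_integrable_cst mu 1. by move=> h; exact: h.
  by apply: integrable_sum => // i _; exact: integrable_gaussian_pow.
apply: le_integrable ig => //.
  by apply/measurable_EFinP; apply: measurable_borel_continuous; exact: pf.1.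
move=> x _ /=; rewrite lee_fin (le_trans (fK x))//.
apply: le_trans (ler_norm _); rewrite /g -mulrA ler_wpM2l//.
have S0 : 0 <= \sum_i dot (delta_mx 0 i) x ^+ M by apply: sumr_ge0 => i _.
have e1 : (1 + `|x|) ^+ N <= (1 + `|x|) ^+ M.
  by apply: ler_weXn2l; [rewrite lerDl|rewrite /M -addnn leq_addr].
apply: (le_trans e1).
have [x1|x1] := leP `|x| 1.
  apply: (@le_trans _ _ (2 ^+ M)); last by rewrite ler_peMr ?exprn_ge0// lerDl.
  by rewrite lerXn2r ?nnegrE ?addr_ge0// -[2]/(1 + 1) lerD2l.
have [i xi] : exists i, `|x| = `|x 0 i|.
  have n0 : mx_norm x != 0 by rewrite -[mx_norm x]/`|x| gt_eqF// (lt_trans ltr01).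
  by have [[i j] /= e] := mx_norm_neq0 n0; exists j; rewrite -(ord1 i) -e.
apply: (@le_trans _ _ ((2 * `|x|) ^+ M)).
  by rewrite lerXn2r ?nnegrE ?addr_ge0 ?mulr_ge0// mulr2n mulrDl mul1r lerD2r ltW.
rewrite exprMn ler_wpM2l ?exprn_ge0// xi.
have -> : `|x 0 i| ^+ M = dot (delta_mx 0 i) x ^+ M.
  by rewrite dot_delta /M -muln2 mulnC !exprM real_normK ?num_real.
rewrite (bigD1 i)//= addrCA lerDl addr_ge0// sumr_ge0//.
Qed.

Lemma is_mean_prob_mean : is_mean prob_mean.
Proof using gmu.
split=> [|f g pf pg|a f pf|f pf f0]; rewrite /prob_mean.
- by rewrite Rintegral_cst// mul1r; exact: (congr1 fine (@probability_setT _ _ _ mu)).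
- by rewrite RintegralD//; exact: integrable_gaussian.
- by rewrite RintegralZl//; exact: integrable_gaussian.
- exact: Rintegral_ge0.
Qed.

Lemma EFin_prob_mean f : poly_growth f ->
  (\int[mu]_x (f x)%:E)%E = (prob_mean f)%:E.
Proof using gmu.
move=> pf; rewrite /prob_mean /Rintegral fineK//.
exact: integrable_fin_num (integrable_gaussian pf).
Qed.

Lemma gaussian_moment a m s :
  (forall B : set R, measurable B -> mu [set x : 'rV[R]_k | B (dot a x)] = gauss1 m s B) ->
  forall j, prob_mean (fun x => (dot a x - m) ^+ j) = s ^+ j * std_moment j.
Proof using gmu.
move=> law j.
have ma : measurable_fun setT (fun x : @borel_rV R k => dot a x).
  by apply: measurable_borel_continuous; exact: dot_continuous.
have mh : measurable_fun setT (fun y : R => (y - m) ^+ j).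
  by apply: measurable_funX; apply: measurable_funB.
have e y : (s * y + m - m) ^+ j = s ^+ j * y ^+ j by rewrite addrK exprMn.
have [|_] := @integral_gauss_law R _ (@borel_rV R k) mu _ m s ma law _ mh.
  rewrite (_ : _ \o _ = (fun y => (s ^+ j)%:E * (y ^+ j)%:E)%E); last first.
    by apply/funext => y /=; rewrite e.
  by apply: integrableZl => //; exact: integrable_std_pow.
rewrite /prob_mean => ->.
rewrite /std_moment -RintegralZl//; last exact: integrable_std_pow.
by apply: eq_Rintegral => y _.
Qed.

Lemma gaussian_dot_mean a m s :
  (forall B : set R, measurable B -> mu [set x : 'rV[R]_k | B (dot a x)] = gauss1 m s B) ->
  prob_mean (dot a) = m.
Proof using gmu.
move=> /gaussian_moment /(_ 1%N); rewrite std_moment1 mulr0 => /eqP.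
have mE := is_mean_prob_mean.
rewrite (_ : (fun x => _) = (fun x => dot a x - m)); last by apply/funext => x; rewrite expr1.
rewrite (meanB mE) ?(mean_cst mE) ?subr_eq0 => [/eqP//||].
- exact: poly_growth_dot.
- exact: poly_growth_cst.
Qed.

Lemma has_meanP eta :
  has_mean mu eta <-> forall i, prob_mean (fun x => x 0 i) = eta 0 i.
Proof using gmu.
by split=> h i; move: (h i); rewrite expectation.unlock EFin_prob_mean;
  try exact: poly_growth_coord; [move=> [] | move=> ->].
Qed.

Lemma has_covarianceP eta C : has_mean mu eta ->
  (has_covariance mu C <-> forall i j,
    prob_mean (fun x => (x 0 i - eta 0 i) * (x 0 j - eta 0 j)) = C i j).
Proof using gmu.
move=> hm.
have e i j : covariance mu (fun x : 'rV[R]_k => x 0 i) (fun x : 'rV[R]_k => x 0 j) =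
    (prob_mean (fun x => (x 0 i - eta 0 i) * (x 0 j - eta 0 j)))%:E.
  rewrite covariance.unlock !hm/= expectation.unlock -EFin_prob_mean//.
  by apply: poly_growthM; apply: poly_growthB (poly_growth_cst _); exact: poly_growth_coord.
by split=> h i j; move: (h i j); rewrite e; [move=> [] | move=> ->].
Qed.

Lemma prob_mean_quadratic (a eta : 'rV[R]_k) :
  prob_mean (fun x => (dot a x - dot a eta) ^+ 2) =
  \sum_i \sum_j a 0 i * a 0 j * prob_mean (fun x => (x 0 i - eta 0 i) * (x 0 j - eta 0 j)).
Proof using gmu.
have mE := is_mean_prob_mean.
have pc i : poly_growth (fun x : 'rV[R]_k => x 0 i - eta 0 i).
  by apply: poly_growthB (poly_growth_cst _); exact: poly_growth_coord.
have pp i j : poly_growth (fun x : 'rV[R]_k => (x 0 i - eta 0 i) * (x 0 j - eta 0 j)).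
  exact: poly_growthM.
rewrite (_ : (fun x => _) = (fun x : 'rV[R]_k => \sum_i \sum_j a 0 i * a 0 j *
    ((x 0 i - eta 0 i) * (x 0 j - eta 0 j)))); last first.
  apply/funext => x; rewrite -dotBr /dot expr2 big_distrl/=; apply: eq_bigr => i _.
  by rewrite big_distrr/=; apply: eq_bigr => j _; rewrite !mxE; ring.
rewrite (mean_sum mE) => [|i]; last by apply: poly_growth_sum => j; exact: poly_growthZ.
apply: eq_bigr => i _; rewrite (mean_sum mE) => [|j]; last exact: poly_growthZ.
by apply: eq_bigr => j _; rewrite (meanZ mE).
Qed.

(** The parameters supplied by [is_gaussian] are identified through the first two moments; [s] is
    determined only up to sign. *)
Lemma gaussian_centered_moment eta C a :
  has_mean mu eta -> has_covariance mu C ->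
  exists2 s, s ^+ 2 = dot (a *m C) a &
    forall j, prob_mean (fun x => (dot a x - dot a eta) ^+ j) = s ^+ j * std_moment j.
Proof using gmu.
move=> hm hC; have [m [s law]] := gmu a; have mE := is_mean_prob_mean.
have em : dot a eta = m.
  rewrite -(gaussian_dot_mean law) (_ : dot a = fun x : 'rV[R]_k => \sum_i a 0 i * x 0 i)//.
  rewrite (mean_sum mE) => [|i]; last by apply: poly_growthZ; exact: poly_growth_coord.
  apply: eq_bigr => i _; rewrite (meanZ mE); last exact: poly_growth_coord.
  by move/has_meanP: hm => ->.
have E j : prob_mean (fun x => (dot a x - dot a eta) ^+ j) = s ^+ j * std_moment j.
  by rewrite em; exact: gaussian_moment.
exists s => //; have := E 2%N; rewrite std_momentSS std_moment0 !mulr1 => <-.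
rewrite prob_mean_quadratic exchange_big dotC /dot; apply: eq_bigr => i _.
rewrite mxE big_distrr/=; apply: eq_bigr => j _.
by move/(has_covarianceP _ hm): hC => ->; ring.
Qed.

End gaussian_mean.

(** * Coordinatewise measurability *)

Section borel_rV_measurable_map.
Context {R : realType} {k : nat} d (T : measurableType d).

(** Every open set is a countable union of boxes with rational centres and half-widths
    [1 / q.2.+1]. *)
Lemma measurable_borel_rV (X : T -> @borel_rV R k) :
  (forall i, measurable_fun setT (fun w => (X w : 'rV[R]_k) 0 i)) ->
  measurable_fun setT X.
Proof.
move=> mX.
pose box (q : 'rV[rat]_k * nat) : set 'rV[R]_k :=
  [set x | forall i, `|x 0 i - ratr (q.1 0 i)| < q.2.+1%:R^-1].
have mbox q : measurable (X @^-1` box q).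
  have -> : X @^-1` box q = \bigcap_(i in [set: 'I_k])
      [set w | `|(X w : 'rV[R]_k) 0 i - ratr (q.1 0 i)| < q.2.+1%:R^-1].
    by apply/seteqP; split=> w H i => [_|]; exact: H.
  apply: fin_bigcap_measurable => // i _.
  have mg : measurable_fun setT
      (fun w => `|(X w : 'rV[R]_k) 0 i - ratr (q.1 0 i)|).
    by apply: measurableT_comp => //; apply: measurable_funB.
  rewrite -[X in measurable X]setTI.
  have := mg measurableT `]-oo, q.2.+1%:R^-1[%classic (measurable_itv _).
  by congr (measurable _); apply/seteqP; split=> w [_]; rewrite /= in_itv.
apply: (@measurability _ _ _ _ setT X (@open 'rV[R]_k)).
  by [].
move=> _ [U oU <-]; rewrite setTI.
pose F n := if unpickle n is Some q then
  if `[< box q `<=` U >] then X @^-1` box q else set0 else set0.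
have -> : X @^-1` U = \bigcup_n F n.
  apply/seteqP; split=> w; last first.
    move=> [n _]; rewrite /F; case: unpickle => [q|]; last by [].
    by case: ifPn => [/asboolP qU|//] /qU.
  move=> /= Uw; have [e /= e0 eU] := (nbhs_ballP _ _).1 (open_nbhs_nbhs (conj oU Uw)).
  (* Two points of a box of half-width [r] are within [2 * r], whence a half-width below [e / 2]. *)
  have [m] := ltr_add_invr (divr_gt0 e0 (ltr0Sn R 1)); rewrite add0r => me.
  set r := m.+1%:R^-1 in me; have r0 : 0 < r by rewrite invr_gt0 ltr0n.
  have /choice[q qP] : forall i, exists q : rat, `|(X w : 'rV[R]_k) 0 i - ratr q| < r.
    move=> i; set x := (X w : 'rV[R]_k) 0 i.
    have [q] := @rat_in_itvoo R (x - r) (x + r) ltac:(lra).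
    by rewrite in_itv/= => /andP[q1 q2]; exists q; rewrite ltr_norml; lra.
  exists (pickle (\row_i q i, m)) => //; rewrite /F pickleK.
  have bw : box (\row_i q i, m) (X w) by move=> i; rewrite /= mxE; exact: qP.
  case: ifPn => [//|/asboolPn[]] y yb; apply: eU; rewrite -ball_normE /ball_/=.
  apply: (@le_lt_trans _ _ (r + r)); last by lra.
  apply: normr_rV_leP => [|i]; first by lra.
  have := bw i; have := yb i; rewrite /= -/r !mxE !ltr_norml ler_norml; lra.
apply: bigcupT_measurable => n; rewrite /F; case: unpickle => [q|]; last by [].
by case: ifP.
Qed.

End borel_rV_measurable_map.

(** * Cholesky factorization of positive semidefinite matrices *)

Section cholesky.
Context {R : realType}.

Let dot_row_mx n (t s : R) (x y : 'rV[R]_n) :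
  dot (row_mx t%:M x : 'rV_(1 + n)) (row_mx s%:M y) = t * s + dot x y.
Proof.
rewrite /dot big_split_ord/= big_ord_recl big_ord0 addr0.
rewrite !row_mxEl !mxE eqxx !mulr1n; congr (_ + _).
by apply: eq_bigr => i _; rewrite !row_mxEr.
Qed.

(** Induction on the size through the Schur complement of the top left entry [c]. The pivot may be
    0; then its row [b] vanishes, and the conventions [0^-1 = 0] make the same formulas valid. *)
Lemma psd_factor n (C : 'M[R]_n) : C^T = C ->
  (forall x : 'rV_n, 0 <= dot (x *m C) x) -> exists A : 'M[R]_n, A^T *m A = C.
Proof.
elim: n C => [|n ih] C; first by move=> _ _; exists 0; rewrite [LHS]flatmx0 [RHS]flatmx0.
move: C; rewrite -[n.+1]/(1 + n)%N => C sC psd.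
pose c := C 0 0; pose b := ursubmx C; pose D := drsubmx C.
have bT : dlsubmx C = b^T by rewrite /b trmx_ursub sC.
have Cc : ulsubmx C = c%:M.
  apply/matrixP => i j; rewrite !ord1 !mxE eqxx mulr1n; congr (C _ _); exact/val_inj.
have CE : C = block_mx c%:M b b^T D by rewrite -Cc -bT submxK.
have quad t y : dot (row_mx t%:M y *m C) (row_mx t%:M y) =
    t * (t * c + dot b y) + (t * dot b y + dot (y *m D) y).
  rewrite [in LHS]CE mul_row_block -scalar_mxM mul_scalar_mx.
  rewrite [y *m b^T]mx11_scalar -dotE -raddfD/= dot_row_mx dotDl dotZl (dotC y b).
  ring.
(* If [c = 0] and [b] were nonzero, the quadratic form would be affine in the first coordinate; the
   chosen value makes it -1. *)
have b0 : c = 0 -> b = 0.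
  move=> c0; apply/eqP; rewrite -dotxx_eq0; apply/negP => /negP bb0.
  have := psd (row_mx (- ((dot (b *m D) b + 1) / (2 * dot b b)))%:M b).
  rewrite quad c0 mulr0 add0r; set q := dot (b *m D) b.
  set t := - (_ / _) => tq; have e : 2 * (t * dot b b) = - (q + 1) by rewrite /t; field.
  by move: tq; rewrite addrA -mulr2n -mulr_natl e opprD -addrA addrCA addNr addr0 oppr_ge0 ler10.
have c0 : 0 <= c.
  by have := psd (row_mx 1%:M 0); rewrite quad dot0r mul0mx dot0l !mul1r !addr0.
pose D' := D - c^-1 *: (b^T *m b).
have [|y|A AD] := ih D'.
- rewrite /D' linearB/= linearZ/= trmx_mul trmxK; congr (_ - _).
  by rewrite /D trmx_drsub sC.
- have -> : dot (y *m D') y = dot (y *m D) y - c^-1 * dot b y ^+ 2.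
    rewrite /D' mulmxBr dotBl -scalemxAr dotZl mulmxA [y *m b^T]mx11_scalar -dotE.
    by rewrite mul_scalar_mx dotZl (dotC y b) expr2.
  (* This first coordinate minimizes the form of [C] when [c] is positive, and the minimum is the
     form of the Schur complement. *)
  have := psd (row_mx (- (c^-1 * dot b y))%:M y); rewrite quad.
  have [cz|cn] := eqVneq c 0; first by rewrite cz invr0 !mul0r oppr0 !mul0r !add0r addr0.
  have -> : - (c^-1 * dot b y) * c = - dot b y by rewrite mulNr mulrAC mulVf// mul1r.
  by rewrite addNr mulr0 add0r mulNr addrC -mulrA -expr2.
set s := Num.sqrt c.
have sb : s *: (s^-1 *: b) = b.
  have [s0|s0] := eqVneq s 0; last by rewrite scalerA divff// scale1r.
  rewrite b0 ?scaler0//; apply/eqP; rewrite eq_le c0 andbT.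
  by move/eqP: s0; rewrite sqrtr_eq0.
have bb : (s^-1 *: b)^T *m (s^-1 *: b) = c^-1 *: (b^T *m b).
  rewrite [(_ *: b)^T]linearZ/= -scalemxAl -scalemxAr scalerA; congr (_ *: _).
  by rewrite -expr2 exprVn sqr_sqrtr.
exists (block_mx s%:M (s^-1 *: b) 0 A).
rewrite tr_block_mx trmx0 mulmx_block CE tr_scalar_mx !mul0mx !mulmx0 !addr0 bb AD.
rewrite -scalar_mxM mul_scalar_mx sb mul_mx_scalar -expr2 sqr_sqrtr//.
by rewrite -linearZ/= sb /D' addrC subrK.
Qed.

End cholesky.

(** * Existence of Gaussian measures *)

Section gaussian_existence.
Context {R : realType} {k : nat}.
Variables (eta : 'rV[R]_k) (C : 'M[R]_k).
Hypotheses (sC : C^T = C) (psdC : forall x : 'rV_k, 0 <= dot (x *m C) x).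

(** The law of [eta + Z *m A] for a standard normal vector [Z] and a factor [A] of the
    covariance. *)
Lemma exists_gaussian : exists mu : probability (@borel_rV R k) R,
  [/\ is_gaussian mu, has_mean mu eta & has_covariance mu C].
Proof.
have [A AC] := psd_factor sC psdC.
have [disp [T [P [Z [mZ _ dotZ]]]]] := @exists_iid_normal R k.
pose X w : @borel_rV R k := eta + Z w *m A.
have mX : measurable_fun setT X.
  apply: measurable_borel_rV => i.
  have -> : (fun w => (X w : 'rV[R]_k) 0 i) =
      (fun w => eta 0 i + \sum_j Z w 0 j * A j i) by apply/funext => w; rewrite !mxE.
  by apply: measurable_funD => //; apply: measurable_sum => j; exact: measurable_funM.
pose X' : {mfun T >-> @borel_rV R k} := mfun_Sub (mem_set mX).
pose mu : probability (@borel_rV R k) R := distribution P X'.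
have law a B : measurable B -> mu [set x : 'rV[R]_k | B (dot a x)] =
    gauss1 (dot a eta) (enorm (a *m A^T)) B.
  move=> mB; have mB' : measurable [set y | B (y + dot a eta)].
    have := @measurable_affine R 1 (dot a eta) measurableT B mB; rewrite setTI.
    by congr (measurable _); apply/seteqP; split=> y /=; rewrite mul1r.
  transitivity (P [set w | B (dot (a *m A^T) (Z w) + dot a eta)]).
    congr (P _); apply/seteqP; split=> w /=;
      by rewrite /X dotDr addrC dot_mulmx trmxK.
  have := dotZ (a *m A^T) _ mB'; rewrite /= => ->.
  have := gauss1_affine 0 (enorm (a *m A^T)) 1 (dot a eta) mB.
  rewrite mulr0 add0r mul1r => <-; congr (gauss1 _ _ _).
  by apply/seteqP; split=> y /=; rewrite mul1r.
have gmu : is_gaussian mu.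
  by move=> a; exists (dot a eta), (enorm (a *m A^T)) => B; exact: law.
have hm : has_mean mu eta.
  apply/(has_meanP gmu) => i; rewrite -[RHS]dot_delta -(gaussian_dot_mean gmu (law _)).
  by congr prob_mean; apply/funext => x; rewrite dot_delta.
have mE := is_mean_prob_mean gmu.
exists mu; split=> //; apply/(has_covarianceP gmu C hm) => i j.
have q a : prob_mean mu (fun x => (dot a x - dot a eta) ^+ 2) = dot (a *m C) a.
  rewrite (gaussian_moment gmu (law a)) std_momentSS std_moment0 !mulr1.
  by rewrite sqr_enorm dot_mulmx trmxK -mulmxA AC dotC.
have dC i' j' : dot (delta_mx 0 i' *m C) (delta_mx 0 j') = C i' j'.
  by rewrite dotC dot_delta -rowE mxE.
pose d i' (x : 'rV[R]_k) := x 0 i' - eta 0 i'.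
have pd a : poly_growth (fun x : 'rV[R]_k => (dot a x - dot a eta) ^+ 2).
  by apply: poly_growthX; apply: poly_growthB (poly_growth_cst _); exact: poly_growth_dot.
(* Polarization: the variances of linear forms are known, and the covariance is a quarter of the
   difference of those of the sum and of the difference of two coordinates. *)
pose ep : 'rV[R]_k := delta_mx 0 i + delta_mx 0 j.
pose em : 'rV[R]_k := delta_mx 0 i - delta_mx 0 j.
rewrite (_ : (fun x => _) = (fun x => 4^-1 * ((dot ep x - dot ep eta) ^+ 2 -
    (dot em x - dot em eta) ^+ 2))); last first.
  by apply/funext => x; rewrite /ep /em !dotDl !dotNl !dot_delta; field.
rewrite (meanZ mE); last exact: poly_growthB.
rewrite (meanB mE)// !q /ep /em !mulmxDl !mulNmx !dotDl !dotNl !dotDr !dotNr !dC.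
have -> : C j i = C i j by rewrite -[in LHS]sC mxE.
by field.
Qed.

Lemma gaussian_measureP : [/\ is_gaussian (gaussian_measure eta C),
  has_mean (gaussian_measure eta C) eta & has_covariance (gaussian_measure eta C) C].
Proof.
have [mu muP] := exists_gaussian.
exact: (@getPex _ [set mu : pprobability (@borel_rV R k) R |
  [/\ is_gaussian mu, has_mean mu eta & has_covariance mu C]]
  (ex_intro _ (mu : pprobability _ _) muP)).
Qed.

End gaussian_existence.

(** * Spheres in affine subspaces *)

Section reflections.
Context {R : realType} {n : nat}.
Implicit Types w x y : 'rV[R]_n.

Lemma reflectionB w x y : reflection w (x - y) = reflection w x - reflection w y.
Proof.
by apply/rowP => i; rewrite /reflection dotBl !mxE; ring.
Qed.

Lemma reflectionK w : involutive (reflection w).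
Proof.
move=> x; have [->|w0] := eqVneq w 0; first by rewrite /reflection !scaler0 !subr0.
have ww : dot w w != 0 by rewrite dotxx_eq0.
by apply/rowP => i; rewrite /reflection dotBl dotZl !mxE; field.
Qed.

Lemma enorm_reflection w x : enorm (reflection w x) = enorm x.
Proof. by rewrite /enorm dot_reflection reflectionK. Qed.

End reflections.

(** * A sphere cut by an affine subspace *)

Section affine_sphere.
Context {R : realType} {n g : nat}.
Variables (U : 'M[R]_(g, n)) (p : 'rV[R]_g) (rho : R).

Definition gram := U *m U^T.
(** For an invertible Gram matrix, the point of the affine subspace [x *m U^T = p] nearest the
    origin, and the centre of the sphere cut out in it. *)
Definition center := p *m invmx gram *m U.
(** For an invertible Gram matrix, the orthogonal projection onto the direction of the affine
    subspace. *)
Definition kerproj : 'M[R]_n := 1%:M - U^T *m invmx gram *m U.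
Definition affine_sphere : set 'rV[R]_n :=
  [set x | enorm x = rho /\ x *m U^T = p].

Hypotheses (gn : (g < n)%N) (uG : gram \in unitmx).

Let symG : gram^T = gram. Proof. by rewrite trmx_mul trmxK. Qed.

Let symGi : (invmx gram)^T = invmx gram. Proof. by rewrite trmx_inv symG. Qed.

Lemma tr_kerproj : kerproj^T = kerproj.
Proof. by rewrite linearB/= trmx1 !trmx_mul trmxK symGi mulmxA. Qed.

Lemma mulmx_kerproj : U *m kerproj = 0.
Proof using uG.
by rewrite mulmxBr mulmx1 !mulmxA -/gram mulmxV// mul1mx subrr.
Qed.

Lemma kerproj_mulmx : kerproj *m U^T = 0.
Proof using uG. by rewrite -tr_kerproj -trmx_mul mulmx_kerproj trmx0. Qed.

Lemma kerproj_idem : kerproj *m kerproj = kerproj.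
Proof using uG.
by rewrite {1}/kerproj mulmxBl mul1mx -!mulmxA mulmx_kerproj !mulmx0 subr0.
Qed.

Lemma mxtrace_kerproj : \tr kerproj = n%:R - g%:R.
Proof using uG.
rewrite linearB/= mxtrace1 mxtrace_mulC mulmxA -/gram; congr (_ - _).
by rewrite mulmxV// mxtrace1.
Qed.

Lemma center_mulmx : center *m U^T = p.
Proof using uG. by rewrite -!mulmxA -/gram mulVmx// mulmx1. Qed.

Lemma center_kerproj : center *m kerproj = 0.
Proof using uG. by rewrite -mulmxA mulmx_kerproj mulmx0. Qed.

Lemma affine_decomp (x : 'rV[R]_n) : x *m U^T = p -> x = center + x *m kerproj.
Proof. by move=> xp; rewrite mulmxBr mulmx1 !mulmxA xp addrC subrK. Qed.

Lemma fixed_kerproj (w : 'rV[R]_n) : w *m kerproj = w <-> w *m U^T = 0.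
Proof using uG.
split=> [<-|w0]; first by rewrite -mulmxA kerproj_mulmx mulmx0.
by rewrite mulmxBr mulmx1 !mulmxA w0 !mul0mx subr0.
Qed.

Lemma dot_center_kerproj (x : 'rV[R]_n) : dot center (x *m kerproj) = 0.
Proof using uG. by rewrite dotC dot_mulmx tr_kerproj center_kerproj dot0r. Qed.

Lemma sqr_enorm_decomp (x : 'rV[R]_n) : x *m U^T = p ->
  dot x x = dot center center + dot (x *m kerproj) (x *m kerproj).
Proof using uG.
move=> xp; rewrite {1 2}(affine_decomp xp) dotDl !dotDr dot_center_kerproj.
by rewrite (dotC _ center) dot_center_kerproj addr0 add0r.
Qed.

Lemma dot_center (z : 'rV[R]_n) : dot z center = dot (p *m invmx gram) (z *m U^T).
Proof. by rewrite dotC /center dot_mulmx. Qed.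

Lemma dot_kerproj (z : 'rV[R]_n) : dot (z *m kerproj) z =
  dot z z - dot (z *m U^T *m invmx gram) (z *m U^T).
Proof. by rewrite mulmxBr mulmx1 dotBl !mulmxA; congr (_ - _); exact: dot_mulmx. Qed.

Hypotheses (rho0 : 0 <= rho) (cr : dot center center < rho ^+ 2).

(** The direction has dimension [n - g]; writing this as [(n - g - 1).+1] matches the exponent of
    the surface measure. *)
Let exists_basis : exists2 B : 'M[R]_((n - g - 1).+1, n),
  row_free B & forall w : 'rV[R]_n, w *m U^T = 0 <-> exists y, w = y *m B.
Proof.
have rU : \rank U = g.
  apply/eqP; rewrite eqn_leq rank_leq_row/= -{1}(mxrank1 R g) -(mulmxV uG).
  by rewrite -mulmxA mxrankM_maxl.
have rK : \rank (kermx U^T) = (n - g - 1).+1.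
  by rewrite mxrank_ker mxrank_tr rU; lia.
have: exists2 B : 'M[R]_(\rank (kermx U^T), n),
    row_free B & forall w : 'rV[R]_n, w *m U^T = 0 <-> exists y, w = y *m B.
  exists (row_base (kermx U^T)) => [|w]; first exact: row_base_free.
  rewrite (rwP eqP) -sub_kermx -(eq_row_base (kermx _)).
  by split=> [/submxP//|?]; apply/submxP.
by rewrite rK.
Qed.

Lemma closed_affine_sphere : closed affine_sphere.
Proof.
have -> : affine_sphere = @enorm R n @^-1` [set rho] `&`
    \bigcap_(i : 'I_g) (fun x : 'rV[R]_n => dot x (row i U)) @^-1` [set p 0 i].
  have xU (x : 'rV[R]_n) i : (x *m U^T) 0 i = dot x (row i U).
    by rewrite !mxE; apply: eq_bigr => j _; rewrite !mxE.
  apply/seteqP; split=> x /= [xr xp]; split=> //; first by move=> i _ /=; rewrite -xU xp.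
  by apply/rowP => i; rewrite xU; exact: xp.
apply: closedI.
  apply: closed_comp (@closed_eq _ _) => x _; move: x.
  move=> x; apply: (@continuous_comp _ _ _ (fun x : 'rV[R]_n => dot x x) Num.sqrt).
    have pg : poly_growth (fun x : 'rV[R]_n => dot x x).
      by apply: poly_growth_sum => i; apply: poly_growthM; exact: poly_growth_coord.
    exact: pg.1.
  exact: sqrt_continuous.
apply: closed_bigI => i _; apply: closed_comp (@closed_eq _ _) => x _; move: x.
exact: (poly_growth_dotl _).1.
Qed.

Lemma affine_sphere_bounded x : affine_sphere x -> `|x| <= rho.
Proof. by move=> [<- _]; exact: normr_le_enorm. Qed.

(** In a basis of the direction this is the set of [hausdorff_ellipsoid], with the radius given by
    Pythagoras. *)
Lemma hausdorff_affine_sphere :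
  (0 < hausdorff (n - g - 1) affine_sphere < +oo)%E.
Proof using gn uG rho0 cr.
have [B fB BP] := exists_basis.
have r0 : 0 < Num.sqrt (rho ^+ 2 - dot center center) by rewrite sqrtr_gt0 subr_gt0.
have -> : affine_sphere = [set x | exists2 y, x = center + y *m B &
    enorm (y *m B) = Num.sqrt (rho ^+ 2 - dot center center)]; last exact: hausdorff_ellipsoid.
apply/seteqP; split=> x /=.
  move=> [xr xp]; have [|y xy] := (BP (x *m kerproj)).1.
    by rewrite -mulmxA kerproj_mulmx mulmx0.
  exists y; rewrite -xy; first exact: affine_decomp.
  by rewrite {1}/enorm -xr sqr_enorm (sqr_enorm_decomp xp) addrC addKr.
move=> [y -> yr]; have yU : y *m B *m U^T = 0 by apply/BP; exists y.
have xp : (center + y *m B) *m U^T = p by rewrite mulmxDl center_mulmx yU addr0.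
split=> //; have := sqr_enorm_decomp xp.
rewrite mulmxDl center_kerproj add0r ((fixed_kerproj _).2 yU) -(sqr_enorm (y *m B)) yr.
rewrite sqr_sqrtr ?subr_ge0 ?ltW// addrCA subrr addr0 -sqr_enorm => /eqP.
by rewrite eqrXn2 ?enorm_ge0// => /eqP.
Qed.

Notation E := (surface_mean (n - g - 1) affine_sphere).

Lemma is_mean_affine_sphere : is_mean E.
Proof using gn uG rho0 cr.
have /andP[h0 hoo] := hausdorff_affine_sphere.
exact: is_mean_surface_mean closed_affine_sphere affine_sphere_bounded h0 hoo.
Qed.

Let E_reflection w : w *m kerproj = w -> forall f, poly_growth f ->
  E (fun x => f (reflection w x)) = E f.
Proof.
move=> wP f pf; have /andP[h0 hoo] := hausdorff_affine_sphere.
apply: (surface_mean_isometry closed_affine_sphere affine_sphere_bounded h0 hoo) => //.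
- exact: reflectionK.
- by move=> x y; rewrite -reflectionB enorm_reflection.
- move=> x [xr xp]; split; first by rewrite enorm_reflection.
  by rewrite mulmxBl -scalemxAl ((fixed_kerproj _).1 wP) scaler0 subr0.
Qed.

(** On the sphere [x] minus the centre is the projection of [x], and the symmetric projection can be
    moved onto [z]. *)
Let E_center (z : 'rV[R]_n) j : E (fun x => (dot z x - dot z center) ^+ j) =
  E (fun x => dot x (z *m kerproj) ^+ j).
Proof.
apply: surface_mean_supp => x [_ xp]; rewrite -[in RHS]tr_kerproj -dot_mulmx.
by rewrite {1}(affine_decomp xp) dotDr addrC addKr dotC.
Qed.

Let zPP (z : 'rV[R]_n) : z *m kerproj *m kerproj = z *m kerproj.
Proof. by rewrite -mulmxA kerproj_idem. Qed.

Lemma affine_sphere_moment_odd (z : 'rV[R]_n) j : odd j ->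
  E (fun x => (dot z x - dot z center) ^+ j) = 0.
Proof using gn uG rho0 cr.
move=> oj; rewrite E_center.
have := sphere_moment_odd is_mean_affine_sphere E_reflection (zPP z) oj.
exact.
Qed.

Lemma affine_sphere_moment_even (z : 'rV[R]_n) j :
  E (fun x => (dot z x - dot z center) ^+ j.*2) =
  dot (z *m kerproj) z ^+ j * \prod_(i < j) (i.*2.+1%:R *
    ((rho ^+ 2 - dot center center) / (n%:R - g%:R + i.*2%:R))).
Proof using gn uG rho0 cr.
have S_norm x : affine_sphere x -> dot (x *m kerproj) (x *m kerproj) =
    rho ^+ 2 - dot center center.
  by move=> [xr xp]; rewrite -xr sqr_enorm (sqr_enorm_decomp xp) addrC addKr.
have E_supp f f' : poly_growth f -> poly_growth f' ->
    (forall x, affine_sphere x -> f x = f' x) -> E f = E f'.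
  by move=> _ _; exact: surface_mean_supp.
have m0 : 0 < n%:R - g%:R :> R by rewrite subr_gt0 ltr_nat.
rewrite E_center (sphere_moment_even is_mean_affine_sphere tr_kerproj kerproj_idem
  mxtrace_kerproj E_supp S_norm E_reflection j m0 (zPP z)).
by rewrite -[in LHS]tr_kerproj -dot_mulmx tr_kerproj zPP.
Qed.

End affine_sphere.

(** * The limit *)

Section proj_span.
Context {R : realType} {n : nat}.

(** The factor [enorm v ^+ 2] cancels the normalization of the projection, so the formula also holds
    at [v = 0] and makes the covariance polynomial in the truncations. *)
Lemma sqr_enorm_proj_span (v : 'rV[R]_n) : enorm v ^+ 2 *: proj_span v = v^T *m v.
Proof.
have [->|v0] := eqVneq v 0; first by rewrite enorm0 expr0n/= scale0r trmx0 mulmx0.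
have vv0 : dot v v != 0 by rewrite dotxx_eq0.
have vT (x : 'rV[R]_n) : x *m v^T = (dot x v)%:M by rewrite dotE [LHS]mx11_scalar.
have dir : (<<v>> :&: kermx v^T = 0)%MS.
  apply/eqP; rewrite -submx0; apply/rV_subP => w; rewrite sub_capmx genmxE sub_kermx.
  move=> /andP[/sub_rVP[a ->]]; rewrite vT dotZl => /eqP /matrixP /(_ 0 0).
  by rewrite !mxE eqxx mulr1n => /eqP; rewrite mulf_eq0 (negPf vv0) orbF => /eqP ->; rewrite scale0r sub0mx.
rewrite sqr_enorm; apply/row_matrixP => i; rewrite !rowE; set x := delta_mx 0 i.
rewrite -scalemxAr mulmxA vT mul_scalar_mx.
have {1}-> : x = (dot x v / dot v v) *: v + (x - (dot x v / dot v v) *: v).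
  by rewrite addrC subrK.
rewrite mulmxDl /proj_span (proj_mx_id dir) ?scalemx_sub ?genmxE// (proj_mx_0 dir).
  by rewrite addr0 scalerA mulrCA divff// mulr1.
by rewrite sub_kermx mulmxBl -scalemxAl !vT scale_scalar_mx divfK// subrr.
Qed.

End proj_span.

(** * The data of the theorem in matrix form *)

Section coefficient_matrix.
Context {R : realType} {gamma : nat}.
Variable u : 'I_gamma -> nat -> R.

Definition coeff_mx n : 'M[R]_(gamma, n) := \matrix_(i, j) u i j.

Let trunc_row n i : trunc n (u i) = row i (coeff_mx n).
Proof. by apply/rowP => j; rewrite !mxE. Qed.

Lemma eta_barE (p : 'I_gamma -> R) k : eta_bar u p k = (\row_i p i) *m coeff_mx k.
Proof.
by rewrite mulmx_sum_row; apply: eq_bigr => i _; rewrite mxE trunc_row.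
Qed.

Lemma cov_barE k : cov_bar u k = 1%:M - (coeff_mx k)^T *m coeff_mx k.
Proof.
congr (_ - _); apply/matrixP => a b; rewrite summxE mxE; apply: eq_bigr => i _.
by rewrite sqr_enorm_proj_span mxE big_ord1 !mxE.
Qed.

Lemma sphere_AE (p : 'I_gamma -> R) n :
  sphere_A u p n = affine_sphere (coeff_mx n) (\row_i p i) (Num.sqrt n%:R).
Proof.
have xU (x : 'rV[R]_n) i : (x *m (coeff_mx n)^T) 0 i = dot x (trunc n (u i)).
  by rewrite mxE; apply: eq_bigr => j _; rewrite !mxE.
apply/seteqP; split=> x [xr xp]; split=> //.
  by apply/rowP => i; rewrite xU mxE; exact: xp.
by move=> i; rewrite -xU xp mxE.
Qed.

Hypothesis ortho : l2_orthonormal u.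

(** [l2dot] is a [limn], so convergence has to be established first: [|a * b| <= a ^+ 2 + b ^+ 2]
    compares with the square-summable series. *)
Lemma cvg_gram i j : gram (coeff_mx n) i j @[n --> \oo] --> ((i == j)%:R : R).
Proof using ortho.
have [su l2] := ortho; rewrite -l2 /l2dot.
have -> : (fun n => gram (coeff_mx n) i j) = series (fun l => u i l * u j l).
  apply/funext => n; rewrite /series/= big_mkord mxE.
  by apply: eq_bigr => l _; rewrite !mxE.
apply: normed_cvg; apply: (@series_le_cvg _ _ (fun l => u i l ^+ 2 + u j l ^+ 2)).
- by move=> l; exact: normr_ge0.
- by move=> l; rewrite addr_ge0 ?sqr_ge0.
- move=> l; rewrite ler_norml; have := sqr_ge0 (u i l - u j l).
  by have := sqr_ge0 (u i l + u j l); nra.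
- rewrite (_ : series _ = series (fun l => u i l ^+ 2) + series (fun l => u j l ^+ 2)).
    by apply: is_cvgD; exact: su.
  by apply/funext => n; rewrite /series/= big_split.
Qed.

End coefficient_matrix.

(** * Inverses of matrices close to the identity *)

Section inverse_perturbation.
Context {R : realType} {g : nat}.
Implicit Types (G : 'M[R]_g) (a b : 'rV[R]_g).

Let dot_bound a b : `|dot a b| <= `|a| * \sum_i `|b 0 i|.
Proof.
rewrite mulr_sumr; apply: le_trans (ler_norm_sum _ _ _) _; apply: ler_sum => i _.
by rewrite normrM ler_wpM2r// normr_coord_le.
Qed.

Let mulmx_small (D : 'M[R]_g) e a : (forall i j, `|D i j| <= e) -> 0 <= e ->
  `|a *m D| <= g%:R * e * `|a|.
Proof.
move=> De e0; apply: normr_rV_leP => [|j]; first by rewrite !mulr_ge0.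
rewrite mxE; apply: le_trans (ler_norm_sum _ _ _) _.
apply: (@le_trans _ _ (\sum_(i < g) e * `|a|)); last first.
  by rewrite sumr_const card_ord -[leLHS]mulr_natl mulrA.
by apply: ler_sum => i _; rewrite normrM mulrC ler_pM// normr_coord_le.
Qed.

(** A row [y] of the kernel satisfies [y *m (G - 1) = - y], hence [|y| <= |y| / 2]. *)
Lemma unitmx_near1 G e : (forall i j, `|(G - 1%:M) i j| <= e) -> 0 <= e ->
  g%:R * e <= 2^-1 -> G \in unitmx.
Proof.
move=> Ge e0 ge; rewrite -row_free_unit -kermx_eq0; apply/eqP/row_matrixP => i.
have := row_sub i (kermx G); rewrite sub_kermx row0; set y := row i _ => /eqP yG.
have yD : y *m (G - 1%:M) = - y by rewrite mulmxBr yG mulmx1 sub0r.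
have := mulmx_small y Ge e0; rewrite yD normrN => yy.
apply/eqP; rewrite -normr_eq0 eq_le normr_ge0 andbT.
have := ler_wpM2r (normr_ge0 y) ge; lra.
Qed.

(** For [y = a *m invmx G] the difference [y - a] is [- y *m (G - 1)], which first gives
    [|y| <= 2 * |a|] and then the bound. *)
Lemma invmx_near1 G e a b : (forall i j, `|(G - 1%:M) i j| <= e) -> 0 <= e ->
  g%:R * e <= 2^-1 ->
  `|dot (a *m invmx G) b - dot a b| <= e * (2 * g%:R * `|a| * \sum_i `|b 0 i|).
Proof.
move=> Ge e0 ge; have uG := unitmx_near1 Ge e0 ge; set y := a *m invmx G.
have yG : y *m G = a by rewrite mulmxKV.
have yD : y - a = - (y *m (G - 1%:M)) by rewrite mulmxBr yG mulmx1 opprB.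
have sm := mulmx_small y Ge e0.
have y2 : `|y| <= 2 * `|a|.
  have := ler_normD (y - a) a; rewrite subrK yD normrN.
  have := ler_wpM2r (normr_ge0 y) ge; lra.
rewrite -dotBl yD; apply: le_trans (dot_bound _ _) _; rewrite normrN.
rewrite !mulrA ler_wpM2r ?sumr_ge0//; apply: le_trans sm _.
rewrite -!mulrA mulrCA ler_wpM2l// mulrCA ler_wpM2l// .
Qed.

End inverse_perturbation.

(** * Limit of the inverse Gram matrices *)

Section gram_limit.
Context {R : realType} {gamma : nat}.
Variable u : 'I_gamma -> nat -> R.
Hypothesis ortho : l2_orthonormal u.
Notation U := (coeff_mx u).

Lemma gram_near1 e : 0 < e ->
  \forall n \near \oo, forall i j, `|(gram (U n) - 1%:M) i j| <= e.
Proof using ortho.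
move=> e0; apply: filter_forall => i; apply: filter_forall => j.
have /cvgr_dist_le/(_ _ e0) := @cvg_gram _ _ _ ortho i j.
by apply: filterS => n; rewrite distrC !mxE.
Qed.

Lemma gram_unitmx_near : \forall n \near \oo, gram (U n) \in unitmx.
Proof using ortho.
(* This is at most [1 / (2 * gamma)] and remains meaningful for [gamma = 0]. *)
have e0 : 0 < (2 * gamma%:R + 1)^-1 :> R by rewrite invr_gt0 ltr_wpDl.
apply: filterS (gram_near1 e0) => n Gn.
apply: (unitmx_near1 Gn); first exact: ltW.
rewrite ler_pdivrMr ?ltr_wpDl//.
have : 0 <= gamma%:R :> R by []. 
lra.
Qed.

Lemma cvg_invmx_gram (a b : 'rV[R]_gamma) :
  dot (a *m invmx (gram (U n))) b @[n --> \oo] --> dot a b.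
Proof using ortho.
apply/cvgrPdist_le => e e0.
set K := 2 * gamma%:R * `|a| * \sum_i `|b 0 i|.
have K0 : 0 <= K by rewrite !mulr_ge0// sumr_ge0.
pose d := Num.min (e / (K + 1)) (2 * gamma%:R + 1)^-1.
have d1 : 0 < e / (K + 1) by rewrite divr_gt0// ltr_wpDl.
have d2 : 0 < (2 * gamma%:R + 1)^-1 :> R by rewrite invr_gt0 ltr_wpDl.
have d0 : 0 < d by rewrite lt_min d1.
apply: filterS (gram_near1 d0) => n Gn; rewrite distrC.
apply: le_trans (invmx_near1 a b Gn (ltW d0) _) _.
  have : gamma%:R * d <= gamma%:R * (2 * gamma%:R + 1)^-1.
    by rewrite ler_wpM2l// ge_min lexx orbT.
  move=> /le_trans; apply; rewrite ler_pdivrMr ?ltr_wpDl//.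
  have : 0 <= gamma%:R :> R by [].
  lra.
rewrite -/K; apply: (@le_trans _ _ (e / (K + 1) * (K + 1))).
  apply: ler_pM => //; first exact: ltW.
    by rewrite ge_min lexx.
  by rewrite lerDl.
by rewrite divfK// gt_eqF// ltr_wpDl.
Qed.

End gram_limit.

(** * Restriction to the first coordinates *)

Section first_coordinates.
Context {R : realType} {k : nat}.

Definition coord_mx n : 'M[R]_(n, k) := \matrix_(l, j) (l == j :> nat)%:R.

Lemma first_coordsE n (x : 'rV[R]_n) : first_coords k x = x *m coord_mx n.
Proof.
apply/rowP => j; rewrite !mxE; case: insubP => [l _ lj|nj].
  rewrite (bigD1 l)//= mxE lj eqxx mulr1 big1 ?addr0// => l' l'l.
  by rewrite mxE -lj (inj_eq val_inj) (negPf l'l) mulr0.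
rewrite big1// => l _; rewrite mxE; case: eqP => [lj|]; last by rewrite mulr0.
by rewrite -lj ltn_ord in nj.
Qed.

Lemma coeff_coord_mx gamma (u : 'I_gamma -> nat -> R) n : (k <= n)%N ->
  coeff_mx u n *m coord_mx n = coeff_mx u k.
Proof.
move=> kn; apply/matrixP => i j; rewrite !mxE (bigD1 (widen_ord kn j))//= !mxE eqxx mulr1.
rewrite big1 ?addr0// => l lj; rewrite !mxE.
have /negPf -> : l != j :> nat by apply: contra lj => /eqP lj; exact/eqP/val_inj.
by rewrite mulr0.
Qed.

Lemma tr_coord_mx n : (k <= n)%N -> (coord_mx n)^T *m coord_mx n = 1%:M.
Proof.
move=> kn; apply/matrixP => i j; rewrite !mxE (bigD1 (widen_ord kn j))//= !mxE eqxx mulr1.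
rewrite big1 ?addr0 => [|l lj]; first by rewrite eq_sym.
have /negPf lj' : l != j :> nat by apply: contra lj => /eqP lj; exact/eqP/val_inj.
by rewrite !mxE lj' mulr0.
Qed.

Lemma poly_growth_first_coords n (f : 'rV[R]_k -> R) : poly_growth f ->
  poly_growth (fun x : 'rV[R]_n => f (first_coords k x)).
Proof.
move=> pf; have [K [N [K0 fK]]] := poly_growth_ge0 pf.
have [C C0 xC] := normr_mulmx_bound (coord_mx n).
split.
  move=> x; apply: continuous_comp; last exact: pf.1.
  apply/(@cvgrPdist_le _ _ _ (nbhs x) (nbhs_filter x)) => e e0.
  apply/nbhs_ballP; exists (e / C); first exact: divr_gt0.
  move=> y; rewrite -ball_normE /ball_/= => xy.
  by rewrite !first_coordsE -mulmxBl (le_trans (xC _))// mulrC -ler_pdivlMr// ltW.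
exists (K * (1 + C) ^+ N), N => x; apply: le_trans (fK _) _.
rewrite -mulrA ler_wpM2l// -exprMn lerXn2r ?nnegrE ?mulr_ge0 ?addr_ge0 ?(ltW C0)//.
rewrite first_coordsE; have := xC x; have := normr_ge0 x.
move: (`|x|) (`|x *m _|) => a b; nra.
Qed.

End first_coordinates.

(** * Convergence of moments and of integrals on the spheres *)

Section main.
Context {R : realType} {k gamma : nat}.
Variables (u : 'I_gamma -> nat -> R) (p : 'I_gamma -> R).
Hypothesis ortho : l2_orthonormal u.
Notation U := (coeff_mx u).
Let P : 'rV[R]_gamma := \row_i p i.
Let S n := affine_sphere (U n) P (Num.sqrt n%:R).
Let c n := center (U n) P.

Let cc_cvg : dot (c n) (c n) @[n --> \oo] --> dot P P.
Proof.
apply: (@cvg_trans _ (dot (P *m invmx (gram (U n))) P @[n --> \oo]));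
  last exact: cvg_invmx_gram.
apply: near_eq_cvg.
apply: filterS (gram_unitmx_near ortho) => n uG.
by rewrite dot_center center_mulmx.
Qed.

Let cvg_exp (a_ : nat -> R) (a : R) j : a_ n @[n --> \oo] --> a -> a_ n ^+ j @[n --> \oo] --> a ^+ j.
Proof.
move=> aa; apply: (@continuous_cvg _ _ _ _ _ _ (fun x : R => x ^+ j) a); last exact: aa.
exact: exprn_continuous.
Qed.

(** For [k <= n], the vector [t] extended by zeros; linear forms in the first [k] coordinates are
    the forms given by padded vectors. *)
Let pad n (t : 'rV[R]_k) : 'rV[R]_n := t *m (coord_mx n)^T.

Let dot_first_coords n t (x : 'rV[R]_n) : dot t (first_coords k x) = dot (pad n t) x.
Proof. by rewrite first_coordsE dotC dot_mulmx dotC. Qed.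

Let pad_mulmx n t : (k <= n)%N -> pad n t *m (U n)^T = t *m (U k)^T.
Proof. by move=> kn; rewrite -mulmxA -trmx_mul coeff_coord_mx. Qed.

Let dot_pad n t : (k <= n)%N -> dot (pad n t) (pad n t) = dot t t.
Proof.
by move=> kn; rewrite {1}/pad dot_mulmx trmxK /pad -mulmxA tr_coord_mx// mulmx1.
Qed.

Let var_ n t := dot (pad n t *m kerproj (U n)) (pad n t).
Let var t := dot (t *m cov_bar u k) t.

Let varE t : var t = dot t t - dot (t *m (U k)^T) (t *m (U k)^T).
Proof.
rewrite /var cov_barE mulmxBr mulmx1 dotBl; congr (_ - _).
by rewrite mulmxA; exact: dot_mulmx.
Qed.

Let var_cvg t : var_ n t @[n --> \oo] --> var t.
Proof.
rewrite varE; apply: (@cvg_trans _ ((dot t t -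
    dot (t *m (U k)^T *m invmx (gram (U n))) (t *m (U k)^T)) @[n --> \oo])).
  apply: near_eq_cvg; apply: filterS (nbhs_infty_ge k) => n /= kn.
  by rewrite /var_ dot_kerproj dot_pad// pad_mulmx.
by apply: cvgB; [exact: cvg_cst|exact: cvg_invmx_gram].
Qed.

(** Bessel's inequality, obtained as a limit: each [var_ n t] with invertible Gram matrix is the
    squared length of a projection. *)
Let var_ge0 t : 0 <= var t.
Proof.
apply: cvgr_to_ge (@var_cvg t) _; apply: filterS (gram_unitmx_near ortho) => n uG.
rewrite /var_ -(kerproj_idem uG) mulmxA dot_mulmx tr_kerproj; exact: dotxx_ge0.
Qed.

Let cov_sym : (cov_bar u k)^T = cov_bar u k.
Proof. by rewrite cov_barE linearB/= trmx1 trmx_mul trmxK. Qed.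

Let m_ n t := dot t (first_coords k (c n)).
Let m t := dot t (eta_bar u p k).

Let m_cvg t : m_ n t @[n --> \oo] --> m t.
Proof.
rewrite /m eta_barE dotC dot_mulmx.
apply: (@cvg_trans _ (dot (P *m invmx (gram (U n))) (t *m (U k)^T) @[n --> \oo]));
  last exact: cvg_invmx_gram.
apply: near_eq_cvg.
apply: filterS (nbhs_infty_ge k) => n /= kn.
by rewrite /m_ dot_first_coords dot_center pad_mulmx.
Qed.

Let E_ n (f : 'rV[R]_k -> R) :=
  surface_mean (n - gamma - 1) (@S n) (fun x => f (first_coords k x)).

Let cc_near : \forall n \near \oo, dot (c n) (c n) <= dot P P + 1.
Proof.
have /cvgrPdist_le/(_ 1 ltr01) := cc_cvg.
by apply: filterS => n; rewrite ler_norml; lra.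
Qed.

(** The conditions under which the intersection is a genuine sphere: the last one says that the
    affine subspace passes closer to the origin than the radius. *)
Let good n := [/\ (gamma < n)%N, gram (U n) \in unitmx &
  dot (c n) (c n) < Num.sqrt n%:R ^+ 2].

Let good_near : \forall n \near \oo, good n.
Proof.
near=> n; split.
- by near: n; exact: nbhs_infty_gt.
- by near: n; exact: gram_unitmx_near.
rewrite sqr_sqrtr//; apply: (@le_lt_trans _ _ (dot P P + 1)).
  by near: n; exact: cc_near.
by near: n; exact: nbhs_infty_gtr.
Unshelve. all: by end_near. Qed.

Let mE_ n : good n -> is_mean (E_ n).
Proof.
move=> [gn uG cn]; have [e1 eD eZ e0] := is_mean_affine_sphere gn uG (sqrtr_ge0 _) cn.
split=> [|f g pf pg|a f pf|f pf f0]; rewrite /E_.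
- exact: e1.
- by rewrite eD//; exact: poly_growth_first_coords.
- by rewrite eZ//; exact: poly_growth_first_coords.
- by apply: e0 => //; exact: poly_growth_first_coords.
Qed.

Let ratio_cvg i : (Num.sqrt n%:R ^+ 2 - dot (c n) (c n)) /
  (n%:R - gamma%:R + i%:R) @[n --> \oo] --> (1 : R).
Proof.
apply/cvgrPdist_le => e e0.
(* The numerator of 1 minus the ratio is eventually at most [B] in absolute value, while the
   denominator exceeds [B / e]. *)
pose B : R := dot P P + 1 + gamma%:R + i%:R.
have B0 : 0 <= B by rewrite !addr_ge0// dotxx_ge0.
near=> n.
have cc : dot (c n) (c n) <= dot P P + 1 by near: n; exact: cc_near.
have cc0 := dotxx_ge0 (c n).
have nB : gamma%:R + B / e < n%:R by near: n; exact: nbhs_infty_gtr.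
have i0 : 0 <= i%:R :> R by [].
have g0 : 0 <= gamma%:R :> R by [].
have Be : 0 <= B / e by rewrite divr_ge0// ltW.
have D0 : 0 < n%:R - gamma%:R + i%:R :> R by lra.
have -> : 1 - (Num.sqrt n%:R ^+ 2 - dot (c n) (c n)) / (n%:R - gamma%:R + i%:R) =
    (dot (c n) (c n) - gamma%:R + i%:R) / (n%:R - gamma%:R + i%:R).
  by rewrite sqr_sqrtr//; field; rewrite gt_eqF.
rewrite normrM normfV (gtr0_norm D0) ler_pdivrMr//.
apply: (@le_trans _ _ B); first by rewrite /B ler_norml; lra.
have : e * (B / e) <= e * (n%:R - gamma%:R + i%:R) by rewrite ler_pM2l//; lra.
by rewrite mulrC divfK// gt_eqF.
Unshelve. all: by end_near. Qed.

Let moment_even_cvg t j : E_ n (fun x => (dot t x - m_ n t) ^+ j.*2) @[n --> \oo] -->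
  var t ^+ j * \prod_(i < j) i.*2.+1%:R.
Proof.
apply: (@cvg_trans _ ((var_ n t ^+ j * \prod_(i < j) (i.*2.+1%:R *
  ((Num.sqrt n%:R ^+ 2 - dot (c n) (c n)) / (n%:R - gamma%:R + i.*2%:R)))) @[n --> \oo])).
  apply: near_eq_cvg; apply: filterS good_near => n [gn uG cn].
  rewrite /var_ -(affine_sphere_moment_even gn uG (sqrtr_ge0 _) cn) /E_.
  by apply: surface_mean_supp => x _; rewrite /m_ !dot_first_coords.
apply: cvgM; first by apply: cvg_exp; exact: var_cvg.
apply: cvg_prod_seq => i; rewrite -[X in _ --> X]mulr1.
by apply: cvgM; [exact: cvg_cst|exact: ratio_cvg].
Qed.

Let moment_odd_cvg t j : odd j ->
  E_ n (fun x => (dot t x - m_ n t) ^+ j) @[n --> \oo] --> (0 : R).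
Proof.
move=> oj; apply: (@cvg_trans _ ((0 : R) @[n --> \oo])); last exact: cvg_cst.
apply: near_eq_cvg; apply: filterS good_near => n [gn uG cn].
rewrite -(affine_sphere_moment_odd gn uG (sqrtr_ge0 _) cn (pad n t) oj) /E_.
by apply: surface_mean_supp => x _; rewrite /m_ !dot_first_coords.
Qed.

Let mu := gaussian_measure (eta_bar u p k) (cov_bar u k).
Let E := prob_mean mu.

Let gmu : is_gaussian mu.
Proof. by have [] := gaussian_measureP (eta_bar u p k) cov_sym var_ge0. Qed.

Let mE : is_mean E.
Proof. exact: is_mean_prob_mean. Qed.

Let E_moment t : exists2 s, s ^+ 2 = var t &
  forall j, E (fun x => (dot t x - m t) ^+ j) = s ^+ j * std_moment j.
Proof.
have [_ hm hC] := gaussian_measureP (eta_bar u p k) cov_sym var_ge0.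
exact: gaussian_centered_moment.
Qed.

Let E_moment_even t j : E (fun x => (dot t x - m t) ^+ j.*2) =
  var t ^+ j * \prod_(i < j) i.*2.+1%:R.
Proof.
have [s s2 ->] := E_moment t.
by rewrite std_moment_even -s2 -exprM mul2n.
Qed.

Let moment_cvg t j : E_ n (fun x => (dot t x - m_ n t) ^+ j) @[n --> \oo] -->
  E (fun x => (dot t x - m t) ^+ j).
Proof.
have [oj|ej] := boolP (odd j).
  have [s _ ->] := E_moment t; rewrite std_moment_odd// mulr0; exact: moment_odd_cvg.
by rewrite -(even_halfK ej) E_moment_even; exact: moment_even_cvg.
Qed.

Let moment_small t :
  E (fun x => (dot t x - m t) ^+ j.*2) / j.*2`!%:R @[j --> \oo] --> (0 : R).
Proof.
under eq_fun do rewrite E_moment_even.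
exact: gaussian_moment_small.
Qed.

(** The second moment about 0, expressed by the moments about [a] whose convergence is known. *)
Let square_mean (F : ('rV[R]_k -> R) -> R) i a : is_mean F ->
  F (fun x => x 0 i ^+ 2) = F (fun x => (dot (delta_mx 0 i) x - a) ^+ 2) +
    (2 * a * F (fun x => (dot (delta_mx 0 i) x - a) ^+ 1) + a ^+ 2).
Proof.
move=> mF; pose d (x : 'rV[R]_k) := dot (delta_mx 0 i) x - a.
have pd j : poly_growth (fun x => d x ^+ j).
  by apply: poly_growthX; apply: poly_growthB (poly_growth_cst _); exact: poly_growth_dot.
rewrite -(meanZ mF _ (pd 1%N)) -[in X in _ + (_ + X)](mean_cst mF (a ^+ 2)).
rewrite -(meanD mF (poly_growthZ _ (pd 1%N)) (poly_growth_cst _)).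
rewrite -(meanD mF (pd 2%N)).
  by congr F; apply/funext => x; rewrite /d dot_delta; ring.
exact: poly_growthD (poly_growthZ _ (pd 1%N)) (poly_growth_cst _).
Qed.

Let square_cvg i : E_ n (fun x => x 0 i ^+ 2) @[n --> \oo] --> E (fun x => x 0 i ^+ 2).
Proof.
rewrite (square_mean _ (m (delta_mx 0 i)) mE).
pose t : 'rV[R]_k := delta_mx 0 i.
apply: (@cvg_trans _ ((E_ n (fun x => (dot t x - m_ n t) ^+ 2) +
    (2 * m_ n t * E_ n (fun x => (dot t x - m_ n t) ^+ 1) + m_ n t ^+ 2)) @[n --> \oo])).
  apply: near_eq_cvg; apply: filterS good_near => n gn.
  by rewrite -square_mean//; exact: mE_.
apply: cvgD; first exact: moment_cvg.
apply: cvgD; last by apply: cvg_exp; exact: m_cvg.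
apply: cvgM; last exact: moment_cvg.
by apply: cvgM; [exact: cvg_cst|exact: m_cvg].
Qed.

Let E_cvg f (M : R) : continuous f -> (forall x, `|f x| <= M) ->
  E_ n f @[n --> \oo] --> E f.
Proof.
have near_mE : \forall n \near \oo, is_mean (E_ n).
  by apply: filterS good_near => n; exact: mE_.
have sq_ge0 i : 0 <= E (fun x => x 0 i ^+ 2).
  apply: (mean_ge0 mE) => [|x]; last exact: sqr_ge0.
  by apply: poly_growthX; exact: poly_growth_coord.
have sq_le i : E (fun x => x 0 i ^+ 2) <= \sum_i E (fun x => x 0 i ^+ 2).
  by rewrite (bigD1 i)//= lerDl sumr_ge0.
(* The limiting second moments are finite in number, so their sum plus 1 eventually bounds the
   second moments along the sequence as well. *)
apply: (@mean_cvg _ _ E_ E (1 + \sum_i E (fun x => x 0 i ^+ 2))) => //.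
- move=> t; apply: (cvg_cos_of_moments near_mE mE (@m_cvg t)) => [j|].
    exact: moment_cvg.
  exact: moment_small.
- move=> t; apply: (cvg_sin_of_moments near_mE mE (@m_cvg t)) => [j|].
    exact: moment_cvg.
  exact: moment_small.
- move=> i; have /cvgrPdist_le/(_ 1 ltr01) := @square_cvg i.
  apply: filterS => n; rewrite ler_norml => /andP[h _].
  by move: h (sq_le i); lra.
- by move=> i; move: (sq_le i); lra.
Qed.

Lemma surface_integral_cvg f (M : R) : continuous f -> (forall x, `|f x| <= M) ->
  (\int[sigma_bar u p n]_(x in sphere_A u p n) (f (first_coords k x))%:E)%E
    @[n --> \oo] --> (\int[mu]_x (f x)%:E)%E.
Proof using ortho.
move=> cf fM; have pf := poly_growth_bounded cf fM.
rewrite (EFin_prob_mean gmu pf).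
apply: (@cvg_trans _ ((E_ n f)%:E @[n --> \oo])); last first.
  by apply: cvg_EFin; [exact: nearW|exact: E_cvg fM].
apply: near_eq_cvg; apply: filterS good_near => n [gn uG cn].
have /andP[h0 hoo] := hausdorff_affine_sphere gn uG (sqrtr_ge0 _) cn.
rewrite /sigma_bar sphere_AE.
have := EFin_surface_mean (@closed_affine_sphere _ _ _ (U n) P (Num.sqrt n%:R))
  (@affine_sphere_bounded _ _ _ (U n) P (Num.sqrt n%:R)) h0 hoo
  (@poly_growth_first_coords _ _ n _ pf).
by move=> /esym; exact.
Qed.

End main.

Theorem theorem4p3 (R : realType) (k gamma : nat)
    (u : 'I_gamma -> nat -> R) (p : 'I_gamma -> R) (f : 'rV[R]_k -> R) :
  l2_orthonormal u ->
  continuous f ->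
  (exists M : R, forall x, `|f x| <= M) ->
  (\int[sigma_bar u p n]_(x in sphere_A u p n) (f (first_coords k x))%:E)%E
    @[n --> \oo] -->
  (\int[gaussian_measure (eta_bar u p k) (cov_bar u k)]_x (f x)%:E)%E.
Proof.
move=> ortho cf [M fM].
by have := @surface_integral_cvg R k gamma u p ortho f M cf fM; exact.
Qed.
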